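(* For every integer $n \geq 5$, $\mathrm{sat}(n, K_{2,3}) = 2n - 3$; that is, every $K_{2,3}$-saturated graph on $n$ vertices has at least $2n-3$ edges, and there exist $K_{2,3}$-saturated graphs on $n$ vertices with exactly $2n-3$ edges.
   Context: All graphs are finite and simple. $K_{2,3}$ denotes the complete bipartite graph with parts of sizes $2$ and $3$. A graph $G$ is $K_{2,3}$-saturated if $G$ contains no subgraph (not necessarily induced) isomorphic to $K_{2,3}$, but for every pair of nonadjacent vertices $u,v$ of $G$, the graph $G+uv$ contains a subgraph isomorphic to $K_{2,3}$. $\mathrm{sat}(n,K_{2,3})$ denotes the minimum number of edges of a $K_{2,3}$-saturated graph on $n$ vertices. *)

(* Defs.v *)
From mathcomp Require Import all_boot.
Set Implicit Arguments. Unset Strict Implicit. Unset Printing Implicit Defensive.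

Definition simple_graph (T : finType) (g : rel T) : Prop :=
  (forall x, ~~ g x x) /\ (forall x y, g x y = g y x).

Definition num_edges (n : nat) (g : rel 'I_n) : nat :=
  #|[set p : 'I_n * 'I_n | (p.1 < p.2)%N && g p.1 p.2]|.

Definition has_K23 (T : finType) (g : rel T) : Prop :=
  exists a1 a2 b1 b2 b3 : T,
    uniq [:: a1; a2; b1; b2; b3] /\
    [&& g a1 b1, g a1 b2, g a1 b3, g a2 b1, g a2 b2 & g a2 b3].

Definition add_edge (T : finType) (g : rel T) (u v : T) : rel T :=
  fun x y => g x y || ((x == u) && (y == v)) || ((x == v) && (y == u)).

Definition K23_saturated (T : finType) (g : rel T) : Prop :=
  simple_graph g /\ ~ has_K23 g /\
  forall u v : T, u != v -> ~~ g u v -> has_K23 (add_edge g u v).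

(* Main.v *)
(** Lower bound. In a saturated graph two vertices have at most two common
    neighbours, and of two nonadjacent vertices [u], [v] one has a neighbour
    sharing two neighbours with the other. Fix a root [v] of minimum degree, and
    call its neighbours hubs; any other vertex [x] has [h x <= 2] hub neighbours.
    Counting degrees, the sum of all degrees is at least [4 n - 6] exactly when the
    charges [deg x + h x - 4] of the non-neighbours [x <> v] of the root sum to at
    least [2 deg v - 2 t - 2], with [t] the number of edges between hubs; by parity
    more than [2 deg v - 2 t - 4] is enough. Applied to [v] and [x], saturation gives
    [x] two neighbours on one hub, or a neighbour with two hubs, so only vertices
    without hubs or with a single one can be short, and their neighbours can pay for
    them. The rules for the payments depend on the degree of the root (one, two or
    three; degree four is trivial) and on the smallest possible [t]; the few vertices
    that stay short are handled by applying saturation to further pairs.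

    Upper bound. Join a vertex to all vertices of the disjoint union of a cycle of
    length [n - 2] and an isolated vertex, or of a triangle and an edge when [n = 6]:
    a cycle of length four would contain two vertices with two common neighbours
    besides the apex. *)
Require Import Defs.
From mathcomp Require Import all_boot all_order all_algebra.
From mathcomp Require Import zify.
Set Implicit Arguments. Unset Strict Implicit. Unset Printing Implicit Defensive.
Import GRing.Theory Num.Theory.

(* [lia] preceded by the removal of the boolean hypotheses, each of which it would otherwise split on. *)
Ltac alia :=
  repeat match goal with
  | H : is_true ?b |- _ =>
      lazymatch b with
      | leq _ _ => fail
      | @Order.le _ _ _ _ => fail
      | @Order.lt _ _ _ _ => fail
      | @eq_op _ ?a _ => first [(let x := constr:((a : nat)) in idtac); fail 1 | clear H]
      | negb (@eq_op _ ?a _) => first [(let x := constr:((a : nat)) in idtac); fail 1 | clear H]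
      | _ => clear H
      end
  | H : @eq bool ?b _ |- _ =>
      lazymatch b with leq _ _ => fail | _ => clear H end
  end; lia.

(** The value that the sum of the charges must exceed depends on the root: it is [-2] for degree
    one, [0] or [-2] for degree two without or with the edge between the hubs, and [2], [0] or at
    most [-2] for degree three with no, one or at least two such edges. A root with few edges
    between its hubs thus demands the most. It is nevertheless taken first: once there is none,
    every vertex of minimum degree has edges in its neighbourhood ([tau_pos], [tau4]), and these
    triangles fix the surroundings of the vertices that are short.

    The obstacle is that the payments do not make all charges nonnegative. The exceptions are
    isolated as predicates ([deficient], [special], [tail], [poor]). Two vertices of such a kind
    have so few neighbours that saturation between them, or a forbidden copy of $K_{2,3}$, bounds
    their number by two or one. The same kind of argument then finds enough vertices of positive
    charge elsewhere, where [units] held by different vertices have to be shown distinct. *)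

Definition ndeg (T : finType) (g : rel T) (x : T) (Q : pred T) : nat :=
  #|[pred y | g x y && Q y]|.

(* The copy of K_{2,3} created by the edge [u v] has [v] and [t] as its part of size two. *)
Definition linked (T : finType) (g : rel T) (u v : T) : Prop :=
  exists t y1 y2, [/\ g u t, t != v & y1 != y2] /\
    [/\ g t y1, g t y2, g v y1 & g v y2].

(** * Counting neighbours *)

Section Count.
Variables (T : finType) (g : rel T).
Implicit Types (x y : T) (Q P : pred T).
Local Notation d := (ndeg g).

Lemma ndegE x Q : d x Q = \sum_y (g x y && Q y).
Proof. rewrite /ndeg -sum1_card big_mkcond /=; apply: eq_bigr => y _.
by rewrite inE; case: (_ && _). Qed.

Lemma eq_ndeg x Q P : (forall y, g x y -> Q y = P y) -> d x Q = d x P.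
Proof. by move=> H; apply: eq_card => y; rewrite !inE; case E: (g x y) => //=; rewrite H. Qed.

Lemma ndeg_le x Q P : (forall y, g x y -> Q y -> P y) -> d x Q <= d x P.
Proof.
move=> H; apply: subset_leq_card; apply/subsetP=> y; rewrite !inE => /andP[a b].
by rewrite a H.
Qed.

Lemma ndegU x Q P : (forall y, g x y -> Q y -> ~~ P y) ->
  d x (fun y => Q y || P y) = d x Q + d x P.
Proof.
move=> H; rewrite !ndegE -big_split /=; apply: eq_bigr => y _.
by case E: (g x y) => //=; case F: (Q y) => //=; rewrite (negbTE (H _ E F)).
Qed.

Lemma ndegC x Q : d x predT = d x Q + d x (fun y => ~~ Q y).
Proof.
rewrite -ndegU; last by move=> y _ ->.
by apply: eq_ndeg => y _; rewrite /= orbN.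
Qed.

Lemma ndeg0 x Q y : d x Q = 0 -> g x y -> Q y = false.
Proof. by move=> /card0_eq H E; have := H y; rewrite !inE E. Qed.

Lemma ndeg_ge1 x Q y : g x y -> Q y -> 0 < d x Q.
Proof. by move=> a b; apply/card_gt0P; exists y; rewrite inE a b. Qed.

Lemma ndeg_gt0 x Q : 0 < d x Q -> exists y, g x y /\ Q y.
Proof. by case/card_gt0P=> y; rewrite inE => /andP[]; exists y. Qed.

Lemma ndeg_uniq x Q (s : seq T) : uniq s -> all (fun y => g x y && Q y) s -> size s <= d x Q.
Proof.
move=> us /allP al; rewrite -(card_uniqP us); apply: subset_leq_card.
by apply/subsetP=> y ys; rewrite inE; apply: al.
Qed.

Lemma ndeg_ge2 x Q y z : y != z -> g x y -> Q y -> g x z -> Q z -> 1 < d x Q.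
Proof. by move=> n a b c e; apply: (@ndeg_uniq x Q [:: y; z]); rewrite /= ?inE ?n ?a ?b ?c ?e. Qed.

Lemma ndeg_ge3 x Q y z t : y != z -> y != t -> z != t ->
  g x y -> Q y -> g x z -> Q z -> g x t -> Q t -> 2 < d x Q.
Proof.
move=> n1 n2 n3 a b c e p q.
by apply: (@ndeg_uniq x Q [:: y; z; t]); rewrite /= ?inE ?negb_or ?n1 ?n2 ?n3 ?a ?b ?c ?e ?p ?q.
Qed.

Lemma ndeg_gt1 x Q : 1 < d x Q -> exists y z, [/\ y != z, g x y, Q y, g x z & Q z].
Proof.
case/card_gt1P=> y [z [a b c]]; exists y, z.
by move: a b; rewrite !inE => /andP[-> ->] /andP[-> ->].
Qed.

Lemma ndeg_all x Q (s : seq T) : uniq s -> all (fun y => g x y && Q y) s ->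
  d x Q <= size s -> forall y, g x y -> Q y -> y \in s.
Proof.
move=> us al le y a b; apply/negPn/negP=> ny.
have := @ndeg_uniq x Q (y :: s); rewrite /= ny us a b al => /(_ isT isT).
by lia.
Qed.

Lemma ndeg_le2 x Q y z : d x Q <= 2 -> y != z -> g x y -> Q y -> g x z -> Q z ->
  forall t, g x t -> Q t -> t = y \/ t = z.
Proof.
move=> le n a b c e t f h.
have := @ndeg_all x Q [:: y; z]; rewrite /= ?inE n a b c e => /(_ isT isT le t f h).
by rewrite !inE => /orP[] /eqP; [left|right].
Qed.

Lemma ndeg_le1 x Q y : d x Q <= 1 -> g x y -> Q y ->
  forall t, g x t -> Q t -> t = y.
Proof.
move=> le a b t f h.
have := @ndeg_all x Q [:: y]; rewrite /= a b => /(_ isT isT le t f h).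
by rewrite !inE => /eqP.
Qed.

Lemma ndeg_le3 x Q y z w : d x Q <= 3 -> y != z -> y != w -> z != w ->
  g x y -> Q y -> g x z -> Q z -> g x w -> Q w ->
  forall t, g x t -> Q t -> [\/ t = y, t = z | t = w].
Proof.
move=> le n1 n2 n3 a b c e p q t f h.
have := @ndeg_all x Q [:: y; z; w].
rewrite /= ?inE ?negb_or n1 n2 n3 a b c e p q => /(_ isT isT le t f h).
by rewrite !inE => /or3P[] /eqP ->; [constructor 1|constructor 2|constructor 3].
Qed.

Hypothesis gs : symmetric g.

(** Double counting of the adjacent pairs [x], [y] with [P x] and [Q y]. *)
Lemma sum_swap (P Q : pred T) :
  \sum_(x | P x) d x Q = \sum_(y | Q y) d y P.
Proof.
under eq_bigr do rewrite ndegE.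
under [RHS]eq_bigr do rewrite ndegE.
rewrite [LHS]big_mkcond [RHS]big_mkcond /=.
rewrite (eq_bigr (fun x => \sum_y (P x && Q y && g x y))); last first.
  move=> x _; case: (P x); last by rewrite big1.
  by apply: eq_bigr => y _; rewrite /= andbC.
rewrite exchange_big /=; apply: eq_bigr => y _.
case: (Q y); last by rewrite big1 // => x _; rewrite andbF.
by apply: eq_bigr => x _; rewrite andbT gs andbC.
Qed.

End Count.

(** * Degree sum and number of edges *)

Section Handshake.
Variables (n : nat) (g : rel 'I_n).
Hypotheses (gs : symmetric g) (gi : irreflexive g).

Lemma handshake : \sum_x ndeg g x predT = 2 * num_edges g.
Proof.
have E1 : num_edges g = \sum_(x : 'I_n) \sum_(y : 'I_n) ((x < y) && g x y).
  rewrite /num_edges -sum1_card pair_bigA /= big_mkcond /=.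
  by apply: eq_bigr => p _; rewrite inE; case: (_ && _).
have E2 : num_edges g = \sum_(x : 'I_n) \sum_(y : 'I_n) ((y < x) && g x y).
  by rewrite E1 exchange_big; apply: eq_bigr => x _; apply: eq_bigr => y _; rewrite gs.
rewrite mul2n -addnn {1}E1 E2 -big_split /=; apply: eq_bigr => x _.
rewrite ndegE -big_split /=; apply: eq_bigr => y _.
case: (ltngtP x y) => [_|_|/val_inj ->]; rewrite ?gi ?andbT ?addn0 ?add0n //.
Qed.
End Handshake.

(** * Saturation turned into links *)

Section Sat.
Variables (T : finType) (g : rel T).
Hypothesis sat : K23_saturated g.

Lemma gsym : symmetric g. Proof. by case: sat => [[_ H] _]. Qed.
Lemma girr : irreflexive g. Proof. by case: sat => [[H _] _] x; apply/negbTE. Qed.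
Lemma gneq x y : g x y -> x != y. Proof. by apply: contraTneq => ->; rewrite girr. Qed.

Lemma K23_free a b x y z : a != b -> x != y -> x != z -> y != z ->
  g a x -> g a y -> g a z -> g b x -> g b y -> g b z -> False.
Proof.
case: sat => [_ [H _]] ab xy xz yz ax ay az bx by' bz; apply: H.
exists a, b, x, y, z; split; last by rewrite ax ay az bx by' bz.
by rewrite /= !inE !negb_or ab xy xz yz !gneq.
Qed.

(** A copy of $K_{2,3}$ in [g + uv] uses the new edge. If this edge joins [a] in the part of size
    two to [p], the other vertex [c] of that part is a neighbour of [p] and shares the two remaining
    vertices with [a], so [p] is linked to [a]. *)
Lemma nonadj_linked u v : u != v -> ~~ g u v -> linked g u v \/ linked g v u.
Proof.
case: sat => [_ [H1 H2]] uv guv.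
have [a1 [a2 [b1 [b2 [b3 [un]]]]]] := H2 u v uv guv.
have X (a c p q r : T) : a != c -> p != q -> p != r -> q != r ->
   a != p -> a != q -> a != r -> c != p -> c != q -> c != r ->
   add_edge g u v a p -> add_edge g u v a q -> add_edge g u v a r ->
   add_edge g u v c p -> add_edge g u v c q -> add_edge g u v c r ->
   ~~ g a p -> linked g u v \/ linked g v u.
  move=> ac pq pr qr ap aq ar cp cq cr + + + + + + nap.
  rewrite /add_edge (negbTE nap) /=.
  have L (s t : T) : (s == u) && (t == v) || (s == v) && (t == u) -> a = s -> p = t ->
      (g a q && g a r && g c p && g c q && g c r) -> linked g u v \/ linked g v u.
    move=> E Es Et /andP[/andP[/andP[/andP[g1 g2] g3] g4] g5]; subst s t.
    case/orP: E => /andP[/eqP Ea /eqP Ep]; subst a p.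
    - right; exists c, q, r; split; split=> //; first by rewrite gsym.
      by rewrite eq_sym.
    - left; exists c, q, r; split; split=> //; first by rewrite gsym.
      by rewrite eq_sym.
  move=> E aq' ar' cp' cq' cr'; apply: (L a p) => //.
  (* Any edge of the copy other than [a p] differs from it as an unordered pair and hence belongs to
     [g]. *)
  have D : forall s t, (s != a) || (t != p) -> (s != p) || (t != a) ->
      g s t || (s == u) && (t == v) || (s == v) && (t == u) -> g s t.
    move=> s t n1 n2; rewrite -orbA => /orP[//|].
    case/orP: E => /andP[/eqP Ea /eqP Ep]; subst a p;
    move=> /orP[] /andP[/eqP Es /eqP Et]; subst; rewrite ?eqxx // in n1 n2.
  have qp : q != p by rewrite eq_sym.
  have rp : r != p by rewrite eq_sym.
  have qa : q != a by rewrite eq_sym.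
  have ra : r != a by rewrite eq_sym.
  have ca : c != a by rewrite eq_sym.
  have F s t : (s != a) || (t != p) -> (s != p) || (t != a) ->
      g s t || (s == u) && (t == v) || (s == v) && (t == u) -> g s t.
    by move=> *; apply: D.
  clear D L.
  apply/andP; split; first apply/andP; first split; first apply/andP; first split;
    first apply/andP; first split.
  - by apply: (F a q) => //; rewrite ?qp ?ap ?orbT.
  - by apply: (F a r) => //; rewrite ?rp ?ap ?orbT.
  - by apply: (F c p) => //; rewrite ?ca ?cp.
  - by apply: (F c q) => //; rewrite ?ca ?cp.
  - by apply: (F c r) => //; rewrite ?ca ?cp.
move: un; rewrite /= !inE !negb_or.
move=> /and5P[/and4P[a12 a1b1 a1b2 a1b3] /and3P[a2b1 a2b2 a2b3] /andP[b12 b13] b23 _].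
move=> /and5P[e1 e2 e3 e4 /andP[e5 e6]].
have f12 : a2 != a1 by rewrite eq_sym.
have f21 : b2 != b1 by rewrite eq_sym.
have f31 : b3 != b1 by rewrite eq_sym.
have f32 : b3 != b2 by rewrite eq_sym.
case E1: (g a1 b1); last by apply: (X a1 a2 b1 b2 b3) => //; rewrite E1.
case E2: (g a1 b2); last by apply: (X a1 a2 b2 b1 b3) => //; rewrite E2.
case E3: (g a1 b3); last by apply: (X a1 a2 b3 b2 b1) => //; rewrite E3.
case E4: (g a2 b1); last by apply: (X a2 a1 b1 b2 b3) => //; rewrite E4.
case E5: (g a2 b2); last by apply: (X a2 a1 b2 b1 b3) => //; rewrite E5.
case E6: (g a2 b3); last by apply: (X a2 a1 b3 b2 b1) => //; rewrite E6.
by case: (@K23_free a1 a2 b1 b2 b3).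
Qed.
End Sat.

(** * Sums of charges and payments *)

Section Sums.
Variables (T : finType) (P : pred T).
Local Open Scope ring_scope.

Lemma sum_split (f : T -> int) x : P x ->
  \sum_(y | P y) f y = f x + \sum_(y | P y && (y != x)) f y.
Proof. by move=> Px; rewrite (bigD1 x). Qed.

Lemma sum_ge1 (f : T -> int) x : (forall y, P y -> 0 <= f y) -> P x ->
  f x <= \sum_(y | P y) f y.
Proof.
by move=> H Px; rewrite (bigD1 x) //= lerDl sumr_ge0 // => y /andP[/H].
Qed.

Lemma sum_ge2 (f : T -> int) x1 x2 : (forall y, P y -> 0 <= f y) ->
  P x1 -> P x2 -> x1 != x2 -> f x1 + f x2 <= \sum_(y | P y) f y.
Proof.
move=> H P1 P2 n; rewrite (bigD1 x1) //= (bigD1 x2) /=; last by rewrite P2 eq_sym.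
by rewrite addrA lerDl sumr_ge0 // => y /andP[/andP[/H]].
Qed.

Lemma sum_ge3 (f : T -> int) x1 x2 x3 : (forall y, P y -> 0 <= f y) ->
  P x1 -> P x2 -> P x3 -> x1 != x2 -> x1 != x3 -> x2 != x3 ->
  f x1 + f x2 + f x3 <= \sum_(y | P y) f y.
Proof.
move=> H P1 P2 P3 n12 n13 n23; rewrite (bigD1 x1) //= (bigD1 x2) /=; last by rewrite P2 eq_sym.
rewrite (bigD1 x3) /=; last by rewrite P3 !(eq_sym x3) n13.
by rewrite !addrA lerDl sumr_ge0 // => y /andP[/andP[/andP[/H]]].
Qed.

Lemma sum_Posz (f : T -> nat) : \sum_(x | P x) (f x)%:Z = (\sum_(x | P x) f x)%N%:Z.
Proof. by elim/big_rec2: _ => // x a b _ ->; rewrite PoszD. Qed.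

Lemma sum_indicator (N : pred T) : (forall x, N x -> P x) ->
  \sum_(x | P x) (N x : nat)%:Z = #|N|%:Z.
Proof.
move=> NP; rewrite sum_Posz -sum1_card big_mkcond [in RHS]big_mkcond /=; congr (Posz _).
apply: eq_bigr => x _; rewrite unfold_in; case n: (N x); first by rewrite NP.
by case: (P x).
Qed.

(** The principle behind all discharging below: what one vertex pays another receives, whatever the
    rule [pay]. *)
Lemma sum_transfer (c : T -> int) (pay : T -> T -> nat) :
  \sum_(x | P x) c x =
  \sum_(x | P x) (c x + (\sum_(y | P y) pay y x)%N%:Z - (\sum_(y | P y) pay x y)%N%:Z).
Proof.
rewrite sumrB big_split /=.
rewrite !sum_Posz exchange_big /=.
by rewrite addrK.
Qed.
End Sums.

(** * Charges relative to a root *)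

Section Root.
Variables (T : finType) (g : rel T).
Hypothesis sat : K23_saturated g.
Variable v : T.
Local Notation d := (ndeg g).
Let gs := gsym sat.

Definition hubs (x : T) : nat := d x (g v).
Definition outer (x : T) : bool := (x != v) && ~~ g v x.
Definition lone : pred T := fun x => outer x && (hubs x == 1).
Definition twin : pred T := fun x => outer x && (hubs x == 2).
Definition far : pred T := fun x => outer x && (hubs x == 0).

Lemma codeg_le2 a b : a != b -> d a (g b) <= 2.
Proof.
move=> ab; rewrite leqNgt; apply/negP => H.
move: H; rewrite /ndeg => /card_gt2P[x [y [z [[A1 A2 A3] [xy yz zx]]]]].
move: A1 A2 A3; rewrite !inE => /andP[ax bx] /andP[ay by'] /andP[az bz].
rewrite eq_sym in zx.
by apply: (K23_free sat ab xy zx yz).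
Qed.

Lemma codeg_eq a b x y : a != b -> x != y -> g a x -> g b x -> g a y -> g b y ->
  forall z, g a z -> g b z -> z = x \/ z = y.
Proof. by move=> ab xy ax bx ay by'; apply: (ndeg_le2 (codeg_le2 ab) xy). Qed.

Lemma hubs_le2 x : outer x -> hubs x <= 2.
Proof. by case/andP=> xv _; apply: codeg_le2. Qed.

Lemma outer_cases x : outer x -> [\/ lone x, twin x | far x].
Proof.
move=> o; have := hubs_le2 o; rewrite /lone /twin /far o /=.
case: (hubs x) => [|[|[|]]] //; by [constructor 1|constructor 2|constructor 3].
Qed.

Lemma outer_nv x : outer x -> ~~ g x v.
Proof. by case/andP=> _; rewrite gs. Qed.

Lemma outer_nbr x y : outer x -> g x y -> g v y \/ outer y.
Proof.
move=> o xy; case E: (g v y); [by left|right].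
by rewrite /outer E andbT; apply: contraTneq xy => ->; rewrite (negbTE (outer_nv o)).
Qed.

Lemma deg_split x : outer x -> d x predT = hubs x + d x lone + d x twin + d x far.
Proof.
move=> o; rewrite (ndegC g x (g v)) -!addnA; congr (_ + _).
rewrite -ndegU; last by move=> y _ /andP[oy /eqP E]; rewrite /far E andbF.
rewrite -ndegU; last first.
  by move=> y _ /andP[oy /eqP E]; rewrite /far /twin E !andbF.
apply: eq_ndeg => y xy.
case E: (g v y) => /=.
  by rewrite /lone /twin /far /outer E !andbF.
case: (outer_nbr o xy); first by rewrite E.
by case/outer_cases => ->; rewrite ?orbT.
Qed.

Local Open Scope ring_scope.
(** Edges from [x] to hubs count twice because the degrees of the hubs are booked on the outer
    vertices; [4] is the average degree to be reached, up to a constant. *)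
Definition charge (x : T) : int := (d x predT + hubs x)%:Z - 4.

(** A hub sees the root, other hubs and outer vertices. Its edges to outer vertices are counted from
    their outer ends, where they appear as [hubs]. *)
Lemma sum_deg : (\sum_x d x predT =
  2 * d v predT + \sum_(h | g v h) d h (g v) + \sum_(x | outer x) (d x predT + hubs x))%N.
Proof.
have gi := girr sat.
rewrite (bigD1 v) //= (bigID (g v)) /=.
rewrite (eq_bigl (g v)); last first.
  by move=> x; case E: (g v x); rewrite ?andbT ?andbF //=; rewrite eq_sym (gneq sat).
rewrite [X in (_ + (_ + X))%N](eq_bigl outer) // [X in (_ + X)%N = _]addnC.
rewrite big_split /= -/(hubs _).
have -> : (\sum_(i | outer i) hubs i = \sum_(h | g v h) d h outer)%N.
  by rewrite (sum_swap gs).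
have -> : (\sum_(h | g v h) d h predT = d v predT + \sum_(h | g v h) d h (g v) + \sum_(h | g v h) d h outer)%N.
  have -> : d v predT = (\sum_(h | g v h) 1)%N.
    by rewrite sum1_card; apply: eq_card => y; rewrite !inE andbT.
  rewrite -!big_split /=; apply: eq_bigr => h vh.
  rewrite (ndegC g h (g v)) (addnC 1%N) -addnA; congr (_ + _)%N.
  have -> : 1%N = d h (pred1 v).
    rewrite /ndeg -(card1 v); apply: eq_card => y; rewrite !inE.
    by case: eqP => [->|]; rewrite ?andbF // gs vh.
  rewrite -ndegU; last by move=> y _ /= /eqP ->; rewrite /outer eqxx.
  apply: eq_ndeg => y hy /=; rewrite /outer; case: eqP => [->|] //=; by rewrite gi.
lia.
Qed.

(** There are [#|T| - 1 - deg v] outer vertices, so [4 * #|T|] splits into their fours and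
    [4 * deg v + 4]; [sum_deg] offsets the latter by [2 * deg v] and the edges between hubs. *)
Lemma charge_bound : (2 * d v predT)%:Z - (\sum_(h | g v h) d h (g v))%N%:Z - 4 <
    \sum_(x | outer x) charge x ->
  (4 * #|T| < \sum_x d x predT + 8)%N.
Proof.
have E : \sum_(x | outer x) charge x =
    (\sum_(x | outer x) (d x predT + hubs x))%N%:Z - 4 * #|outer|%:Z.
  rewrite sumrB sum_Posz; congr (_ - _).
  by rewrite sumr_const -[X in X = _]mulr_natr natz; reflexivity.
have C : (#|outer| + d v predT + 1 = #|T|)%N.
  rewrite -(cardC (g v)) (cardD1 v (predC (g v))).
  have -> : v \in predC (g v) by rewrite !inE; apply: (negbT (girr sat v)).
  have -> : d v predT = #|g v| by apply: eq_card => y; rewrite !inE andbT.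
  have -> : #|[predD1 (predC (g v)) & v]| = #|outer| by apply: eq_card => y; rewrite !inE.
  lia.
rewrite E sum_deg; lia.
Qed.

(* The charge after each lone vertex has given one unit to each far neighbour,
   and each twin one unit to each lone or far neighbour. *)
Definition phi (x : T) : int :=
  if hubs x == 2%N then (d x twin)%:Z
  else if hubs x == 1%N then (d x lone + 2 * d x twin)%:Z - 2
  else (2 * d x lone + 2 * d x twin + d x far)%:Z - 4.

Lemma sum_phi : \sum_(x | outer x) charge x = \sum_(x | outer x) phi x.
Proof.
pose pay x y : nat := g x y && ((lone x && far y) || (twin x && (lone y || far y))).
rewrite (@sum_transfer _ _ charge pay); apply: eq_bigr => x o.
have inE' : (\sum_(y | outer y) pay y x =
   (lone x || far x) * d x twin + far x * d x lone)%N.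
  rewrite !ndegE !big_distrr -big_split /= big_mkcond; apply: eq_bigr => y _.
  rewrite /pay gs; case oy: (outer y); last by rewrite /lone /twin oy !andbF !muln0.
  by rewrite /lone /twin /far o oy; case: (g x y); case: (hubs x) => [|[|[]]]; case: (hubs y) => [|[|[]]].
have outE : (\sum_(y | outer y) pay x y =
   (lone x || twin x) * d x far + twin x * d x lone)%N.
  rewrite !ndegE !big_distrr -big_split /= big_mkcond; apply: eq_bigr => y _.
  rewrite /pay; case oy: (outer y); last by rewrite /lone /far oy !andbF !muln0.
  by rewrite /lone /twin /far o oy; case: (g x y); case: (hubs x) => [|[|[]]]; case: (hubs y) => [|[|[]]].
rewrite inE' outE /charge /phi (deg_split o).
by case: (outer_cases o); rewrite /lone /twin /far o /= => /eqP -> /=; lia.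
Qed.

End Root.

(** Free of subtraction. As the degree sum is even, exceeding [4 n - 8] means at least [4 n - 6],
    that is, at least [2 n - 3] edges. *)
Definition dense (T : finType) (g : rel T) : Prop :=
  4 * #|T| < \sum_x ndeg g x predT + 8.

(** * Outer vertices classified by their hubs *)

Section Levels.
Variables (T : finType) (g : rel T).
Hypothesis sat : K23_saturated g.
Variable v : T.
Local Notation d := (ndeg g).
Local Notation outer := (outer g v).
Local Notation lone := (lone g v).
Local Notation twin := (twin g v).
Local Notation far := (far g v).
Local Notation hubs := (hubs g v).
Local Notation phi := (phi g v).
Let gs := gsym sat.

Definition near : pred T := fun x => outer x && (0 < hubs x).

Lemma near_split x : near x = lone x || twin x.
Proof.
rewrite /near /lone /twin; case o: (outer x) => //=.
by have := hubs_le2 sat o; case: (hubs x) => [|[|[]]].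
Qed.

Lemma lone_near x : lone x -> near x. Proof. by rewrite near_split => ->. Qed.
Lemma twin_near x : twin x -> near x. Proof. by rewrite near_split => ->; rewrite orbT. Qed.
Lemma lone_outer x : lone x -> outer x. Proof. by case/andP. Qed.
Lemma twin_outer x : twin x -> outer x. Proof. by case/andP. Qed.
Lemma far_outer x : far x -> outer x. Proof. by case/andP. Qed.
Lemma near_outer x : near x -> outer x. Proof. by case/andP. Qed.
Lemma lone_twinF x : lone x -> twin x = false.
Proof. by rewrite /lone /twin => /andP[-> /eqP ->]. Qed.
Lemma lone_farF x : lone x -> far x = false.
Proof. by rewrite /lone /far => /andP[-> /eqP ->]. Qed.
Lemma twin_farF x : twin x -> far x = false.
Proof. by rewrite /twin /far => /andP[-> /eqP ->]. Qed.
Lemma near_farF x : near x -> far x = false.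
Proof. by rewrite /near /far => /andP[->]; case: (hubs x). Qed.
Lemma far_nearF x : far x -> near x = false.
Proof. by rewrite /near /far => /andP[-> /eqP ->]. Qed.

Lemma near_far x : outer x -> near x \/ far x.
Proof. by rewrite /near /far => ->; case: (hubs x); [right|left]. Qed.

Lemma d_near x : d x near = d x lone + d x twin.
Proof.
rewrite -ndegU; last by move=> y _ /lone_twinF ->.
by apply: eq_ndeg => y _; rewrite near_split.
Qed.

Lemma phi_lone x : lone x -> (phi x = (d x near + d x twin)%:Z - 2)%R.
Proof. by rewrite /phi d_near => /andP[_ /eqP ->] /=; lia. Qed.
Lemma phi_twin x : twin x -> (phi x = (d x twin)%:Z)%R.
Proof. by rewrite /phi => /andP[_ /eqP ->]. Qed.
Lemma phi_far x : far x -> (phi x = (2 * d x near + d x far)%:Z - 4)%R.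
Proof. by rewrite /phi d_near => /andP[_ /eqP ->] /=; lia. Qed.

Lemma deg_near x : outer x -> d x predT = hubs x + d x near + d x far.
Proof. by move=> o; rewrite (deg_split sat o) d_near; lia. Qed.
Lemma deg_lone x : lone x -> d x predT = 1 + d x near + d x far.
Proof. by move=> l; rewrite deg_near ?lone_outer //; case/andP: l => _ /eqP ->. Qed.
Lemma deg_twin x : twin x -> d x predT = 2 + d x near + d x far.
Proof. by move=> l; rewrite deg_near ?twin_outer //; case/andP: l => _ /eqP ->. Qed.
Lemma deg_far x : far x -> d x predT = d x near + d x far.
Proof. by move=> l; rewrite deg_near ?far_outer //; case/andP: l => _ /eqP ->. Qed.

Lemma nearI x h : outer x -> g v h -> g h x -> near x.
Proof. by move=> o a b; rewrite /near o; apply: (@ndeg_ge1 _ _ _ _ h) => //; rewrite gs. Qed.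

Lemma near_hub x : near x -> exists2 h, g v h & g h x.
Proof. by case/andP=> _ /ndeg_gt0[h [a b]]; exists h; rewrite // gs. Qed.

Lemma far_hub x h : far x -> g v h -> g h x = false.
Proof.
case/andP=> o /eqP E vh; apply/negP => hx.
by have := nearI o vh hx; rewrite /near o E.
Qed.

Lemma twinI x h h' : outer x -> g v h -> g v h' -> h != h' -> g h x -> g h' x -> twin x.
Proof.
move=> o a b n p q; rewrite /twin o eqn_leq hubs_le2 //.
by apply: (@ndeg_ge2 _ _ _ _ h h') => //; rewrite gs.
Qed.

Lemma lone_hub x h h' : lone x -> g v h -> g v h' -> g h x -> g h' x -> h' = h.
Proof.
case/andP=> o /eqP E a b p q; apply: (@ndeg_le1 _ g x (g v)) => //; rewrite ?E //.
- by move: E; rewrite /hubs => ->.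
- by rewrite gs.
- by rewrite gs.
Qed.

Lemma twin_hubs x : twin x -> exists h h', [/\ h != h', g v h, g v h', g h x & g h' x].
Proof.
case/andP=> o /eqP E; have /ndeg_gt1[h [h' [a b c e f]]] : 1 < d x (g v).
  by move: E; rewrite /hubs => ->.
by exists h, h'; rewrite !(gs _ x).
Qed.

Lemma twin_hub3 x h h' : twin x -> h != h' -> g v h -> g v h' -> g h x -> g h' x ->
  forall h'', g v h'' -> g h'' x -> h'' = h \/ h'' = h'.
Proof.
move=> /andP[o _] n a b p q h'' c r.
by apply: (@codeg_eq _ _ sat x v) => //; rewrite ?(gs x) //; case/andP: o.
Qed.

Lemma outer_v' x : outer x -> g v x = false.
Proof. by case/andP=> _ /negbTE. Qed.

Lemma outerI x y : outer x -> g x y -> ~~ g v y -> outer y.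
Proof. by move=> o xy n; case: (outer_nbr sat o xy) => // E; rewrite E in n. Qed.

Lemma hub_nbr h y : g v h -> g h y -> [\/ y = v, g v y | outer y].
Proof.
move=> vh hy; case: (eqVneq y v) => [->|n]; first by constructor 1.
case E: (g v y); first by constructor 2.
by constructor 3; rewrite /outer n E.
Qed.

Lemma hub_far h x : g v h -> far x -> g x h = false.
Proof. by move=> vh fx; rewrite gs; apply: far_hub. Qed.

Lemma far_nbr x y : far x -> g x y -> near y \/ far y.
Proof.
move=> fx xy; apply/near_far/(outerI (far_outer fx) xy); apply/negP => vy.
by rewrite (hub_far vy fx) in xy.
Qed.

(** The two directions of a link between [x] and the root: it starts at the root and runs through a
    hub, or it starts at [x] and the two shared vertices are hubs. *)
Lemma outer_link x : outer x ->
  (exists h y1 y2, [/\ g v h & y1 != y2] /\ [/\ g h y1, g h y2, g x y1 & g x y2]) \/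
  (exists t y1 y2, [/\ g x t & y1 != y2] /\ [/\ g t y1, g t y2, g v y1 & g v y2]).
Proof.
case/andP=> xv vx; rewrite eq_sym in xv.
case: (nonadj_linked sat xv vx) => -[t [y1 [y2 [[a b c] e]]]].
- by left; exists t, y1, y2.
- by right; exists t, y1, y2.
Qed.

Lemma dense_phi :
  ((2 * d v predT)%:Z - (\sum_(h | g v h) d h (g v))%N%:Z - 4 < \sum_(x | outer x) phi x)%R ->
  dense g.
Proof. by rewrite -(sum_phi sat); apply: charge_bound. Qed.

Lemma outer_hub_nbr h x y : outer x -> g v h -> g h y -> g x y -> g v y \/ near y.
Proof.
move=> o vh hy xy; case: (outer_nbr sat o xy); [by left|right].
exact: nearI vh hy.
Qed.

Lemma near_not_twin x y : d x twin = 0 -> g x y -> near y -> lone y.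
Proof. by move=> t0 xy; rewrite near_split => /orP[//|ty]; have := ndeg0 t0 xy; rewrite ty. Qed.

End Levels.

(** * Minimum degree one, and at least four *)

Section Small.
Variables (T : finType) (g : rel T).
Hypothesis sat : K23_saturated g.
Local Notation d := (ndeg g).
Let gs := gsym sat.

Lemma dense_deg4 : (forall x, 4 <= d x predT) -> dense g.
Proof.
move=> H; rewrite /dense; have : \sum_(x : T) 4 <= \sum_x d x predT by apply: leq_sum.
by rewrite sum_nat_const mulnC => H1; apply: leq_ltn_trans H1 _; rewrite -addn1 leq_add2l.
Qed.

(** A link with another vertex, in either direction, uses a neighbour of [v]. *)
Lemma deg_gt0 v : 1 < #|T| -> 0 < d v predT.
Proof.
move=> c; rewrite lt0n; apply/negP => /eqP E.
have N y : g v y = false by apply/negP => vy; have := ndeg0 E vy.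
have [u uv] : exists u, u != v.
  case: (pickP [pred u | u != v]) => [u|H]; first by exists u.
  move: c; rewrite (cardD1 v) inE (eq_card0 (A := [predD1 T & v])) // => y.
  by rewrite !inE andbT; have := H y.
case: (nonadj_linked sat uv); rewrite ?(gs u) ?N // => -[t [y1 [y2 [[a b c'] [e f p q]]]]].
- by rewrite N in p.
- by rewrite N in a.
Qed.

(** With a single hub, a link between [x] and the root can only run through that hub. Hence every
    outer vertex has two near neighbours, no [phi] is negative, and only [-2] has to be exceeded. *)
Lemma dense_deg1 v : d v predT = 1 -> dense g.
Proof.
move=> E; have /ndeg_gt0[a [va _]] : 0 < d v predT by rewrite E.
have H h : g v h -> h = a by move=> vh; apply: (@ndeg_le1 _ g v predT) => //; rewrite E.
have na h : g h h = false by apply: (girr sat).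
apply: (@dense_phi _ _ sat v); rewrite E big1; last first.
  move=> h vh; apply: eq_card0 => y; rewrite !inE; apply/negP => /andP[hy vy].
  by move: hy; rewrite (H _ vh) (H _ vy) na.
apply: (@Order.POrderTheory.lt_le_trans _ _ 0%R); first by [].
apply: sumr_ge0 => x o.
case: (outer_link sat o) => [[h [y1 [y2 [[vh n] [h1 h2 x1 x2]]]]]|[t [y1 [y2 [[_ n] [_ _ v1 v2]]]]]]; last first.
  by move: n; rewrite (H _ v1) (H _ v2) eqxx.
have Y y : g h y -> g x y -> near g v y.
  move=> hy xy; case: (outer_hub_nbr sat o vh hy xy) => // vy.
  by move: hy; rewrite (H _ vy) (H _ vh) na.
have N2 : 1 < d x (near g v) by apply: (@ndeg_ge2 _ _ _ _ y1 y2) => //; apply: Y.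
case: (outer_cases sat o) => l.
- by rewrite (phi_lone sat l); lia.
- by rewrite (phi_twin l).
- by rewrite (phi_far sat l); lia.
Qed.

End Small.

(* Twice the number of edges inside the neighbourhood of [u]. *)
Definition tau2 (T : finType) (g : rel T) (u : T) : nat :=
  \sum_(h | g u h) ndeg g h (g u).

Section Tau.
Variables (T : finType) (g : rel T).
Hypothesis sat : K23_saturated g.
Local Notation d := (ndeg g).
Let gs := gsym sat.

Lemma nbhd_set u (s : seq T) : uniq s -> all (g u) s -> d u predT = size s ->
  forall y, g u y = (y \in s).
Proof.
move=> us al E y; apply/idP/idP => [uy|ys]; last exact: (allP al).
by apply: (@ndeg_all _ g u predT) => //; [apply: sub_all al => z -> | rewrite E].
Qed.

Lemma tau2_seq u (s : seq T) : uniq s -> all (g u) s -> d u predT = size s ->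
  tau2 g u = \sum_(x <- s) \sum_(y <- s) g x y.
Proof.
move=> us al E; have N := nbhd_set us al E.
have S (F : T -> nat) : \sum_(h | g u h) F h = \sum_(x <- s) F x.
  by rewrite (eq_bigl (mem s)) ?big_uniq // => y; rewrite N.
rewrite /tau2 (S (fun h => d h (g u))); apply: eq_bigr => x _.
rewrite ndegE -(S (fun y => g x y : nat)) [RHS]big_mkcond /=.
by apply: eq_bigr => y _; case: (g u y); rewrite ?andbT ?andbF.
Qed.

Lemma tau2_2 u a b : d u predT = 2 -> a != b -> g u a -> g u b ->
  tau2 g u = 2 * g a b.
Proof.
move=> E n ua ub; rewrite (@tau2_seq u [:: a; b]) /= ?inE ?n ?ua ?ub //.
by rewrite !big_cons !big_nil !(girr sat) (gs b a); alia.
Qed.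

Lemma tau2_3 u a b c : d u predT = 3 -> a != b -> a != c -> b != c ->
  g u a -> g u b -> g u c -> tau2 g u = 2 * (g a b + g a c + g b c).
Proof.
move=> E n1 n2 n3 ua ub uc; rewrite (@tau2_seq u [:: a; b; c]) /= ?inE ?negb_or ?n1 ?n2 ?n3 ?ua ?ub ?uc //.
by rewrite !big_cons !big_nil !(girr sat) (gs b a) (gs c a) (gs c b); alia.
Qed.

Lemma tau2_sum v : (\sum_(h | g v h) d h (g v)) = tau2 g v. Proof. by []. Qed.

Lemma nbr3 u a b : d u predT = 3 -> a != b -> g u a -> g u b ->
  exists c, [/\ g u c, c != a, c != b & forall y, g u y -> [\/ y = a, y = b | y = c]].
Proof.
move=> E n ua ub.
have : 0 < d u (fun y => ~~ ((y == a) || (y == b))).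
  have := ndegC g u (fun y => (y == a) || (y == b)); rewrite E.
  have : d u (fun y => (y == a) || (y == b)) <= 2.
    apply: leq_trans (subset_leq_card (_ : _ \subset [set a; b])) _.
      by apply/subsetP=> y; rewrite !inE => /andP[].
    by rewrite cards2; case: (_ != _).
  alia.
case/ndeg_gt0=> c [uc]; rewrite negb_or => /andP[ca cb].
exists c; split=> // y uy.
by apply: (@ndeg_le3 _ g u predT a b c); rewrite ?E // eq_sym.
Qed.

Lemma tau2_ge4 u a b c : d u predT = 3 -> 4 <= tau2 g u ->
  a != b -> a != c -> b != c -> g u a -> g u b -> g u c ->
  ~~ g a b -> g a c /\ g b c.
Proof.
move=> E + n1 n2 n3 ua ub uc /negbTE N; rewrite (tau2_3 E n1 n2 n3 ua ub uc) N.
by case: (g a c); case: (g b c).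
Qed.

Lemma tau2_ge2 u a b c : d u predT = 3 -> 2 <= tau2 g u ->
  a != b -> a != c -> b != c -> g u a -> g u b -> g u c ->
  [|| g a b, g a c | g b c].
Proof.
move=> E + n1 n2 n3 ua ub uc; rewrite (tau2_3 E n1 n2 n3 ua ub uc).
by case: (g a b); case: (g a c); case: (g b c).
Qed.
End Tau.

(** * Minimum degree three, at least two edges in every neighbourhood of size three *)

Section Deg3Tau4.
Variables (T : finType) (g : rel T).
Hypothesis sat : K23_saturated g.
Local Notation d := (ndeg g).
Local Notation deg x := (ndeg g x predT).
Hypothesis deg3 : forall x, 3 <= deg x.
Hypothesis tau4 : forall x, deg x = 3 -> 4 <= tau2 g x.
Variable v : T.
Hypothesis degv : deg v = 3.
Let gs := gsym sat.
Local Notation outer := (outer g v).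
Local Notation lone := (lone g v).
Local Notation twin := (twin g v).
Local Notation far := (far g v).
Local Notation near := (near g v).
Local Notation hubs := (hubs g v).

(** Far vertices of charge [-1] that no twin pays; they depend on their lone neighbours. *)
Definition needy : pred T := fun z => [&& far z, deg z == 3 & d z twin == 0].

(** No neighbour of [z] is a twin, so the link with the root runs through a hub, and the two shared
    vertices are near without being twins. *)
Lemma needy_nbrs z : needy z -> exists h p q, [/\ p != q, g v h & [/\ lone p, lone q,
  g h p, g h q & g z p /\ g z q]].
Proof.
case/and3P=> fz _ /eqP t0; have oz := far_outer fz.
have L y : near y -> g z y -> lone y.
  by rewrite (near_split sat) => /orP[//|ty] zy; have := ndeg0 t0 zy; rewrite ty.
case: (outer_link sat oz) => [[h [p [q [[vh n] [hp hq zp zq]]]]]|[t [p [q [[zt n] [tp tq vp vq]]]]]].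
- exists h, p, q; split=> //; split=> //; apply: L => //.
  + by case: (outer_hub_nbr sat oz vh hp zp) => // E; rewrite (hub_far sat E fz) in zp.
  + by case: (outer_hub_nbr sat oz vh hq zq) => // E; rewrite (hub_far sat E fz) in zq.
- have ot : outer t by case: (outer_nbr sat oz zt) => // E; rewrite (hub_far sat E fz) in zt.
  have tt : twin t by apply: (twinI sat ot vp vq n); rewrite gs.
  by have := ndeg0 t0 zt; rewrite tt.
Qed.

Lemma needy_le x : d x needy <= d x far.
Proof. by apply: ndeg_le => y _ /andP[]. Qed.

(* A lone neighbour of degree 3 of a needy vertex is adjacent to a lone vertex that can pay in full. *)
Lemma poor_nbr z p : needy z -> lone p -> g z p -> deg p = 3 ->
  exists x, [/\ lone x, g z x & d x needy + 3 <= deg x].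
Proof.
move=> nz lp zp dp; case/and3P: (nz) => fz /eqP dz /eqP t0.
have [h vh hp] := near_hub sat (lone_near sat lp).
have zh : g z h = false by apply: (hub_far sat vh fz).
have ph : g p h by rewrite gs.
have pz : g p z by rewrite gs.
have hz : h != z by apply: contraFneq zh => E; move: vh; rewrite E (outer_v' (far_outer fz)).
have [x [px xh xz Np]] := nbr3 dp hz ph pz.
have [hx zx] : g h x /\ g z x.
  apply: (tau2_ge4 sat dp (tau4 dp) hz _ _ ph pz px); rewrite // 1?eq_sym //.
  by rewrite gs zh.
have nx : near x.
  case: (far_nbr sat fz zx) => // fx.
  by rewrite (far_hub sat fx vh) in hx.
have lx : lone x.
  by move: nx; rewrite (near_split sat) => /orP[//|tx]; have := ndeg0 t0 zx; rewrite tx.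
exists x; split=> //.
have xp : g x p by rewrite gs.
have pxn : p != x by apply: (gneq sat).
have [o [zo op ox Nz]] := nbr3 dz pxn zp zx.
have xo : g x o.
  have po : ~~ g p o.
    apply/negP => po; case: (Np _ po) => E; subst o.
    - by rewrite zo in zh.
    - by rewrite (girr sat) in zo.
    - by rewrite eqxx in ox.
  have [_ oxg] : g p x /\ g o x.
    by apply: (tau2_ge4 sat dz (tau4 dz) _ pxn ox zp zo zx po); rewrite eq_sym.
  by rewrite gs.
rewrite (deg_lone sat lx).
have le := needy_le x.
have np : near p by apply: lone_near.
have two y : near y -> g x y -> y != p -> d x needy + 3 <= 1 + d x near + d x far.
  move=> ny xy yp; have := @ndeg_ge2 _ g x near y p yp xy ny xp np; alia.
case: (far_nbr sat fz zo) => [no|fo]; first exact: (two o).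
(* Either [o] is a far neighbour of [x] that takes nothing, or it is needy; in the latter case its
   third neighbour [y] turns out to be a near neighbour of [x] other than [p]. *)
case E: (needy o); last first.
  have : d x needy < d x far.
    rewrite /ndeg; apply: proper_card; apply/properP; split.
      by apply/subsetP=> y; rewrite !inE => /andP[-> /and3P[-> _ _]].
    by exists o; rewrite !inE ?xo ?fo // E.
  have := @ndeg_ge1 _ g x near p xp np; alia.
have ozn : g o z by rewrite gs.
have oxn : g o x by rewrite gs.
case/and3P: (E) => _ /eqP do_ _.
have zxn : z != x by apply: (gneq sat).
have [y [oy yz yx No]] := nbr3 do_ zxn ozn oxn.
have zy : ~~ g z y.
  apply/negP => zy; case: (Nz _ zy) => Ey; subst y.
  - rewrite gs in oy; case: (Np _ oy) => Eo; subst o.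
    + by rewrite zo in zh.
    + by rewrite (girr sat) in zo.
    + by rewrite eqxx in ox.
  - by rewrite eqxx in yx.
  - by rewrite (girr sat) in oy.
have [zx2 yx2] : g z x /\ g y x.
  by apply: (tau2_ge4 sat do_ (tau4 do_) _ _ _ ozn oy oxn zy); rewrite // 1?eq_sym //.
have [h' [a [b [ab vh' [la lb ha hb [oa ob]]]]]] := needy_nbrs E.
have xy : g x y by rewrite gs.
have ny : near y.
  case: (No _ oa) => Ea; subst a; last exact: lone_near.
  - by rewrite (lone_farF la) in fz.
  - case: (No _ ob) => Eb; subst b; last exact: lone_near.
    + by rewrite (lone_farF lb) in fz.
    + by rewrite eqxx in ab.
apply: (two y ny xy); apply/eqP => Ey; subst y.
by rewrite zp in zy.
Qed.

(** With three needy neighbours [p] has no near neighbour. A needy neighbour [z] then has a second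
    lone neighbour [q] on the hub of [p]; since [p] and [q] are nonadjacent, the third neighbour [s]
    of [z] sees both, and [p], [q] share the hub, [z] and [s]. *)
Lemma lone_deg4_needy_le2 p : lone p -> deg p = 4 -> d p needy <= 2.
Proof.
move=> lp dp; rewrite leqNgt; apply/negP => n3.
have le := needy_le p.
have sp := deg_lone sat lp; rewrite dp in sp.
have n0 : d p near = 0 by alia.
have allneedy y : g p y -> outer y -> needy y.
  move=> py oy; case: (near_far oy) => [ny|fy].
    by have := ndeg0 n0 py; rewrite ny.
  have := ndegC g p needy; rewrite dp => E.
  apply/negPn/negP => nn.
  have [h vh hp] := near_hub sat (lone_near sat lp).
  have : 1 < d p (fun y => ~~ needy y).
    apply: (@ndeg_ge2 _ _ _ _ y h) => //; last 1 first.
    - by rewrite /needy /far /outer vh andbF.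
    - by apply/eqP => Ey; subst y; rewrite (outer_v' oy) in vh.
    - by rewrite gs.
  alia.
have [z [pz nz]] : exists z, g p z /\ needy z by apply: ndeg_gt0; alia.
case/and3P: (nz) => fz /eqP dz /eqP t0.
have zp : g z p by rewrite gs.
have [h [a [b [ab vh [la lb ha hb [za zb]]]]]] := needy_nbrs nz.
have [q [qp zq hq lq hp]] : exists q, [/\ q != p, g z q, g h q, lone q & g h p].
  case: (eqVneq a p) => [Ea|na].
    by subst a; exists b; rewrite eq_sym.
  case: (eqVneq b p) => [Eb|nb].
    by subst b; exists a.
  have [c [zc ca cb N]] := nbr3 dz ab za zb.
  have {}N : c = p by case: (N _ zp) => // E; rewrite E eqxx in na nb.
  subst c.
  have pa : ~~ g p a by apply/negP => pa; have := ndeg0 n0 pa; rewrite (lone_near sat la).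
  have pb : ~~ g p b by apply/negP => pb; have := ndeg0 n0 pb; rewrite (lone_near sat lb).
  have [_ pb'] : g a b /\ g p b.
    by apply: (tau2_ge4 sat dz (tau4 dz) na ab _ za zc zb); rewrite // 1?eq_sym gs //.
  by rewrite pb' in pb.
have pq : p != q by rewrite eq_sym.
have [s [zs sp' sq N]] := nbr3 dz pq zp zq.
have npq : ~~ g p q by apply/negP => pq'; have := ndeg0 n0 pq'; rewrite (lone_near sat lq).
have [ps qs] : g p s /\ g q s.
  by apply: (tau2_ge4 sat dz (tau4 dz) _ _ _ zp zq zs npq); rewrite // 1?eq_sym //.
have sh : s != h by apply: contraTneq zs => ->; rewrite (hub_far sat vh fz).
have zh : z != h by apply: contraTneq vh => <-; rewrite (outer_v' (far_outer fz)).
apply: (@K23_free _ _ sat p q h z s) => //; rewrite ?(gs _ h) ?(gs _ z) // 1?eq_sym //.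
by rewrite eq_sym (gneq sat zs).
Qed.

(** Amounts are half units. A lone vertex owns [2 * deg - 6] of them and gives each needy neighbour
    the full two if that suffices, otherwise one as soon as it owns any. *)
Definition pay_needy (x y : T) : nat := g x y *
  (if twin x then 2 * far y else
   (lone x && needy y) * (if d x needy + 3 <= deg x then 2 else (3 < deg x))).

(** A needy vertex has two lone neighbours paying at least one half unit or, by [poor_nbr], one that
    pays in full. Single half units are affordable from degree five on, as there are at most
    [deg - 1] needy neighbours; degree four is [lone_deg4_needy_le2]. *)
Lemma dense_tau4 : dense g.
Proof.
have D0 : (0 <= \sum_(x | outer x) (2 * charge g v x))%R.
  rewrite (@sum_transfer _ _ _ pay_needy); apply: sumr_ge0 => x o.
  have outE : \sum_(y | outer y) pay_needy x y =
     if twin x then 2 * d x far else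
     lone x * (d x needy * (if d x needy + 3 <= deg x then 2 else (3 < deg x))).
    rewrite big_mkcond /= /pay_needy; case tx: (twin x).
      rewrite ndegE big_distrr; apply: eq_bigr => y _ /=.
      case oy: (outer y); last by rewrite /far oy !andbF.
      by case: (g x y); case: (far y).
    case lx: (lone x); last by rewrite big1 // => y _; case: ifP; rewrite //= mul0n muln0.
    set e := (if _ then _ else (nat_of_bool _)).
    rewrite mul1n ndegE big_distrl; apply: eq_bigr => y _ /=.
    case oy: (outer y); first by case: (g x y); case: (needy y); rewrite ?mul1n ?mul0n.
    by rewrite /needy /far oy !andbF mul0n.
  have pay_le z y : outer y -> pay_needy y z <= \sum_(y | outer y) pay_needy y z.
    by move=> oy; rewrite (bigD1 y) //= leq_addr.
  rewrite outE /charge.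
  case: (outer_cases sat o) => cx.
  - rewrite (lone_twinF cx) cx mul1n.
    have /andP[_ /eqP E] := cx; rewrite E.
    have le := needy_le x; have D := deg_lone sat cx.
    have := deg3 x; case: ifP => H; first by alia.
    case: (ltnP 3 (deg x)) => H4; last by alia.
    case: (eqVneq (deg x) 4) => H5; last by alia.
    by have := lone_deg4_needy_le2 cx H5; alia.
  - rewrite cx; have /andP[_ /eqP E] := cx; rewrite E.
    have D := deg_twin sat cx; alia.
  - have tx : twin x = false by apply/negP => /twin_farF; rewrite cx.
    have lx : lone x = false by apply/negP => /lone_farF; rewrite cx.
    rewrite tx lx mul0n; have /andP[_ /eqP E] := cx; rewrite E.
    have := deg3 x; case: (ltnP 3 (deg x)) => H4; first by alia.
    move=> H3; have dx : deg x = 3 by alia.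
    suff : 2 <= \sum_(y | outer y) pay_needy y x by alia.
    case t0: (d x twin == 0); last first.
      have [t [xt tt]] : exists t, g x t /\ twin t by apply: ndeg_gt0; rewrite lt0n t0.
      apply: leq_trans (pay_le x t (twin_outer tt)).
      by rewrite /pay_needy gs xt tt cx.
    have nx : needy x by rewrite /needy cx dx t0.
    have full y : lone y -> g x y -> d y needy + 3 <= deg y -> 2 <= \sum_(y | outer y) pay_needy y x.
      move=> ly xy H; apply: leq_trans (pay_le x y (lone_outer ly)).
      by rewrite /pay_needy gs xy (lone_twinF ly) ly nx H.
    have [h [p [q [pq vh [lp lq hp hq [xp xq]]]]]] := needy_nbrs nx.
    have half y : lone y -> g x y -> 3 < deg y -> 1 <= pay_needy y x.
      move=> ly xy H; rewrite /pay_needy gs xy (lone_twinF ly) ly nx H.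
      by case: ifP.
    case: (ltnP 3 (deg p)) => Hp; last first.
      have dp : deg p = 3 by have := deg3 p; alia.
      by have [y [ly xy H]] := poor_nbr nx lp xp dp; apply: (full y).
    case: (ltnP 3 (deg q)) => Hq; last first.
      have dq : deg q = 3 by have := deg3 q; alia.
      by have [y [ly xy H]] := poor_nbr nx lq xq dq; apply: (full y).
    rewrite (bigD1 p) ?lone_outer //= (bigD1 q) /=; last by rewrite lone_outer // eq_sym.
    have := half p lp xp Hp; have := half q lq xq Hq; alia.
apply: (@charge_bound _ _ sat v); rewrite tau2_sum degv.
have := tau4 degv; rewrite -mulr_sumr pmulr_rge0 // in D0.
move: D0; set S := (\sum_(_ | _) _)%R; alia.
Qed.
End Deg3Tau4.

(** * Roots whose hubs span a matching *)

Section SparseHubs.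
Variables (T : finType) (g : rel T).
Hypothesis sat : K23_saturated g.
Variable v : T.
Hypothesis hub_edge_uniq : forall h k k', g v h -> g v k -> g v k' -> g h k -> g h k' -> k = k'.
Local Notation d := (ndeg g).
Local Notation outer := (outer g v).
Local Notation lone := (lone g v).
Local Notation twin := (twin g v).
Local Notation far := (far g v).
Local Notation near := (near g v).
Let gs := gsym sat.

Lemma sparse_common_twin h h' y : h != h' -> g v h -> g v h' -> g h y -> g h' y ->
  y != v -> twin y.
Proof.
move=> n vh vh' hy hy' yv; apply: (twinI sat _ vh vh' n) => //.
case: (hub_nbr vh hy) => // E; first by rewrite E eqxx in yv.
by case/eqP: n; apply: (hub_edge_uniq E vh vh'); rewrite gs.
Qed.

(* The hub link of an outer vertex [x] uses at most one hub, and then [x] is adjacent to it. *)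
Lemma sparse_link x : outer x ->
  (exists h y1 y2, [/\ g v h, y1 != y2 & [/\ near y1, g h y1, g h y2, g x y1 & g x y2]]) \/
  (exists t, g x t /\ twin t).
Proof.
move=> o; case: (outer_link sat o) => [[h [y1 [y2 [[vh n] [h1 h2 x1 x2]]]]]|[t [y1 [y2 [[xt n] [t1 t2 v1 v2]]]]]].
  left; case: (outer_hub_nbr sat o vh h1 x1) => c1; last by exists h, y1, y2.
  case: (outer_hub_nbr sat o vh h2 x2) => c2; first by rewrite (hub_edge_uniq vh c1 c2) ?eqxx in n.
  by exists h, y2, y1; rewrite eq_sym.
right; exists t; split=> //; apply: (twinI sat _ v1 v2 n); rewrite 1?(gs _ t) //.
apply: (outerI sat o xt); apply/negP => vt.
by rewrite (hub_edge_uniq vt v1 v2) ?eqxx in n.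
Qed.

Lemma sparse_near x : outer x -> 0 < d x near.
Proof.
case/sparse_link=> [[h [y1 [y2 [_ _ [n1 _ _ x1 _]]]]]|[t [xt tt]]]; first exact: ndeg_ge1 x1 n1.
exact: ndeg_ge1 xt (twin_near sat tt).
Qed.

Lemma sparse_far r : far r -> d r twin = 0 -> exists h p q, [/\ g v h, p != q &
  [/\ lone p, lone q, g h p, g h q & g r p /\ g r q]].
Proof.
move=> fr t0; case: (sparse_link (far_outer fr)) => [[h [p [q [vh n [np h1 h2 x1 x2]]]]]|[t [pt tt]]]; last first.
  by have := ndeg0 t0 pt; rewrite tt.
exists h, p, q; split=> //; split; rewrite ?(near_not_twin sat t0) //.
case: (far_nbr sat fr x2) => // fq; by rewrite (far_hub sat fq vh) in h2.
Qed.
End SparseHubs.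

(** * Roots with independent neighbourhood *)

Section Indep.
Variables (T : finType) (g : rel T).
Hypothesis sat : K23_saturated g.
Variable v : T.
Local Notation d := (ndeg g).
Local Notation deg x := (ndeg g x predT).
Local Notation outer := (outer g v).
Local Notation lone := (lone g v).
Local Notation twin := (twin g v).
Local Notation far := (far g v).
Local Notation near := (near g v).
Local Notation phi := (phi g v).
Let gs := gsym sat.

Lemma lone_pos x : lone x -> 2 < d x near + d x twin -> (0 < phi x)%R.
Proof. by move=> /(phi_lone sat) ->; alia. Qed.
Lemma lone_pos2 x : lone x -> 3 < d x near + d x twin -> (1 < phi x)%R.
Proof. by move=> /(phi_lone sat) ->; alia. Qed.
Lemma far_pos x : far x -> 4 < 2 * d x near + d x far -> (0 < phi x)%R.
Proof. by move=> /(phi_far sat) ->; alia. Qed.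
Lemma far_pos2 x : far x -> 5 < 2 * d x near + d x far -> (1 < phi x)%R.
Proof. by move=> /(phi_far sat) ->; alia. Qed.
Lemma lone_twin x : lone x -> twin x -> False.
Proof. by move=> /lone_twinF ->. Qed.
Lemma lone_far x : lone x -> far x -> False.
Proof. by move=> /lone_farF ->. Qed.
Lemma twin_far x : twin x -> far x -> False.
Proof. by move=> /twin_farF ->. Qed.

Hypothesis ind : forall h h', g v h -> g v h' -> ~~ g h h'.

Lemma tau2_indep : tau2 g v = 0.
Proof.
rewrite /tau2 big1 // => h vh; apply: eq_card0 => y; rewrite !inE; apply/negP => /andP[hy vy].
by have := ind vh vy; rewrite hy.
Qed.

Lemma outer_hub_near x h y : outer x -> g v h -> g h y -> g x y -> near y.
Proof.
move=> o vh hy xy; case: (outer_hub_nbr sat o vh hy xy) => // vy.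
by have := ind vh vy; rewrite hy.
Qed.

Lemma indep_link x : outer x ->
  (exists h y1 y2, [/\ g v h & y1 != y2] /\
     [/\ g h y1, g h y2, g x y1, g x y2 & near y1 /\ near y2]) \/
  (exists t, g x t /\ twin t).
Proof.
move=> o; case: (outer_link sat o) => [[h [y1 [y2 [[a b] [p q r s]]]]]|[t [y1 [y2 [[a b] [p q r s]]]]]].
- by left; exists h, y1, y2; split=> //; split=> //; split; apply: (outer_hub_near o a).
- right; exists t; split=> //.
  have ot : outer t.
    by apply: (outerI sat o a); apply/negP => vt; have := ind vt r; rewrite p.
  by apply: (twinI sat ot r s b); rewrite gs.
Qed.

Lemma common_hubs_twin h h' y : h != h' -> g v h -> g v h' -> g h y -> g h' y ->
  y != v -> twin y.
Proof.
move=> n a b c e yv; apply: (twinI sat _ a b n) => //.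
by case: (hub_nbr a c) => // [E|E]; [rewrite E eqxx in yv | have := ind a E; rewrite c].
Qed.

Lemma outer_near2 x : outer x -> d x twin = 0 -> 1 < d x near.
Proof.
move=> o t0; case: (indep_link o) => [[h [y1 [y2 [[_ n] [_ _ a b [c e]]]]]]|[t [a b]]].
- exact: (@ndeg_ge2 _ g x near y1 y2).
- by have := ndeg0 t0 a; rewrite b.
Qed.

Lemma far_lone r z : far r -> lone z -> g r z -> 1 < d r near.
Proof.
move=> fr lz rz; case: (indep_link (far_outer fr)) => [[h [y1 [y2 [[_ n] [_ _ a b [c e]]]]]]|[t [a b]]].
- exact: (@ndeg_ge2 _ g r near y1 y2).
- apply: (@ndeg_ge2 _ g r near z t) => //.
  + by apply/eqP => E; subst t; apply: lone_twin lz b.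
  + exact: lone_near.
  + exact: twin_near.
Qed.

Lemma near_gt2 y u t z1 z2 : u != t -> z1 != z2 -> g y u -> g y t -> g y z1 -> g y z2 ->
  near u -> near t -> near z1 -> near z2 ->
  [\/ z1 = u /\ z2 = t, z1 = t /\ z2 = u | 2 < d y near].
Proof.
move=> n1 n2 a b c e p q r s.
case: (eqVneq z1 u) => [E|n3].
  subst z1; case: (eqVneq z2 t) => [->|n4]; first by constructor 1.
  by constructor 3; apply: (@ndeg_ge3 _ g y near u z2 t) => //; rewrite ?n2 ?n1.
case: (eqVneq z1 t) => [E|n4].
  subst z1; case: (eqVneq z2 u) => [->|n5]; first by constructor 2.
  by constructor 3; apply: (@ndeg_ge3 _ g y near u z2 t) => //; rewrite eq_sym.
by constructor 3; apply: (@ndeg_ge3 _ g y near z1 u t).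
Qed.

(* A vertex [y] without twin neighbours has two neighbours of one class, hence a third
   neighbour next to [u] and [t] if these lie in different classes. *)
Lemma mixed_near y u t x k : outer y -> d y twin = 0 -> g y u -> g y t -> near u -> near t ->
  lone u -> g v x -> g v k -> g x u -> g k t -> x != k -> ~~ twin t -> u != t -> 2 < d y near.
Proof.
move=> o t0 yu yt nu nt lu vx vk xu kt xk tt ut.
case: (indep_link o) => [[h [z1 [z2 [[vh n] [h1 h2 a b [c e]]]]]]|[s [a b]]]; last first.
  by have := ndeg0 t0 a; rewrite b.
have bad : g h u -> g h t -> False.
  move=> hu ht; have E : h = x by apply: (lone_hub sat lu).
  subst h; have := common_hubs_twin xk vx vk ht kt; rewrite (negbTE tt).
  case: (eqVneq t v) => [E|_ /(_ isT)//].
  by have := near_outer nt; rewrite E /outer eqxx.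
case: (near_gt2 ut n yu yt a b nu nt c e) => [[? ?]|[? ?]|//]; subst z1 z2; by case: bad.
Qed.

(** Saturation for [u] and the hub [k]. Without twins [x] and [k] share only the root, so the link
    avoids [x]. If it starts at [u], its middle vertex has [u] and both shared vertices as near
    neighbours; if it starts at [k], a shared vertex sees [u] and a vertex on [k], and [mixed_near]
    adds a third. *)
Lemma contact u x k : (forall w, ~~ twin w) -> lone u -> g v x -> g x u -> g v k -> ~~ g k u ->
  exists y, [/\ g u y, outer y, 2 < d y near & exists t, [/\ g y t, near t & g k t]].
Proof.
move=> W0 lu vx xu vk ku.
have t0 y : d y twin = 0.
  by apply/eqP; rewrite -leqn0 leqNgt; apply/negP => /ndeg_gt0[w [_]]; rewrite (negbTE (W0 w)).
have ou := lone_outer lu.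
have uk : u != k by apply/eqP => E; subst k; rewrite (outer_v' ou) in vk.
have xk : x != k by apply: contraNneq ku => <-.
case: (nonadj_linked sat uk _); first by rewrite gs.
- move=> [t [y1 [y2 [[ut tk y12] [t1 t2 k1 k2]]]]].
  case: (outer_nbr sat ou ut) => [vt|ot].
    have E : t = x by apply: (lone_hub sat lu) => //; rewrite gs.
    subst t; case: (eqVneq y1 v) => [E|n].
      have n : y2 != v by rewrite -E eq_sym.
      by have := W0 y2; rewrite (common_hubs_twin xk vx vk).
    by have := W0 y1; rewrite (common_hubs_twin xk vx vk).
  have n1 : near y1 by apply: (outer_hub_near ot vk).
  have n2 : near y2 by apply: (outer_hub_near ot vk).
  exists t; split=> //; last by exists y1.
  have u1 : u != y1 by apply: contraNneq ku => ->.
  have u2 : u != y2 by apply: contraNneq ku => ->.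
  by apply: (@ndeg_ge3 _ g t near u y1 y2); rewrite ?(gs t u) // lone_near.
- move=> [t [y1 [y2 [[kt tu y12] [t1 t2 u1 u2]]]]].
  case: (hub_nbr vk kt) => [E|vt|ot].
  + subst t; case/eqP: y12; transitivity x; first by apply: (lone_hub sat lu) => //; rewrite gs.
    by apply/esym; apply: (lone_hub sat lu) => //; rewrite gs.
  + by have := ind vk vt; rewrite kt.
  have nt : near t by apply: nearI vk kt.
  have o1 : outer y1.
    apply: (outerI sat ou u1); apply/negP => v1.
    have E : y1 = x by apply: (lone_hub sat lu) => //; rewrite gs.
    have := W0 t; rewrite (common_hubs_twin xk vx vk _ kt) -?E //; first by rewrite gs.
    by case/andP: ot.
  exists y1; split=> //; last by exists t; rewrite gs.
  apply: (@mixed_near y1 u t x k) => //; rewrite 1?gs // 1?eq_sym //.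
  exact: lone_near.
Qed.

End Indep.

(** * Degree-two vertices attached to a twin *)

Section Tails.
Variables (T : finType) (g : rel T).
Hypothesis sat : K23_saturated g.
Variables v w : T.
Hypothesis tw : twin g v w.
Let gs := gsym sat.
Local Notation far := (far g v).
Variable tail : pred T.
Hypothesis tail_far : forall r, tail r -> far r.
Hypothesis tail_nbrs : forall r, tail r -> exists r1, [/\ g r w, g r r1, far r1, g r1 w &
  forall y, g r y -> y = w \/ y = r1].

(** A link between two tails shares both neighbours of one tail, so its middle vertex is adjacent to
    [w] and to the partner of that tail. It is a neighbour of the other tail and not [w], hence the
    other partner. *)
Lemma tail_pair r r' r1 r1' : tail r -> tail r' -> r != r' -> ~~ g r r' ->
  g r r1 -> far r1 -> g r' r1' -> far r1' -> g r1 r1'.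
Proof.
move=> nr nr' rr' nrr rr1 fr1 rr1' fr1'.
have [s [rw rs fs _ N]] := tail_nbrs nr; have [s' [rw' rs' fs' _ N']] := tail_nbrs nr'.
have E : r1 = s by case: (N _ rr1) => // E; subst r1; case: (twin_far tw fr1).
have E' : r1' = s' by case: (N' _ rr1') => // E'; subst r1'; case: (twin_far tw fr1').
subst s s'.
case: (nonadj_linked sat rr' nrr) => -[t [y1 [y2 [[yt tx y12] [t1 t2 x1 x2]]]]].
- have [tw' tp] : g t w /\ g t r1'.
    by case: (N' _ x1) => E1; case: (N' _ x2) => E2; subst y1 y2; rewrite ?eqxx // in y12.
  by case: (N _ yt) => E; subst t; first rewrite (girr sat) in tw'.
- have [tw' tp] : g t w /\ g t r1.
    by case: (N _ x1) => E1; case: (N _ x2) => E2; subst y1 y2; rewrite ?eqxx // in y12.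
  by case: (N' _ yt) => E; subst t; [rewrite (girr sat) in tw'|rewrite gs].
Qed.

(** For three tails [tail_pair] makes the partners [a1], [b1], [c1] pairwise adjacent; then [w] and
    [a1] share [a], [b1] and [c1]. *)
Lemma tail_card : #|tail| <= 2.
Proof.
rewrite leqNgt; apply/negP => /card_gt2P[a [b [c [[na nb nc] [ab bc ca]]]]].
move: na nb nc; rewrite !unfold_in => na nb nc.
have [a1 [aw aa1 fa1 a1w Na]] := tail_nbrs na.
have [b1 [bw bb1 fb1 b1w Nb]] := tail_nbrs nb.
have [c1 [cw cc1 fc1 c1w Nc]] := tail_nbrs nc.
have F := tail_far.
(* Two adjacent tails [x], [y] would be each other's partner. The partner of a third tail, adjacent
   to [y] by [tail_pair], could then only be [x], which the third tail does not see. *)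
have nonadj x y z x1 y1 z1 : tail x -> tail y -> tail z -> x != y -> z != x -> z != y ->
   g x x1 -> far x1 -> g y y1 -> far y1 -> g z z1 -> far z1 ->
   (forall t, g x t -> t = w \/ t = x1) -> (forall t, g y t -> t = w \/ t = y1) -> ~~ g x y.
  move=> nx ny nz xy zx zy xx1 fx1 yy1 fy1 zz1 fz1 Nx Ny; apply/negP => D.
  have Ex : x1 = y by case: (Nx _ D) => // E; subst y; case: (twin_far tw (F _ ny)).
  subst x1; have nzx : ~~ g z x.
    apply/negP => E; rewrite gs in E; case: (Nx _ E) => E'; subst z.
      by case: (twin_far tw (F _ nz)).
    by rewrite eqxx in zy.
  have := tail_pair nz nx zx nzx zz1 fz1 xx1 fx1; rewrite gs => E.
  case: (Ny _ E) => E'; first by subst z1; case: (twin_far tw fz1).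
  subst z1; case: (Ny x); rewrite 1?gs // => E'; subst x; first by case: (twin_far tw (F _ nx)).
  by rewrite (negbTE nzx) in zz1.
have nab : ~~ g a b by apply: (nonadj a b c a1 b1 c1) => //; rewrite eq_sym.
have nbc : ~~ g b c by apply: (nonadj b c a b1 c1 a1) => //; rewrite eq_sym.
have nca : ~~ g c a by apply: (nonadj c a b c1 a1 b1) => //; rewrite eq_sym.
have e1 := tail_pair na nb ab nab aa1 fa1 bb1 fb1.
have e3 := tail_pair nc na ca nca cc1 fc1 aa1 fa1.
have ab1 : a != b1 by apply/eqP => E; subst b1; rewrite gs (negbTE nab) in bb1.
have ac1 : a != c1 by apply/eqP => E; subst c1; rewrite (negbTE nca) in cc1.
have bc1 : b1 != c1.
  by have e2 := tail_pair nb nc bc nbc bb1 fb1 cc1 fc1; apply: (gneq sat).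
apply: (@K23_free _ _ sat w a1 a b1 c1) => //; rewrite 1?(gs w) //.
- by apply/eqP => E; subst a1; apply: twin_far tw fa1.
- by rewrite gs.
- by rewrite gs.
Qed.

End Tails.

(** * Where units of charge are kept *)

Section Carriers.
Variables (T : finType) (g : rel T) (v : T).
Local Notation outer := (outer g v).
Local Notation lone := (lone g v).
Local Notation twin := (twin g v).
Local Notation far := (far g v).

(* The places where a neighbour [z] of a twin may leave its unit of charge. *)
Definition carries z e := e == z \/ far e /\ g z e.

Lemma carrier_outer z e : lone z -> carries z e -> outer e.
Proof. by move=> lz [/eqP ->|[/far_outer //]]; apply: lone_outer. Qed.

(** A common carrier would be a far common neighbour of [z] and [z'], but their common neighbours
    are a hub and a twin. *)
Lemma carrier_neq z z' x w e e' : z != z' -> lone z -> lone z' ->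
  (forall y, g z y -> g z' y -> y = x \/ y = w) -> g v x -> twin w ->
  carries z e -> carries z' e' -> e != e'.
Proof.
move=> n lz lz' N vx tw A B; apply/eqP => E; subst e'.
case: A B => [/eqP ->|[fe ze]] [/eqP E|[fe' ze']].
- by rewrite E eqxx in n.
- exact: lone_far lz fe'.
- by subst e; apply: lone_far lz' fe.
- case: (N _ ze ze') => E; subst e; last exact: twin_far tw fe.
  by have := outer_v' (far_outer fe); rewrite vx.
Qed.

Lemma carrier_shared z z2 e : lone z -> lone z2 -> z != z2 -> carries z e -> carries z2 e ->
  [/\ far e, g z e & g z2 e].
Proof.
move=> lz lz2 n; case=> [/eqP E|[fe ze]] [/eqP E'|[fe' ze']] //.
- by rewrite -E E' eqxx in n.
- by subst e; case: (lone_far lz fe').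
- by subst e; case: (lone_far lz2 fe).
Qed.
End Carriers.

(** * Minimum degree three, a root with independent neighbourhood *)

Section Deg3Tau0.
Variables (T : finType) (g : rel T).
Hypothesis sat : K23_saturated g.
Local Notation d := (ndeg g).
Local Notation deg x := (ndeg g x predT).
Hypothesis deg3 : forall x, 3 <= deg x.
Variable v : T.
Hypothesis ind : forall h h', g v h -> g v h' -> ~~ g h h'.
Let gs := gsym sat.
Local Notation outer := (outer g v).
Local Notation lone := (lone g v).
Local Notation twin := (twin g v).
Local Notation far := (far g v).
Local Notation near := (near g v).
Local Notation phi := (phi g v).

Lemma far_lone_pos r z : far r -> lone z -> g r z -> (0 < phi r)%R.
Proof.
move=> fr lz rz; have := far_lone sat ind fr lz rz.
by have := deg3 r; rewrite (deg_far sat fr) => A B; apply: (far_pos sat) => //; alia.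
Qed.

Lemma phi_ge0 x : outer x -> (0 <= phi x)%R.
Proof.
move=> o; have D := deg3 x; have N2 := outer_near2 sat ind o.
case: (outer_cases sat o) => c.
- rewrite (phi_lone sat c); have := d_near sat v x; case: (posnP (d x twin)) => [/N2|]; alia.
- by rewrite (phi_twin c).
- rewrite (phi_far sat c); rewrite (deg_far sat c) in D.
  have := d_near sat v x; case: (posnP (d x twin)) => [/N2|]; alia.
Qed.

(** For a root of degree three with independent neighbourhood the sum has to exceed [2]. In the
    presence of a twin this is reached by three positive vertices, or as in [duo] by two of which
    one counts double. *)
Lemma tri e1 e2 e3 : outer e1 -> outer e2 -> outer e3 -> e1 != e2 -> e1 != e3 -> e2 != e3 ->
  (0 < phi e1)%R -> (0 < phi e2)%R -> (0 < phi e3)%R -> (2 < \sum_(x | outer x) phi x)%R.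
Proof.
move=> o1 o2 o3 n12 n13 n23 p1 p2 p3.
by have := sum_ge3 phi_ge0 o1 o2 o3 n12 n13 n23; alia.
Qed.

Lemma duo e1 e2 : outer e1 -> outer e2 -> e1 != e2 ->
  (1 < phi e1)%R -> (0 < phi e2)%R -> (2 < \sum_(x | outer x) phi x)%R.
Proof.
move=> o1 o2 n12 p1 p2.
by have := sum_ge2 phi_ge0 o1 o2 n12; alia.
Qed.

Section NoTwin.
Hypothesis degv : deg v = 3.

Lemma hub3 a b : a != b -> g v a -> g v b ->
  exists c, [/\ g v c, c != a, c != b & forall y, g v y -> [\/ y = a, y = b | y = c]].
Proof. exact: nbr3. Qed.

Hypothesis W0 : forall w, ~~ twin w.

Lemma no_twin y : d y twin = 0.
Proof. by apply/eqP; rewrite -leqn0 leqNgt; apply/negP => /ndeg_gt0[w [_]]; rewrite (negbTE (W0 w)). Qed.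

Definition cls (k : T) : pred T := fun t => near t && g k t.

Lemma near_lone y : near y -> lone y.
Proof. by rewrite (near_split sat) (negbTE (W0 y)) orbF. Qed.

Lemma lone_class y a b c : (forall y, g v y -> [\/ y = a, y = b | y = c]) -> lone y ->
  g v a -> g v b -> g v c -> a != b -> a != c -> b != c ->
  (g a y : nat) + g b y + g c y = 1.
Proof.
move=> N ly va vb vc ab ac bc.
have [h vh hy] := near_hub sat (lone_near sat ly).
have E h' : g v h' -> g h' y = (h' == h).
  move=> vh'; apply/idP/eqP => [h'y|->//]; exact: (lone_hub sat ly).
rewrite !E //; case: (N _ vh) => ->; rewrite !eqxx ?(negbTE ab) ?(negbTE ac) ?(negbTE bc) //.
- by rewrite !(eq_sym _ a) (negbTE ab) (negbTE ac).
- by rewrite !(eq_sym _ b) (negbTE bc).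
Qed.

(* Double counting of the pairs (lone vertex [u], hub [k] not adjacent to [u]): each has a
   contact [y], and [y] serves at most [4 * phi y] pairs. *)
Lemma no_twin_sum : (2 < \sum_(x | outer x) phi x)%R.
Proof.
have [a [b [ab va _ vb _]]] : exists a b, [/\ a != b, g v a, predT a, g v b & predT b].
  by apply: ndeg_gt1; rewrite degv.
have [c [vc ca cb N]] := hub3 ab va vb.
have ac : a != c by rewrite eq_sym.
have bc : b != c by rewrite eq_sym.
pose serve k u y : bool := [&& lone u, ~~ g k u, g u y, outer y, 2 < d y near & 0 < d y (cls k)].
have cont k : g v k -> \sum_(u | lone u && ~~ g k u) 1 <= \sum_(y | outer y) \sum_u serve k u y.
  move=> vk; rewrite exchange_big /= [X in _ <= X](bigID (fun u => lone u && ~~ g k u)) /=.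
  apply: leq_trans (leq_addr _ _); apply: leq_sum => u /andP[lu ku].
  have [x vx xu] := near_hub sat (lone_near sat lu).
  have [y [uy oy ny [t [yt nt kt]]]] := contact sat ind W0 lu vx xu vk ku.
  rewrite (bigD1 y) //= /serve lu ku uy oy ny.
  by rewrite (@ndeg_ge1 _ g y (cls k) t) // /cls nt kt.
have serveE k y : outer y -> \sum_u serve k u y =
    (2 < d y near) * ((0 < d y (cls k)) * (d y near - d y (cls k))).
  move=> oy; have -> : d y near - d y (cls k) = d y (fun u => lone u && ~~ g k u).
    have -> : d y near = d y (cls k) + d y (fun u => lone u && ~~ g k u).
      rewrite -ndegU; last by move=> z _; rewrite /cls => /andP[_ ->]; rewrite andbF.
      apply: eq_ndeg => z _; rewrite /cls /=; apply/idP/orP.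
        by move=> nz; rewrite nz (near_lone nz); case: (g k z); [left|right].
      by case=> /andP[] // lz _; apply: lone_near.
    by rewrite addKn.
  rewrite [X in _ * (_ * X)]ndegE !big_distrr /=; apply: eq_bigr => u _; rewrite /serve oy (gs u y).
  by case: (lone u); case: (g k u); case: (g y u); case: (2 < _); case: (0 < _).
have clsum y : outer y -> d y (cls a) + d y (cls b) + d y (cls c) = d y near.
  move=> oy; rewrite !ndegE -!big_split /=; apply: eq_bigr => u _.
  case yu: (g y u); rewrite /cls //=; case nu: (near u) => //=.
  exact: (lone_class N (near_lone nu)).
(* The link with the root puts two neighbours of [y] in one class. This excludes class sizes
   [1, 1, 1], where [y] would serve six pairs while the bound [d y near - 2] for [phi y] is only
   [1]. *)
have cl2 y : outer y -> [|| 1 < d y (cls a), 1 < d y (cls b) | 1 < d y (cls c)].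
  move=> oy; case: (indep_link sat ind oy) => [[h [y1 [y2 [[vh n] [h1 h2 a1 a2 [n1 n2]]]]]]|[t [p q]]]; last first.
    by have := W0 t; rewrite q.
  have : 1 < d y (cls h) by apply: (@ndeg_ge2 _ g y (cls h) y1 y2); rewrite // /cls ?n1 ?n2 ?h1 ?h2.
  by case: (N _ vh) => -> ->; rewrite ?orbT.
(* Each of the three hubs has two neighbours besides the root, all of them lone, and every lone
   vertex misses two hubs. *)
have pair2 : 12 <= \sum_(u | lone u && ~~ g a u) 1 + \sum_(u | lone u && ~~ g b u) 1 +
      \sum_(u | lone u && ~~ g c u) 1.
  have big k : g v k -> 2 <= \sum_(u | lone u) (g k u).
    move=> vk; have := deg3 k; rewrite (ndegC g k (pred1 v)).
    have -> : d k (pred1 v) = 1.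
      rewrite /ndeg -(card1 v); apply: eq_card => y; rewrite !inE.
      by case: eqP => [->|]; rewrite ?andbF // gs vk.
    have -> : d k (fun y => ~~ pred1 v y) = \sum_(u | lone u) (g k u).
      rewrite ndegE [RHS]big_mkcond /=; apply: eq_bigr => u _.
      case ku: (g k u); last by rewrite if_same.
      case: (hub_nbr vk ku) => [->|E|o]; first by rewrite eqxx /lone /outer eqxx.
        by have := ind vk E; rewrite ku.
      rewrite (near_lone (nearI sat o vk ku)).
      by case/andP: o => ->.
    by [].
  have R k : \sum_(u | lone u && ~~ g k u) 1 = \sum_(u | lone u) (~~ g k u).
    by rewrite big_mkcondr /=; apply: eq_bigr => u _; case: (g k u).
  have S : \sum_(u | lone u && ~~ g a u) 1 + \sum_(u | lone u && ~~ g b u) 1 +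
      \sum_(u | lone u && ~~ g c u) 1 =
      2 * (\sum_(u | lone u) (g a u) + \sum_(u | lone u) (g b u) + \sum_(u | lone u) (g c u)).
    rewrite !R -!big_split big_distrr /=; apply: eq_bigr => u lu.
    by have := lone_class N lu va vb vc ab ac bc; case: (g a u); case: (g b u); case: (g c u).
  rewrite S; have := big a va; have := big b vb; have := big c vc; alia.
have tot : 12 <= \sum_(y | outer y) (2 < d y near) *
   ((0 < d y (cls a)) * (d y near - d y (cls a)) + (0 < d y (cls b)) * (d y near - d y (cls b))
    + (0 < d y (cls c)) * (d y near - d y (cls c))).
  apply: leq_trans pair2 _.
  apply: leq_trans (leq_add (leq_add (cont a va) (cont b vb)) (cont c vc)) _.
  rewrite -!big_split /=; apply: leq_sum => y oy.
  by rewrite !serveE // !mulnDr.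
have each y : outer y -> (((2 < d y near) *
   ((0 < d y (cls a)) * (d y near - d y (cls a)) + (0 < d y (cls b)) * (d y near - d y (cls b))
    + (0 < d y (cls c)) * (d y near - d y (cls c))))%N%:Z <= 4 * phi y)%R.
  move=> oy; have := phi_ge0 oy; case: (ltnP 2 (d y near)) => n3; last first.
    by rewrite mul0n => H; rewrite mulr_ge0.
  move=> _; have le : ((d y near)%:Z - 2 <= phi y)%R.
    case: (outer_cases sat oy) => l.
    - by rewrite (phi_lone sat l) no_twin addn0.
    - by have := W0 y; rewrite l.
    - by rewrite (phi_far sat l); alia.
  have := clsum y oy; have := cl2 y oy; move: le n3.
  move: (phi y) (d y near) (d y (cls a)) (d y (cls b)) (d y (cls c)).
  clear; move=> p D [|da] [|db] [|dc]; rewrite /= ?mul1n ?mul0n ?ltnS; lia.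
have : (12%:Z <= 4 * \sum_(y | outer y) phi y)%R.
  rewrite mulr_sumr; apply: Order.POrderTheory.le_trans (ler_sum _ each).
  by rewrite sum_Posz lez_nat.
alia.
Qed.
End NoTwin.

End Deg3Tau0.

(** * Independent neighbourhood of size three, with a twin *)

Section Deg3Tau0Twin.
Variables (T : finType) (g : rel T).
Hypothesis sat : K23_saturated g.
Local Notation d := (ndeg g).
Local Notation deg x := (ndeg g x predT).
Hypothesis deg3 : forall x, 3 <= deg x.
Variable v : T.
Hypothesis degv : deg v = 3.
Hypothesis ind : forall h h', g v h -> g v h' -> ~~ g h h'.
Let gs := gsym sat.
Local Notation outer := (outer g v).
Local Notation lone := (lone g v).
Local Notation twin := (twin g v).
Local Notation far := (far g v).
Local Notation near := (near g v).
Local Notation phi := (phi g v).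
Local Notation good := (2 < \sum_(x | outer x) phi x)%R.
Let tri := tri sat deg3 ind.
Let duo := duo sat deg3 ind.

Definition unit_at z e := carries g v z e /\ (0 < phi e)%R.

Lemma unit_outer z e : lone z -> unit_at z e -> outer e.
Proof. by move=> lz [/(carrier_outer lz)]. Qed.

(** If [z] has no far neighbour, degree three gives it two near ones, and with the twin among them
    it stays positive itself; otherwise any far neighbour of [z] is positive. *)
Lemma unit_exists z w : lone z -> twin w -> g z w -> exists e, unit_at z e.
Proof.
move=> lz tw zw; have D := deg3 z; rewrite (deg_lone sat lz) in D.
have t1 := ndeg_ge1 zw tw; have S := d_near sat v z.
case: (posnP (d z far)) => [f0|/ndeg_gt0[r [zr fr]]].
  by exists z; split; [left|apply: (lone_pos sat lz); alia].
exists r; split; first by right.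
by apply: (far_lone_pos sat deg3 ind fr lz); rewrite gs.
Qed.

Lemma unit_neq z z' x w e e' : z != z' -> lone z -> lone z' ->
  (forall y, g z y -> g z' y -> y = x \/ y = w) -> g v x -> twin w ->
  unit_at z e -> unit_at z' e' -> e != e'.
Proof. by move=> n lz lz' N vx tw [A _] [B _]; apply: (carrier_neq n lz lz' N vx tw A B). Qed.

Lemma far_neq z z' x w e e' : lone z -> lone z' ->
  (forall y, g z y -> g z' y -> y = x \/ y = w) -> g v x -> twin w ->
  far e -> g z e -> unit_at z' e' -> e != e'.
Proof.
move=> lz lz' N vx tw fe ze [B _]; apply/eqP => E; subst e'.
case: B => [/eqP E|[_ ze']].
- by subst e; apply: lone_far lz' fe.
- case: (N _ ze ze') => E; subst e; last exact: twin_far tw fe.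
  by have := outer_v' (far_outer fe); rewrite vx.
Qed.

Lemma lone_neq z z' e : lone z -> z != z' -> unit_at z' e -> z != e.
Proof.
move=> lz n [[/eqP ->//|[fe _]] _]; apply/eqP => E; subst e; exact: lone_far lz fe.
Qed.

Lemma twin_v w : twin w -> w != v.
Proof. by move=> /twin_outer /andP[]. Qed.

(** The hubs [h] and [h'] already share the root, which leaves room for one twin. *)
Lemma twin_hub_uniq h h' w w' : h != h' -> g v h -> g v h' -> twin w -> twin w' ->
  g h w -> g h' w -> g h w' -> g h' w' -> w = w'.
Proof.
move=> n vh vh' tw tw' a b c e; apply/eqP/negPn/negP => nw.
apply: (@K23_free _ _ sat h h' v w w') => //; rewrite ?(gs _ v) //.
- by rewrite eq_sym twin_v.
- by rewrite eq_sym twin_v.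
Qed.

(** Both twins are positive. If no third vertex is, lone vertices see neither twins nor far vertices
    and have at most two near neighbours. Saturation for a lone vertex on a hub [b] of [w] and a hub
    [c] of [w'] then demands a third. *)
Lemma twin_edge w w' : twin w -> twin w' -> g w w' -> good.
Proof.
move=> tw tw' ww'.
have nww : w != w' by apply: (gneq sat).
have p1 : (0 < phi w)%R by rewrite (phi_twin tw); have := ndeg_ge1 ww' tw'; alia.
have p2 : (0 < phi w')%R.
  by rewrite (phi_twin tw'); have := @ndeg_ge1 _ g w' twin w; rewrite gs ww' tw => /(_ isT isT); alia.
have [ow ow'] := (twin_outer tw, twin_outer tw').
case: (pickP [pred y | [&& outer y, y != w, y != w' & (0 < phi y)%R]]) => [y /and4P[oy n1 n2 py]|Z].
  by apply: (tri ow ow' oy) => //; rewrite eq_sym.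
have {}Z y : outer y -> (0 < phi y)%R -> y = w \/ y = w'.
  move=> oy py; move: (Z y); rewrite /= oy py andbT.
  by case: eqP => [->|_]; [left|case: eqP => [->|_]; [right|]].
have notw z : lone z -> z = w \/ z = w' -> False.
  by move=> lz [] E; subst z; [apply: lone_twin lz tw|apply: lone_twin lz tw'].
have notf z : far z -> z = w \/ z = w' -> False.
  by move=> lz [] E; subst z; [apply: twin_far tw lz|apply: twin_far tw' lz].
have L0 z : lone z -> (0 < phi z)%R -> False.
  by move=> lz pz; apply: (notw _ lz); apply: Z => //; apply: lone_outer.
have F0 z r : lone z -> g z r -> far r -> False.
  move=> lz zr fr; apply: (notf _ fr); apply: Z; first exact: far_outer.
  by apply: (far_lone_pos sat deg3 ind fr lz); rewrite gs.
have T0 z t : lone z -> g z t -> twin t -> False.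
  move=> lz zt tt; have [e [[/eqP E|[fe ze]] pe]] := unit_exists lz tt zt.
    by subst e; apply: L0 lz pe.
  exact: F0 lz ze fe.
have t0 z : lone z -> d z twin = 0.
  by move=> lz; apply/eqP; rewrite -leqn0 leqNgt; apply/negP => /ndeg_gt0[t [zt tt]]; apply: T0 zt tt.
have n2 z : lone z -> d z near <= 2.
  move=> lz; rewrite leqNgt; apply/negP => n3; apply: (L0 z lz).
  by apply: (lone_pos sat lz); alia.
have Tw t : twin t -> t = w \/ t = w'.
  move=> tt; have [//|nt] : (t = w \/ t = w') \/ ~ (t = w \/ t = w').
    by case: (eqVneq t w) => [->|a]; [left; left|case: (eqVneq t w') => [->|b];
      [left; right|right=> -[] E; subst t; rewrite eqxx in a b]].
  have [y [ty ny]] : exists y, g t y /\ near y.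
    case: (indep_link sat ind (twin_outer tt)) => [[h [y1 [y2 [_ [_ _ a _ [c _]]]]]]|[s [a b]]].
      by exists y1.
    by exists s; rewrite (twin_near sat).
  case: nt; apply: Z; first exact: twin_outer.
  move: ny; rewrite (near_split sat) => /orP[ly|tty].
    by case: (T0 y t) => //; rewrite gs.
  by rewrite (phi_twin tt); have := ndeg_ge1 ty tty; alia.
have [h1 [h2 [n12 v1 v2 w1 w2]]] := twin_hubs sat tw.
have [k1 [k2 [m12 u1 u2 x1 x2]]] := twin_hubs sat tw'.
(* Distinct twins have distinct pairs of hubs, hence [b] on [w] only and [c] on [w'] only. As there
   is no third twin, [b] and [c] share only the root. *)
have [b [vb bw bw']] : exists b, [/\ g v b, g b w & ~~ g b w'].
  case E1: (g h1 w'); last by exists h1; rewrite E1.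
  case E2: (g h2 w'); last by exists h2; rewrite E2.
  by have := twin_hub_uniq n12 v1 v2 tw tw' w1 w2 E1 E2 => E; rewrite E eqxx in nww.
have [c [vc cw' cw]] : exists c, [/\ g v c, g c w' & ~~ g c w].
  case E1: (g k1 w); last by exists k1; rewrite E1.
  case E2: (g k2 w); last by exists k2; rewrite E2.
  by have := twin_hub_uniq m12 u1 u2 tw tw' E1 E2 x1 x2 => E; rewrite E eqxx in nww.
have bc : b != c by apply: contraNneq bw' => ->.
have nobc t : t != v -> g b t -> g c t -> False.
  move=> tv bt ct; have tt := common_hubs_twin sat ind bc vb vc bt ct tv.
  by case: (Tw t tt) => E; subst t; [rewrite ct in cw|rewrite bt in bw'].
have [u [bu uv uw]] : exists u, [/\ g b u, u != v & u != w].
  have degb := deg3 b.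
  have := ndegC g b (fun y => (y == v) || (y == w)).
  have : d b (fun y => (y == v) || (y == w)) <= 2.
    apply: leq_trans (subset_leq_card (_ : _ \subset [set v; w])) _.
      by apply/subsetP=> y; rewrite !inE => /andP[].
    by rewrite cards2; case: (_ != _).
  move=> A B; have /ndeg_gt0[u [bu]] : 0 < d b (fun y => ~~ ((y == v) || (y == w))) by alia.
  by rewrite negb_or => /andP[p q]; exists u.
have ou : outer u.
  by case: (hub_nbr vb bu) => // E; [rewrite E eqxx in uv|have := ind vb E; rewrite bu].
have lu : lone u.
  case: (outer_cases sat ou) => // tu.
    by case: (Tw u tu) => E; subst u; [rewrite eqxx in uw|rewrite bu in bw'].
  by rewrite (far_hub sat tu vb) in bu.
have cu : ~~ g c u by apply/negP => cu; apply: (nobc u).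
have uc : u != c by apply/eqP => E; subst u; rewrite (outer_v' ou) in vc.
have uhub h : g v h -> g u h -> h = b.
  by move=> vh uh; apply: (lone_hub sat lu) => //; rewrite gs.
have third z p q r : lone z -> p != q -> p != r -> q != r -> g z p -> g z q -> g z r ->
   near p -> near q -> near r -> False.
  move=> lz a1 a2 a3 a4 a5 a6 a7 a8 a9.
  by have := @ndeg_ge3 _ g z near p q r a1 a2 a3 a4 a7 a5 a8 a6 a9; rewrite ltnNge n2.
case: (nonadj_linked sat uc _); first by rewrite gs.
- move=> [t [y1 [y2 [[ut tc y12] [t1 t2 c1 c2]]]]].
  case: (outer_nbr sat ou ut) => [vt|ot].
    have E := uhub _ vt ut; subst t.
    case: (eqVneq y1 v) => [E|n]; last by case: (nobc y1).
    by case: (nobc y2) => //; rewrite -E eq_sym.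
  have Ny y : g t y -> g c y -> near y.
    by move=> ty cy; apply: (outer_hub_near sat ind ot vc).
  have lt : lone t.
    case: (outer_cases sat ot) => // tt; [by case: (T0 u t)|by case: (F0 u t)].
  case: (third t u y1 y2) => //; rewrite 1?gs //; try exact: Ny.
  + by apply: contraNneq cu => ->.
  + by apply: contraNneq cu => ->.
  + exact: (lone_near sat).
- move=> [t [y1 [y2 [[ct tu y12] [t1 t2 u1' u2']]]]].
  case: (hub_nbr vc ct) => [E|vt|ot].
  + subst t; case/eqP: y12; transitivity b; first exact: uhub.
    by apply/esym; apply: uhub.
  + by have := ind vc vt; rewrite ct.
  have nt : near t by apply: nearI vc ct.
  have tv : t != v by case/andP: ot.
  have o1 : outer y1.
    apply: (outerI sat ou u1'); apply/negP => vy1.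
    by have E := uhub _ vy1 u1'; subst y1; case: (nobc t); rewrite // gs.
  have l1 : lone y1.
    case: (outer_cases sat o1) => // tt; [by case: (T0 u y1)|by case: (F0 u y1)].
  have lt : lone t.
    by move: nt; rewrite (near_split sat) => /orP[//|tt]; case: (T0 y1 t); rewrite // gs.
  have : 2 < d y1 near.
    apply: (@mixed_near _ _ sat v ind y1 u t b c) => //; rewrite 1?gs //.
    * exact: t0.
    * exact: lone_near.
    * by apply/negP => tt; apply: lone_twin lt tt.
    * by rewrite eq_sym.
  by rewrite ltnNge n2.
Qed.

Section NoTwinEdge.
Hypothesis tt0 : forall w w', twin w -> twin w' -> ~~ g w w'.

(** No neighbour of [w] is a twin, so its link with the root runs through a hub. As codegrees are at
    most two, [z] and [z'] share nothing but [x] and [w], which keeps their units apart. *)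
Lemma twin_pair w : twin w -> exists x z z', [/\ g v x, z != z' &
  [/\ lone z, lone z', g x z, g x z' & [/\ g w z, g w z' &
   forall y, g z y -> g z' y -> y = x \/ y = w]]].
Proof.
move=> tw; case: (indep_link sat ind (twin_outer tw)) => [[x [z [z' [[vx n] [xz xz' wz wz' [nz nz']]]]]]|[t [wt tt]]]; last first.
  by have := tt0 tw tt; rewrite wt.
have L y : g w y -> near y -> lone y.
  by move=> wy; rewrite (near_split sat) => /orP[//|ty]; have := tt0 tw ty; rewrite wy.
exists x, z, z'; split=> //; split; rewrite ?L //; split=> //.
apply: (@codeg_eq _ _ sat z z') => //; rewrite 1?gs //.
by apply: contraTneq vx => ->; rewrite (outer_v' (twin_outer tw)).
Qed.

Lemma far_unit_pos2 r z : far r -> lone z -> g r z -> 2 < d r near -> (1 < phi r)%R.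
Proof. by move=> fr lz rz n3; apply: (far_pos2 sat fr); alia. Qed.

Lemma two_twin_nbrs y y' w w2 e0 : twin w -> twin w2 -> w != w2 -> lone y ->
  g w y -> g w2 y -> y != y' -> lone y' -> unit_at y' e0 -> good.
Proof.
move=> tw tw2 nw ly wy w2y yy' ly' E0; apply: (@duo y e0) => //.
- exact: lone_outer.
- exact: unit_outer ly' E0.
- exact: lone_neq ly yy' E0.
- apply: (lone_pos2 sat ly); rewrite (d_near sat).
  by have := @ndeg_ge2 _ g y twin w w2 nw; rewrite !(gs y) wy w2y tw tw2 => /(_ isT isT isT isT); alia.
- by case: E0.
Qed.

Lemma unit_shared z z2 e : lone z -> lone z2 -> z != z2 -> unit_at z e -> unit_at z2 e ->
  [/\ far e, g z e & g z2 e].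
Proof. by move=> lz lz2 n [A _] [B _]; apply: carrier_shared A B. Qed.

Lemma phi1_near e z z2 : far e -> lone z -> lone z2 -> z != z2 -> g z e -> g z2 e ->
  (phi e <= 1)%R -> forall y, g e y -> near y -> y = z \/ y = z2.
Proof.
move=> fe lz lz2 n ze ze2; rewrite (phi_far sat fe) => le y.
have := deg3 e; rewrite (deg_far sat fe) => D.
apply: (@ndeg_le2 _ g e near z z2) => //; rewrite 1?gs ?(lone_near sat) //; alia.
Qed.

(** Carriers shared by lone vertices are far. Unless a further unit turns up, all neighbours of [z]
    and [z2'] and the near neighbours of [e] and [e'] are known, and the link of [e] with the root
    identifies [x] and [x2]. Then [z] and [z2'] are nonadjacent and unlinked. *)
Lemma two_twins_aligned w w2 x x2 z z' z2 z2' e e' :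
  twin w -> twin w2 -> w != w2 -> g v x -> g v x2 -> z != z' -> z2 != z2' ->
  lone z -> lone z' -> lone z2 -> lone z2' ->
  g x z -> g x2 z2 -> g x2 z2' -> g w z -> g w z' -> g w2 z2 -> g w2 z2' ->
  (forall y, g z y -> g z' y -> y = x \/ y = w) ->
  (forall y, g z2 y -> g z2' y -> y = x2 \/ y = w2) ->
  unit_at z e -> unit_at z' e' -> unit_at z2 e -> unit_at z2' e' -> good.
Proof.
move=> tw tw2 nw vx vx2 nz nz2 lz lz' lz2 lz2' xz xz2 xz2' wz wz' wz2 wz2' N N2 E E' F F'.
have ee' := unit_neq nz lz lz' N vx tw E E'.
have [oe oe'] := (unit_outer lz E, unit_outer lz' E').
have [pe pe'] := (proj2 E, proj2 E').
case: (eqVneq z z2) => [D|n12].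
  by subst z2; apply: (two_twin_nbrs tw tw2 nw lz wz wz2 nz lz' E').
case: (eqVneq z' z2') => [D|n12'].
  subst z2'; apply: (two_twin_nbrs tw tw2 nw lz' wz' wz2' _ lz E).
  by rewrite eq_sym.
have [fe ze ze2] := unit_shared lz lz2 n12 E F.
have [fe' ze' ze2'] := unit_shared lz' lz2' n12' E' F'.
case: (ltrP 1 (phi e)) => h1; first by apply: (@duo e e').
case: (ltrP 1 (phi e')) => h2; first by apply: (@duo e' e); rewrite // eq_sym.
have Ne := phi1_near fe lz lz2 n12 ze ze2 h1.
have Ne' := phi1_near fe' lz' lz2' n12' ze' ze2' h2.
have not_common y y' u x0 w0 : (forall t, g y t -> g y' t -> t = x0 \/ t = w0) -> g v x0 -> twin w0 ->
    far u -> g y u -> g y' u -> False.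
  move=> N0 vx0 tw0 fu yu y'u; case: (N0 _ yu y'u) => D; subst u; last exact: twin_far tw0 fu.
  by have := outer_v' (far_outer fu); rewrite vx0.
have nearpos y w0 : lone y -> twin w0 -> g y w0 -> (exists a, [/\ g y a, near a & a != w0]) -> good.
  move=> ly tw0 yw0 [a [ya na aw0]]; apply: (@tri y e e') => //.
  - exact: lone_outer.
  - by apply/eqP => D; subst e; apply: lone_far ly fe.
  - by apply/eqP => D; subst e'; apply: lone_far ly fe'.
  - apply: (lone_pos sat ly); have := ndeg_ge1 yw0 tw0.
    by have := @ndeg_ge2 _ g y near a w0 aw0 ya na yw0 (twin_near sat tw0); alia.
have [//|Nz] : good \/ forall y, g z y -> [\/ y = x, y = w | y = e].
  case: (pickP [pred y | [&& g z y, y != x, y != w & y != e]]) => [y /and4P[zy n1 n2 n3]|Z]; last first.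
    right=> y zy; move: (Z y); rewrite /= zy /=.
    by case: eqP => [|_]; [constructor 1|case: eqP => [|_]; [constructor 2|case: eqP => // ? _; constructor 3]].
  left; case: (outer_nbr sat (lone_outer lz) zy) => [vy|oy].
    by case/eqP: n1; apply: (lone_hub sat lz) => //; rewrite gs.
  case: (near_far oy) => [ny|fy]; first by apply: (nearpos z w lz tw); [rewrite gs|exists y].
  case: (eqVneq y e') => [D|n4].
    by subst y; case: (not_common _ _ _ _ _ N vx tw fe' zy ze').
  by apply: (@tri y e e') => //; apply: (far_lone_pos sat deg3 ind fy lz); rewrite gs.
have [//|Nz'] : good \/ forall y, g z2' y -> [\/ y = x2, y = w2 | y = e'].
  case: (pickP [pred y | [&& g z2' y, y != x2, y != w2 & y != e']]) => [y /and4P[zy n1 n2 n3]|Z]; last first.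
    right=> y zy; move: (Z y); rewrite /= zy /=.
    by case: eqP => [|_]; [constructor 1|case: eqP => [|_]; [constructor 2|case: eqP => // ? _; constructor 3]].
  left; case: (outer_nbr sat (lone_outer lz2') zy) => [vy|oy].
    by case/eqP: n1; apply: (lone_hub sat lz2') => //; rewrite gs.
  case: (near_far oy) => [ny|fy]; first by apply: (nearpos z2' w2 lz2' tw2); [rewrite gs|exists y].
  case: (eqVneq y e) => [D|n4].
    by subst y; case: (not_common _ _ _ _ _ N2 vx2 tw2 fe ze2 zy).
  by apply: (@tri y e e') => //; apply: (far_lone_pos sat deg3 ind fy lz2'); rewrite gs.
have xx2 : x2 = x.
  case: (indep_link sat ind oe) => [[h [a [b [[vh ab] [ha hb ea eb [na nb]]]]]]|[t [et tt]]]; last first.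
    by case: (Ne t et (twin_near sat tt)) => D; subst t; [case: (lone_twin lz tt)|case: (lone_twin lz2 tt)].
  have [hz hz2] : g h z /\ g h z2.
    by case: (Ne a ea na) => D; case: (Ne b eb nb) => D'; subst a b; rewrite ?eqxx // in ab.
  by rewrite -(lone_hub sat lz2 vx2 vh) // (lone_hub sat lz vx vh) // (lone_hub sat lz2 vx2 vh).
subst x2.
have zz2' : z != z2'.
  by apply/eqP => D; subst z2'; apply: (not_common _ _ _ _ _ N vx tw fe' ze2' ze').
have nadj : ~~ g z z2'.
  apply/negP => D; case: (Nz _ D) => D'; subst z2'.
  - by have := outer_v' (lone_outer lz2'); rewrite vx.
  - exact: lone_twin lz2' tw.
  - exact: lone_far lz2' fe.
have xe : g x e = false by apply: (far_hub sat fe vx).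
have xe' : g x e' = false by apply: (far_hub sat fe' vx).
have we' : g w e' = false.
  apply/negP => D; rewrite gs in D; case: (Ne' _ D (twin_near sat tw)) => D'; subst w.
  - exact: lone_twin lz' tw.
  - exact: lone_twin lz2' tw.
have we : g w2 e = false.
  apply/negP => D; rewrite gs in D; case: (Ne _ D (twin_near sat tw2)) => D'; subst w2.
  - exact: lone_twin lz tw2.
  - exact: lone_twin lz2 tw2.
have ww : g w w2 = false by apply: negbTE; apply: tt0.
have ww' : g w2 w = false by rewrite gs.
have [ex e'x] : g e x = false /\ g e' x = false by rewrite !(gs _ x).
have [ew2 e'w] : g e w2 = false /\ g e' w = false by rewrite !(gs _ w) (gs _ w2).
have gxx y : g y y = false by apply: (girr sat).
case: (nonadj_linked sat zz2' nadj) => -[t [y1 [y2 [[a1 a2 a3] [b1 b2 c1 c2]]]]].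
- case: (Nz t a1) => D; subst t; case: (Nz' _ c1) => D; subst y1; case: (Nz' _ c2) => D; subst y2;
  by rewrite ?eqxx ?gxx ?xe' ?we' ?ww ?ex ?ew2 // in a3 b1 b2.
- case: (Nz' t a1) => D; subst t; case: (Nz _ c1) => D; subst y1; case: (Nz _ c2) => D; subst y2;
  by rewrite ?eqxx ?gxx ?xe ?we ?ww' ?e'x ?e'w // in a3 b1 b2.
Qed.

(** Each twin yields two distinct carriers. Three different ones among the four are enough;
    otherwise the two pairs coincide, which is the aligned case up to order. *)
Lemma two_twins w w2 : twin w -> twin w2 -> w != w2 -> good.
Proof.
move=> tw tw2 nw.
have [x [z [z' [vx nz [lz lz' xz xz' [wz wz' N]]]]]] := twin_pair tw.
have [x2 [z2 [z2' [vx2 nz2 [lz2 lz2' xz2 xz2' [wz2 wz2' N2]]]]]] := twin_pair tw2.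
have [e E] := unit_exists lz tw (etrans (gs z w) wz).
have [e' E'] := unit_exists lz' tw (etrans (gs z' w) wz').
have [f F] := unit_exists lz2 tw2 (etrans (gs z2 w2) wz2).
have [f' F'] := unit_exists lz2' tw2 (etrans (gs z2' w2) wz2').
have ee' := unit_neq nz lz lz' N vx tw E E'.
have ff' := unit_neq nz2 lz2 lz2' N2 vx2 tw2 F F'.
have [oe oe'] := (unit_outer lz E, unit_outer lz' E').
have [of_ of'] := (unit_outer lz2 F, unit_outer lz2' F').
have [pe pe'] := (proj2 E, proj2 E').
have [pf pf'] := (proj2 F, proj2 F').
have nz2' : z2' != z2 by rewrite eq_sym.
have N2' y : g z2' y -> g z2 y -> y = x2 \/ y = w2 by move=> a b; apply: N2.
case: (eqVneq f e) => [fe|fe]; last case: (eqVneq f e') => [fe'|fe'].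
- case: (eqVneq f' e') => [fe'|fe']; last first.
    by apply: (@tri e e' f') => //; [rewrite -fe | rewrite eq_sym].
  subst f f'.
  by apply: (@two_twins_aligned w w2 x x2 z z' z2 z2' e e').
- case: (eqVneq f' e) => [f'e|f'e]; last first.
    by apply: (@tri e e' f') => //; [rewrite eq_sym | rewrite -fe'].
  subst f f'.
  by apply: (@two_twins_aligned w w2 x x2 z z' z2' z2 e e').
- by apply: (@tri e e' f) => //; rewrite eq_sym.
Qed.

(** The pair of [w] provides two units. The missing one comes from saturation for [z] and a hub [k]
    that shares only the root with the hub of [z]. *)
Lemma one_twin w : twin w -> (forall w', twin w' -> w' = w) -> good.
Proof.
move=> tw uw.
have [x [z [z' [vx nz [lz lz' xz xz' [wz wz' N]]]]]] := twin_pair tw.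
have [zw z'w] : g z w /\ g z' w by rewrite !(gs _ w).
have [e E] := unit_exists lz tw zw.
have [e' E'] := unit_exists lz' tw z'w.
have ee' := unit_neq nz lz lz' N vx tw E E'.
have [oe oe'] := (unit_outer lz E, unit_outer lz' E').
have [pe pe'] := (proj2 E, proj2 E').
have oz := lone_outer lz; have nw := twin_near sat tw; have ow := twin_outer tw.
have ze' := lone_neq lz nz E'.
(* If [w] is not on [x], a hub of [w] will do; otherwise take the hub that [w] misses. *)
have [k [vk xk nok]] : exists k, [/\ g v k, x != k & ~ (g k w /\ g x w)].
  have [h1 [h2 [n12 v1 v2 w1 w2]]] := twin_hubs sat tw.
  case: (boolP (g x w)) => xw; last first.
    case: (eqVneq x h1) => [D|n]; last by exists h1; split=> // -[].
    by exists h2; split=> //; [rewrite D|case].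
  have [c [vc c1 c2 _]] := hub3 degv n12 v1 v2.
  have cw : ~ g c w.
    by move=> cw; case: (twin_hub3 sat tw n12 v1 v2 w1 w2 vc cw) => D; subst c; rewrite eqxx in c1 c2.
  exists c; split=> //; last by case.
  by apply/eqP => D; subst c; case: cw.
have noxk t : t != v -> g x t -> g k t -> False.
  move=> tv xt kt; have := common_hubs_twin sat ind xk vx vk xt kt tv.
  by move=> /uw D; subst t; case: nok.
have kz : ~~ g k z.
  by apply/negP => D; case: (noxk z) => //; case/andP: oz.
have zk : z != k by apply/eqP => D; subst k; rewrite (outer_v' oz) in vk.
have zhub h : g v h -> g z h -> h = x.
  by move=> vh zh; apply: (lone_hub sat lz) => //; rewrite gs.
have zpos y : g z y -> near y -> y != w -> (0 < phi z)%R.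
  move=> zy ny yw; apply: (lone_pos sat lz); have := ndeg_ge1 zw tw.
  by have := @ndeg_ge2 _ g z near y w yw zy ny zw nw; alia.
have two y : outer y -> (1 < phi y)%R -> y != e' -> good.
  by move=> oy py n; apply: (@duo y e').
case: (nonadj_linked sat zk _); first by rewrite gs.
- move=> [t [y1 [y2 [[zt tk y12] [t1 t2 k1 k2]]]]].
  case: (outer_nbr sat oz zt) => [vt|ot].
    have D := zhub _ vt zt; subst t.
    case: (eqVneq y1 v) => [D|n]; last by case: (noxk y1).
    by case: (noxk y2) => //; rewrite -D eq_sym.
  have Ny y : g t y -> g k y -> near y by move=> ty ky; apply: (outer_hub_near sat ind ot vk).
  have [n1 n2] := (Ny _ t1 k1, Ny _ t2 k2).
  have z1 : z != y1 by apply: contraNneq kz => ->.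
  have z2 : z != y2 by apply: contraNneq kz => ->.
  have tz : g t z by rewrite gs.
  have n3 : 2 < d t near by apply: (@ndeg_ge3 _ g t near z y1 y2); rewrite // lone_near.
  case: (outer_cases sat ot) => ct.
  + have tw' : t != w by apply/eqP => D; subst t; apply: lone_twin ct tw.
    have pz := zpos t zt (lone_near sat ct) tw'.
    have pt : (0 < phi t)%R by apply: (lone_pos sat ct); alia.
    have zt' : z != t by apply: (gneq sat).
    case: (eqVneq t z') => [D|n].
      subst t; apply: (@duo z' z) => //; first by rewrite eq_sym.
      by apply: (lone_pos2 sat ct); have := ndeg_ge1 z'w tw; alia.
    by apply: (@tri z t e') => //; apply: lone_neq ct n E'.
  + have D := uw _ ct; subst t.
    have L y : g w y -> near y -> lone y.
      by move=> wy; rewrite (near_split sat) => /orP[//|ty]; have := tt0 tw ty; rewrite wy.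
    have [l1 l2] := (L _ t1 n1, L _ t2 n2).
    have M y : g y1 y -> g y2 y -> y = k \/ y = w.
      apply: (@codeg_eq _ _ sat y1 y2); rewrite 1?(gs y1) 1?(gs y2) //.
      by rewrite eq_sym.
    have [f1 F1] := unit_exists l1 tw (etrans (gs y1 w) t1).
    have [f2 F2] := unit_exists l2 tw (etrans (gs y2 w) t2).
    (* A far vertex that carries units for lone vertices on the different hubs [k] and [x] needs a
       third near neighbour for its own link with the root, and then holds two units. *)
    have big y f zz ez : lone y -> g k y -> unit_at y f -> lone zz -> g x zz -> unit_at zz ez -> f = ez -> (1 < phi f)%R.
      move=> ly ky Fy lzz xzz Ez D; subst ez.
      have yzz : y != zz.
        apply/eqP => D; subst zz; case: (noxk y) => //.
        by case/andP: (lone_outer ly).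
      have [ff' yf zzf] := unit_shared ly lzz yzz Fy Ez.
      apply: (far_unit_pos2 ff' ly); first by rewrite gs.
      have [nyy nzz] := (lone_near sat ly, lone_near sat lzz).
      case: (indep_link sat ind (far_outer ff')) => [[h [a [b [[vh ab] [ha hb ea eb [na nb]]]]]]|[s [es ts]]].
        case: (near_gt2 yzz ab _ _ ea eb nyy nzz na nb) => //; rewrite 1?gs // => -[D1 D2]; subst a b.
          by case/eqP: xk; rewrite -(lone_hub sat ly vk vh ky ha) (lone_hub sat lzz vx vh xzz hb).
        by case/eqP: xk; rewrite -(lone_hub sat ly vk vh ky hb) (lone_hub sat lzz vx vh xzz ha).
      apply: (@ndeg_ge3 _ g f near y zz s); rewrite // 1?(gs f) ?(twin_near sat) //.
        by apply/eqP => D; subst s; apply: lone_twin ly ts.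
      by apply/eqP => D; subst s; apply: lone_twin lzz ts.
    have [o1 o2] := (unit_outer l1 F1, unit_outer l2 F2).
    have [p1 p2] := (proj2 F1, proj2 F2).
    case: (eqVneq f1 e) => [D|a1].
      by subst f1; apply: (@duo e e') => //; apply: (big y1 e z e l1 k1 F1 lz xz E).
    case: (eqVneq f1 e') => [D|a2]; last by apply: (@tri e e' f1); rewrite // eq_sym.
    subst f1; apply: (@duo e' e) => //.
    exact: (big y1 e' z' e' l1 k1 F1 lz' xz' E').
  + apply: (two t ot); first exact: far_unit_pos2 ct lz tz n3.
    exact: far_neq lz lz' N vx tw ct zt E'.
- move=> [t [y1 [y2 [[kt tz y12] [t1 t2 z1 z2]]]]].
  case: (hub_nbr vk kt) => [D|vt|ot].
  + subst t; case/eqP: y12; transitivity x; first exact: zhub.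
    by apply/esym; apply: zhub.
  + by have := ind vk vt; rewrite kt.
  have tv : t != v by case/andP: ot.
  have nt : near t by apply: nearI vk kt.
  have Oy y : g t y -> g z y -> outer y.
    move=> ty zy; apply: (outerI sat oz zy); apply/negP => vy.
    by have D := zhub _ vy zy; subst y; case: (noxk t); rewrite // gs.
  have far_w y : far y -> g z y -> g w y -> (0 < phi y)%R /\ y != e'.
    move=> fy zy wy; split; last exact: far_neq lz lz' N vx tw fy zy E'.
    by apply: (far_lone_pos sat deg3 ind fy lz); rewrite gs.
  have lone_case y : lone y -> g z y -> g w y -> y != z' -> good.
    move=> ly zy wy n; have yw : y != w by rewrite eq_sym (gneq sat).
    apply: (@tri z y e') => //; first exact: lone_outer.
    - exact: (gneq sat).
    - exact: lone_neq ly n E'.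
    - exact: zpos zy (lone_near sat ly) yw.
    - apply: (lone_pos sat ly); have := @ndeg_ge1 _ g y twin w; rewrite gs wy tw => /(_ isT isT).
      have zw' : z != w by apply: (gneq sat).
      have := @ndeg_ge2 _ g y near z w zw'; rewrite !(gs y) zy wy nw (lone_near sat lz) => /(_ isT isT isT isT).
      alia.
  case: (boolP (twin t)) => tt.
    have D := uw _ tt; subst t.
    have cls y : g w y -> g z y -> lone y \/ far y.
      move=> wy zy; case: (outer_cases sat (Oy _ wy zy)) => c; [by left| |by right].
      by have := tt0 tw c; rewrite wy.
    wlog l1 : y1 y2 y12 t1 t2 z1 z2 / lone y1 \/ (far y1 /\ far y2).
      move=> W; case: (cls _ t1 z1) => c1; first by apply: (W y1 y2); auto.
      case: (cls _ t2 z2) => c2; last by apply: (W y1 y2); auto.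
      by apply: (W y2 y1); rewrite // 1?eq_sym //; left.
    case: l1 => [l1|[f1 f2]]; last first.
      have [a b] := far_w _ f1 z1 t1; have [c e1] := far_w _ f2 z2 t2.
      by apply: (@tri y1 y2 e') => //; apply: far_outer.
    case: (eqVneq y1 z') => [D|n]; last exact: (lone_case y1).
    subst y1; have n2 : y2 != z' by rewrite eq_sym.
    case: (cls _ t2 z2) => c2; first exact: (lone_case y2).
    have [c e1] := far_w _ c2 z2 t2.
    have z'w' : z' != w by apply: (gneq sat).
    apply: (@tri z z' y2) => //; try exact: lone_outer; try exact: far_outer.
    - by apply/eqP => D; subst y2; apply: lone_far lz c2.
    - exact: zpos z1 (lone_near sat lz') z'w'.
    - apply: (lone_pos sat lz'); have := ndeg_ge1 z'w tw.
      have zw' : z != w by apply: (gneq sat).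
      have := @ndeg_ge2 _ g z' near z w zw'; rewrite !(gs z') z1 wz' nw (lone_near sat lz) => /(_ isT isT isT isT).
      alia.
  wlog y1w : y1 y2 y12 t1 t2 z1 z2 / y1 != w.
    move=> W; case: (eqVneq y1 w) => [D|n]; last exact: (W y1 y2).
    by apply: (W y2 y1); rewrite // -?D eq_sym.
  have o1 := Oy _ t1 z1.
  have tw1 : ~~ twin y1 by apply/negP => D; rewrite (uw _ D) eqxx in y1w.
  have zt' : z != t by rewrite eq_sym.
  have n3 : (d y1 twin = 0 -> 2 < d y1 near).
    move=> q; apply: (@mixed_near _ _ sat v ind y1 z t x k) => //; rewrite 1?gs //.
    exact: (lone_near sat).
  have three s : twin s -> g y1 s -> 2 < d y1 near.
    move=> ts ys; have D := uw _ ts; subst s.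
    apply: (@ndeg_ge3 _ g y1 near z t w); rewrite // 1?(gs y1) ?(lone_near sat) //.
      by apply: (gneq sat).
    by apply/eqP => D; subst t; rewrite tw in tt.
  have {}n3 : 2 < d y1 near.
    by case: (posnP (d y1 twin)) => [/n3//|/ndeg_gt0[s [ys ts]]]; apply: three ts ys.
  case: (outer_cases sat o1) => c1.
  + have p1 : (0 < phi y1)%R by apply: (lone_pos sat c1); alia.
    have pz := zpos y1 z1 (lone_near sat c1) y1w.
    have zy1 : z != y1 by apply: (gneq sat).
    case: (eqVneq y1 z') => [D|n].
      subst y1; apply: (@duo z' z) => //; first by rewrite eq_sym.
      by apply: (lone_pos2 sat c1); have := ndeg_ge1 z'w tw; alia.
    by apply: (@tri z y1 e') => //; apply: lone_neq c1 n E'.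
  + by rewrite c1 in tw1.
  + apply: (two y1 o1); first by apply: (far_unit_pos2 c1 lz) => //; rewrite gs.
    exact: far_neq lz lz' N vx tw c1 z1 E'.
Qed.

End NoTwinEdge.

Lemma dense_tau0 : dense g.
Proof.
apply: (@dense_phi _ _ sat v); rewrite tau2_sum (tau2_indep ind) degv.
suff : good by [].
case: (pickP twin) => [w tw|W0]; last by apply: no_twin_sum => // w; rewrite W0.
case: (pickP [pred p : T * T | [&& twin p.1, twin p.2 & g p.1 p.2]]) => [[a b] /and3P[/= ta tb ab]|H].
  exact: (@twin_edge a b).
have tt0 w1 w2 : twin w1 -> twin w2 -> ~~ g w1 w2.
  by move=> a b; apply/negP => c; have := H (w1, w2); rewrite /= a b c.
case: (pickP [pred w2 | twin w2 && (w != w2)]) => [w2 /andP[tw2 n]|H'].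
  exact: (two_twins tt0 tw tw2 n).
apply: (one_twin tt0 tw) => w' tw'; apply/eqP; rewrite eq_sym; apply/negPn/negP => n.
by have := H' w'; rewrite /= tw' n.
Qed.
End Deg3Tau0Twin.

(** * Minimum degree two, a root with independent neighbourhood *)

Section TwoHubs.
Variables (T : finType) (g : rel T).
Hypothesis sat : K23_saturated g.
Variables v a0 b0 : T.
Hypothesis Nv : forall y, g v y -> y = a0 \/ y = b0.
Local Notation lone := (lone g v).
Local Notation twin := (twin g v).
Local Notation far := (far g v).
Local Notation near := (near g v).
Variable w : T.
Hypothesis tw : twin w.

Lemma hub_w h : g v h -> g h w.
Proof.
move=> vh; have [h1 [h2 [n v1 v2 w1 w2]]] := twin_hubs sat tw.
case: (Nv vh) (Nv v1) (Nv v2) => -> [] E1 [] E2; subst h1 h2 => //;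
by rewrite eqxx in n.
Qed.

(** With two hubs in all, every twin is on both, and these share the root as well. *)
Lemma twin_uniq w' : twin w' -> w' = w.
Proof.
move=> tw'; have [h1 [h2 [n v1 v2 w1 w2]]] := twin_hubs sat tw'.
by apply: (twin_hub_uniq sat n v1 v2 tw' tw) => //; apply: hub_w.
Qed.

Lemma near_lone_w y : near y -> y != w -> lone y.
Proof. by rewrite (near_split sat) => /orP[//|/twin_uniq ->]; rewrite eqxx. Qed.

Lemma lone_neq_w z : lone z -> z != w.
Proof. by move=> lz; apply/eqP => E; subst z; apply: lone_twin lz tw. Qed.

Lemma far_neq_w x : far x -> x != w.
Proof. by move=> fx; apply/eqP => E; subst x; apply: twin_far tw fx. Qed.
End TwoHubs.

Section Deg2Tau0.
Variables (T : finType) (g : rel T).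
Hypothesis sat : K23_saturated g.
Local Notation d := (ndeg g).
Local Notation deg x := (ndeg g x predT).
Hypothesis deg2 : forall x, 2 <= deg x.
Variables v a0 b0 : T.
Hypotheses (va0 : g v a0) (vb0 : g v b0) (ab0 : a0 != b0).
Hypothesis Nv : forall y, g v y -> y = a0 \/ y = b0.
Hypothesis ind : forall h h', g v h -> g v h' -> ~~ g h h'.
Let gs := gsym sat.
Local Notation outer := (outer g v).
Local Notation lone := (lone g v).
Local Notation twin := (twin g v).
Local Notation far := (far g v).
Local Notation near := (near g v).
Local Notation phi := (phi g v).

(** Here [0] has to be exceeded. Every [phi] is at least [d near - 2], which is nonnegative, and the
    contact of a neighbour of [a0] with the hub [b0] has three near neighbours. *)
Lemma deg2_no_twin : (forall w, ~~ twin w) -> (0 < \sum_(x | outer x) phi x)%R.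
Proof.
move=> W0.
have le y : outer y -> ((d y near)%:Z - 2 <= phi y)%R.
  move=> oy; have := outer_near2 sat ind oy (no_twin W0 y).
  case: (outer_cases sat oy) => l.
  - by rewrite (phi_lone sat l) (no_twin W0); alia.
  - by have := W0 y; rewrite l.
  - by rewrite (phi_far sat l); alia.
have ge0 y : outer y -> (0 <= phi y)%R.
  by move=> oy; have := outer_near2 sat ind oy (no_twin W0 y); have := le y oy; alia.
have [u [a0u uv]] : exists u, g a0 u /\ u != v.
  have := deg2 a0; case/ndeg_gt1 => p [q [pq ap _ aq _]].
  case: (eqVneq p v) => [E|n]; last by exists p.
  by exists q; rewrite -E eq_sym.
have ou : outer u.
  by case: (hub_nbr va0 a0u) => // E; [rewrite E eqxx in uv|have := ind va0 E; rewrite a0u].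
have lu : lone u by apply: (near_lone sat W0); apply: nearI va0 a0u.
have b0u : ~~ g b0 u.
  apply/negP => bu; have := W0 u.
  by rewrite (common_hubs_twin sat ind ab0 va0 vb0 a0u bu uv).
have [y [_ oy n3 _]] := contact sat ind W0 lu va0 a0u vb0 b0u.
by have := sum_ge1 ge0 oy; have := le y oy; alia.
Qed.

Variable w : T.
Hypothesis tw : twin w.

Let hub_w := hub_w sat Nv tw.
Let twin_uniq := twin_uniq sat Nv tw.
Let near_lone_w := near_lone_w sat Nv tw.
Let near_w : near w := twin_near sat tw.
Let lone_neq_w := lone_neq_w tw.

(** The vertices with negative [phi], namely [-1]: of degree two, adjacent to [w] and to one far
    vertex. *)
Definition poor_far : pred T := fun r => [&& far r, d r near == 1 & d r far == 1].
Definition detached : pred T := fun y => far y && ~~ g y w.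
Definition deficient : pred T := fun r => poor_far r && (d r detached == 0).
Definition pay_poor_far (y r : T) : nat := [&& g y r, poor_far r & detached y].
(** Detached vertices pay their poor neighbours. The last term lifts the poor vertices that remain
    unpaid to zero, so that the sum of [phi] exceeds [0] as soon as positive [net] outweighs the
    number of deficient vertices. *)
Definition net (x : T) : int :=
  (phi x + (\sum_(y | outer y) pay_poor_far y x)%N%:Z - (\sum_(y | outer y) pay_poor_far x y)%N%:Z + (deficient x : nat)%:Z)%R.

Local Notation some_net_pos := (exists2 e, outer e & (0 < net e)%R).

Lemma net_sum : (\sum_(x | outer x) net x = \sum_(x | outer x) phi x + #|deficient|%:Z)%R.
Proof.
rewrite big_split /= -sum_transfer; congr (_ + _)%R; apply: sum_indicator => x.
by case/andP=> /and3P[/far_outer].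
Qed.

Lemma received_poor_far x : \sum_(y | outer y) pay_poor_far y x = poor_far x * d x detached.
Proof.
rewrite ndegE big_distrr big_mkcond /=; apply: eq_bigr => y _; rewrite /pay_poor_far gs.
case oy: (outer y); last by rewrite /detached /far oy !andbF muln0.
by case: (g x y); case: (poor_far x); rewrite ?mul0n ?mul1n.
Qed.

Lemma paid_poor_far x : \sum_(y | outer y) pay_poor_far x y = detached x * d x poor_far.
Proof.
rewrite ndegE big_distrr big_mkcond /=; apply: eq_bigr => y _; rewrite /pay_poor_far.
case oy: (outer y); last by rewrite /poor_far /far oy !andbF muln0.
by case: (g x y); case: (poor_far y); case: (detached x).
Qed.

Lemma near_not_poor_far x : near x -> poor_far x = false.
Proof. by move=> /near_farF; rewrite /poor_far => ->. Qed.
Lemma near_not_detached x : near x -> detached x = false.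
Proof. by move=> /near_farF; rewrite /detached => ->. Qed.

Lemma net_lone x : lone x -> net x = ((d x near + d x twin)%:Z - 2)%R.
Proof.
move=> l; have nx := lone_near sat l; rewrite /net received_poor_far paid_poor_far /deficient near_not_poor_far // near_not_detached //.
by rewrite (phi_lone sat l); alia.
Qed.

Lemma net_twin x : twin x -> net x = ((d x twin)%:Z)%R.
Proof.
move=> l; have nx := twin_near sat l; rewrite /net received_poor_far paid_poor_far /deficient near_not_poor_far // near_not_detached //.
by rewrite (phi_twin l); alia.
Qed.

Lemma net_attached x : far x -> g x w -> 1 < d x near -> net x = ((2 * d x near + d x far)%:Z - 4)%R.
Proof.
move=> f xw n; rewrite /net received_poor_far paid_poor_far /deficient /detached xw andbF mul0n.
have -> : poor_far x = false by rewrite /poor_far f; case: eqP n => // ->.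
by rewrite (phi_far sat f); alia.
Qed.

Lemma detached_near x : far x -> ~~ g x w -> 1 < d x near.
Proof.
move=> f xw; apply: (outer_near2 sat ind (far_outer f)).
apply/eqP; rewrite -leqn0 leqNgt; apply/negP => /ndeg_gt0[t [xt tt]].
by rewrite -(twin_uniq tt) xt in xw.
Qed.

Lemma net_detached x : far x -> ~~ g x w ->
  (net x = (2 * d x near + d x far)%:Z - 4 - (d x poor_far)%:Z)%R.
Proof.
move=> f xw; have n := detached_near f xw; rewrite /net received_poor_far paid_poor_far /deficient /detached f xw /=.
have -> : poor_far x = false by rewrite /poor_far f; case: eqP n => // ->.
by rewrite (phi_far sat f); alia.
Qed.

Lemma poor_far_le x : d x poor_far <= d x far.
Proof. by apply: ndeg_le => y _ /andP[]. Qed.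

Lemma poor_far_nbrs r : poor_far r -> exists r1, [/\ g r w, g r r1, far r1 &
  forall y, g r y -> y = w \/ y = r1].
Proof.
case/and3P=> fr /eqP n1 /eqP f1.
have rw : g r w.
  case: (indep_link sat ind (far_outer fr)) => [[h [y1 [y2 [[_ n] [_ _ a b [c e]]]]]]|[t [a b]]].
    by have := @ndeg_ge2 _ g r near y1 y2 n a c b e; rewrite n1.
  by rewrite -(twin_uniq b).
have [r1 [rr1 fr1]] : exists r1, g r r1 /\ far r1 by apply: ndeg_gt0; rewrite f1.
exists r1; split=> // y ry; case: (far_nbr sat fr ry) => c; [left|right].
  by apply: (@ndeg_le1 _ g r near) => //; rewrite ?n1 // near_w.
by apply: (@ndeg_le1 _ g r far) => //; rewrite f1.
Qed.

Lemma deficient_nbrs r : deficient r -> exists r1, [/\ g r w, g r r1, far r1, g r1 w &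
  forall y, g r y -> y = w \/ y = r1].
Proof.
case/andP=> nr /eqP o0; have [r1 [rw rr1 fr1 N]] := poor_far_nbrs nr.
exists r1; split=> //; apply/negPn/negP => n.
by have := ndeg0 o0 rr1; rewrite /detached fr1 n.
Qed.

(** A detached vertex has two near neighbours and therefore a unit for each of its far
    neighbours. *)
Lemma net_ge0 x : outer x -> (0 <= net x)%R.
Proof.
move=> o; have N2 := outer_near2 sat ind o; have S := d_near sat v x.
case: (outer_cases sat o) => c.
- rewrite (net_lone c); case: (posnP (d x twin)) => [/N2|]; alia.
- by rewrite (net_twin c).
- case: (boolP (g x w)) => xw; last first.
    by rewrite net_detached //; have := detached_near c xw; have := poor_far_le x; alia.
  case: (ltnP 1 (d x near)) => n; first by rewrite net_attached //; alia.
  have := ndeg_ge1 xw near_w; have := deg2 x; rewrite (deg_far sat c) => D n1.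
  have E : d x near = 1 by alia.
  have ox : detached x = false by rewrite /detached xw andbF.
  rewrite /net received_poor_far paid_poor_far ox mul0n (phi_far sat c) E.
  case: (eqVneq (d x far) 1) => f1.
    have nx : poor_far x by rewrite /poor_far c E f1.
    rewrite /deficient nx f1 /= mul1n; case: (posnP (d x detached)) => [->|]; alia.
  have nx : poor_far x = false by rewrite /poor_far c E (negbTE f1).
  by rewrite /deficient nx; alia.
Qed.

Lemma poor_far_near y z : poor_far y -> near z -> g y z -> z = w.
Proof.
move=> ny nz yz; have [r1 [yw yr fr N]] := poor_far_nbrs ny.
by case: (N _ yz) => // E; subst z; rewrite (near_farF nz) in fr.
Qed.

Definition net_unit z e := carries g v z e /\ (0 < net e)%R.

Lemma net_unit_outer z e : lone z -> net_unit z e -> outer e.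
Proof. by move=> lz [/(carrier_outer lz)]. Qed.

Lemma net_unit_lone z y : lone z -> g z w -> g z y -> near y -> y != w -> net_unit z z.
Proof.
move=> lz zw zy ny yw; split; first by left.
rewrite (net_lone lz); have := ndeg_ge1 zw tw.
by have := @ndeg_ge2 _ g z near y w yw zy ny zw near_w; alia.
Qed.

Lemma attached_near2 y z : g y w -> g y z -> lone z -> 1 < d y near.
Proof.
move=> yw yz lz; apply: (@ndeg_ge2 _ g y near z w); rewrite ?near_w ?(lone_near sat) //.
exact: lone_neq_w.
Qed.

Lemma net_unit_attached z y : lone z -> g z y -> far y -> g y w -> 2 < deg y -> net_unit z y.
Proof.
move=> lz zy fy yw D; split; first by right.
have n2 := @attached_near2 y z yw (etrans (gs y z) zy) lz.
by rewrite net_attached //; rewrite (deg_far sat fy) in D; alia.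
Qed.

Lemma net_unit_attached_far z y r : lone z -> g z y -> far y -> g y w -> g y r -> far r -> net_unit z y.
Proof.
move=> lz zy fy yw yr fr; apply: net_unit_attached => //.
rewrite (deg_far sat fy); have := ndeg_ge1 yr fr.
by have := @attached_near2 y z yw (etrans (gs y z) zy) lz; alia.
Qed.

Lemma net_unit_detached z y r : lone z -> g z y -> far y -> ~~ g y w -> g y r -> far r -> ~~ poor_far r ->
  net_unit z y.
Proof.
move=> lz zy fy yw yr fr nr; split; first by right.
rewrite net_detached //; have := detached_near fy yw.
have : d y poor_far < d y far.
  rewrite /ndeg; apply: proper_card; apply/properP; split.
    by apply/subsetP=> x; rewrite !inE => /andP[-> /and3P[-> _ _]].
  by exists r; rewrite !inE ?yr ?fr // (negbTE nr).
alia.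
Qed.

Lemma w_pair : exists h z z', [/\ g v h, z != z' &
  [/\ lone z, lone z', g h z, g h z' & [/\ g w z, g w z' &
   forall y, g z y -> g z' y -> y = h \/ y = w]]].
Proof.
case: (indep_link sat ind (twin_outer tw)) => [[x [z [z' [[vx n] [xz xz' wz wz' [nz nz']]]]]]|[t [wt tt]]]; last first.
  by rewrite (twin_uniq tt) (girr sat) in wt.
have L y : g w y -> near y -> lone y.
  move=> wy ny; apply: near_lone_w => //; rewrite eq_sym; exact: (gneq sat).
exists x, z, z'; split=> //; split; rewrite ?L //; split=> //.
apply: (@codeg_eq _ _ sat z z') => //; rewrite 1?gs //.
by apply: contraTneq vx => ->; rewrite (outer_v' (twin_outer tw)).
Qed.

Lemma net_unit_neq z z' x e e' : z != z' -> lone z -> lone z' ->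
  (forall y, g z y -> g z' y -> y = x \/ y = w) -> g v x ->
  net_unit z e -> net_unit z' e' -> e != e'.
Proof. by move=> n lz lz' N vx [A _] [B _]; apply: (carrier_neq n lz lz' N vx tw A B). Qed.

Lemma sum_pos_of_net : (forall r, deficient r -> False) -> some_net_pos ->
  (0 < \sum_(x | outer x) phi x)%R.
Proof.
move=> no [e oe pe]; have := sum_ge1 net_ge0 oe; rewrite net_sum.
have -> : #|deficient| = 0 by apply: eq_card0 => r; apply/negP => /no.
by alia.
Qed.

Lemma net_unit_pos z e : lone z -> net_unit z e -> some_net_pos.
Proof. by move=> lz E; exists e; [apply: net_unit_outer lz E|case: E]. Qed.

Lemma deg2_far y z : far y -> g y w -> g y z -> lone z -> deg y <= 2 ->
  forall x, g y x -> x = w \/ x = z.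
Proof.
move=> fy yw yz lz D x yx.
by apply: (@ndeg_le2 _ g y predT w z); rewrite // eq_sym lone_neq_w.
Qed.

(** A lone neighbour of [w] with a second near neighbour is positive, and so are far neighbours of
    it that are on [w] with degree three or detached next to a far vertex that is not poor. The link
    always exhibits one of these, unless it meets a far vertex of degree two on [w]. *)
Lemma pair_link h z z' : g v h -> lone z -> lone z' -> g h z -> g h z' ->
  g w z -> g w z' -> linked g z z' ->
  some_net_pos \/
  (exists y q, [/\ q = z \/ q = z', far y, g y w, g y q & deg y <= 2]).
Proof.
move=> vh lz lz' hz hz' wz wz' [t [y1 [y2 [[zt tz' y12] [t1 t2 z1 z2]]]]].
have [zw z'w] : g z w /\ g z' w by rewrite !(gs _ w).
have [oz oz'] := (lone_outer lz, lone_outer lz').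
have hub q x : lone q -> g h q -> g v x -> g q x -> x = h.
  by move=> lq hq vx qx; apply: (lone_hub sat lq) => //; rewrite gs.
have two q y : lone q -> g q y -> far y -> g y w -> q = z \/ q = z' ->
   some_net_pos \/
   (exists y q, [/\ q = z \/ q = z', far y, g y w, g y q & deg y <= 2]).
  move=> lq qy fy yw Q; case: (ltnP 2 (deg y)) => D.
    by left; apply: (net_unit_pos lq (net_unit_attached lq qy fy yw D)).
  by right; exists y, q; rewrite (gs y q).
have nearz' y : g z' y -> near y -> y != w -> some_net_pos.
  by move=> a b c; apply: (net_unit_pos lz' (net_unit_lone lz' z'w a b c)).
case: (outer_nbr sat oz zt) => [vt|ot].
  have E := hub _ _ lz hz vt zt; subst t; left.
  wlog n : y1 y2 y12 t1 t2 z1 z2 / y1 != w.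
    move=> W; case: (eqVneq y1 w) => [E|n]; last exact: (W y1 y2).
    by apply: (W y2 y1); rewrite // -?E eq_sym.
  by apply: (nearz' y1) => //; apply: (outer_hub_near sat ind oz' vh).
have Oz' y : g z' y -> y != h -> outer y.
  move=> zy n; apply: (outerI sat oz' zy); apply/negP => vy.
  by rewrite (hub _ _ lz' hz' vy zy) eqxx in n.
case: (near_far ot) => ct.
  case: (eqVneq t w) => [E|n]; last by left; apply: (net_unit_pos lz (net_unit_lone lz zw zt ct n)).
  subst t.
  wlog n : y1 y2 y12 t1 t2 z1 z2 / y1 != h.
    move=> W; case: (eqVneq y1 h) => [E|n]; last exact: (W y1 y2).
    by apply: (W y2 y1); rewrite // -?E eq_sym.
  case: (near_far (Oz' _ z1 n)) => c1.
    by left; apply: (nearz' y1) => //; rewrite eq_sym (gneq sat).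
  by apply: (two z' y1); rewrite ?(gs y1); auto.
left; have noh y : g t y -> y != h.
  by move=> ty; apply: contraTneq ty => ->; rewrite (hub_far sat vh ct).
case: (boolP (g t w)) => tw'.
  wlog n : y1 y2 y12 t1 t2 z1 z2 / y1 != w.
    move=> W; case: (eqVneq y1 w) => [E|n]; last exact: (W y1 y2).
    by apply: (W y2 y1); rewrite // -?E eq_sym.
  case: (near_far (Oz' _ z1 (noh _ t1))) => c1; first exact: (nearz' y1).
  exact: (net_unit_pos lz (net_unit_attached_far lz zt ct tw' t1 c1)).
have n1 : y1 != w by apply: contraNneq tw' => <-.
case: (near_far (Oz' _ z1 (noh _ t1))) => c1; first exact: (nearz' y1).
apply: (net_unit_pos lz (net_unit_detached lz zt ct tw' t1 c1 _)).
apply/negP => ny; have := poor_far_near ny (lone_near sat lz') (etrans (gs y1 z') z1).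
by move=> E; have := lone_neq_w lz'; rewrite E eqxx.
Qed.

Lemma pair_sat h z z' : g v h -> lone z -> lone z' -> g h z -> g h z' -> z != z' ->
  g w z -> g w z' ->
  some_net_pos \/
  (exists y q, [/\ lone q, g h q, g w q, far y & [/\ g y w, g y q & deg y <= 2]]).
Proof.
move=> vh lz lz' hz hz' n wz wz'; have [zw z'w] : g z w /\ g z' w by rewrite !(gs _ w).
case: (boolP (g z z')) => zz'.
  left; apply: (net_unit_pos lz (net_unit_lone lz zw zz' (lone_near sat lz') _)).
  exact: lone_neq_w.
case: (nonadj_linked sat n zz') => L.
- case: (pair_link vh lz lz' hz hz' wz wz' L) => [|[y [q [Q b c e f]]]]; [by left|right].
  by exists y, q; case: Q => E; subst q.
- case: (pair_link vh lz' lz hz' hz wz' wz L) => [|[y [q [Q b c e f]]]]; [by left|right].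
  by exists y, q; case: Q => E; subst q.
Qed.

Lemma other_hub h : g v h -> exists2 k, g v k & h != k.
Proof.
by case/Nv=> ->; [exists b0|exists a0; rewrite // eq_sym].
Qed.

(** Saturation for [y] and the other hub [k]. As [y] sees only [w] and [q], the link either runs
    through [w], which yields the second pair, or exhibits a neighbour of [q] on [k], which makes
    [q] positive. *)
Lemma second_pair h k y q : g v h -> g v k -> h != k -> lone q -> g h q -> g w q -> far y -> g y w -> g y q ->
  deg y <= 2 ->
  some_net_pos \/
  (exists u u', [/\ lone u, lone u', u != u', g k u & [/\ g k u', g w u & g w u']]).
Proof.
move=> vh vk hk lq hq wq fy yw yq dy; have N := deg2_far fy yw yq lq dy.
have yk : g y k = false by apply: (hub_far sat vk fy).
have nyk : y != k by apply: contraTneq vk => <-; rewrite (outer_v' (far_outer fy)).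
have wout t : g w t -> g k t -> lone t.
  move=> wt kt; apply: near_lone_w; last by rewrite eq_sym (gneq sat).
  exact: (outer_hub_near sat ind (twin_outer tw) vk).
have qpos t : g q t -> g k t -> t != w -> some_net_pos.
  move=> qt kt n; apply: (net_unit_pos lq (net_unit_lone lq (etrans (gs q w) wq) qt _ n)).
  exact: (outer_hub_near sat ind (lone_outer lq) vk).
case: (nonadj_linked sat nyk _); rewrite ?yk //.
- move=> [t [y1 [y2 [[yt tk y12] [t1 t2 k1 k2]]]]].
  case: (N _ yt) => E; subst t.
    by right; exists y1, y2; rewrite !wout.
  left; case: (eqVneq y1 w) => [E|n].
    by subst y1; apply: (qpos y2) => //; rewrite eq_sym.
  by apply: (qpos y1).
- move=> [t [y1 [y2 [[kt ty y12] [t1 t2 z1 z2]]]]].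
  have [tw' tq] : g t w /\ g t q.
    by case: (N _ z1) => E1; case: (N _ z2) => E2; subst y1 y2; rewrite ?eqxx // in y12.
  left; apply: (qpos t) => //; first by rewrite gs.
  exact: (gneq sat).
Qed.

(** If nothing positive turns up earlier, there are degree-two vertices [y] on [w], [q] and [x] on
    [w], [p], with [q] and [p] lone on different hubs. A link between [y] and [x] forces [q] and [p]
    to be adjacent, and [q] is positive after all. *)
Lemma no_deficient_pos : some_net_pos.
Proof.
have [h [z [z' [vh nz [lz lz' hz hz' [wz wz' _]]]]]] := w_pair.
case: (pair_sat vh lz lz' hz hz' nz wz wz') => [//|[y [q [lq hq wq fy [yw yq dy]]]]].
have [k vk hk] := other_hub vh.
have Ny := deg2_far fy yw yq lq dy.
case: (second_pair vh vk hk lq hq wq fy yw yq dy) => [//|[u [u' [lu lu' nu ku [ku' wu wu']]]]].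
case: (pair_sat vk lu lu' ku ku' nu wu wu') => [//|[x [p [lp kp wp fx [xw xp dx]]]]].
have Nx := deg2_far fx xw xp lp dx.
have qp : q != p.
  apply/eqP => E; subst p; case/eqP: hk; apply: (lone_hub sat lq) => //.
have yx : y != x.
  apply/eqP => E; subst x; case: (Ny _ xp) => E.
    by have := lone_neq_w lp; rewrite E eqxx.
  by rewrite E eqxx in qp.
have nyx : ~~ g y x.
  apply/negP => D; case: (Ny _ D) => E; subst x; first exact: twin_far tw fx.
  exact: lone_far lq fx.
have key : g p q \/ g q p -> some_net_pos.
  move=> pq; have {}pq : g q p by case: pq; rewrite // gs.
  apply: (net_unit_pos lq (net_unit_lone lq (etrans (gs q w) wq) pq (lone_near sat lp) _)).
  exact: lone_neq_w.
case: (nonadj_linked sat yx nyx) => -[t [y1 [y2 [[yt tx y12] [t1 t2 x1 x2]]]]].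
- have [tw' tp] : g t w /\ g t p.
    by case: (Nx _ x1) => E1; case: (Nx _ x2) => E2; subst y1 y2; rewrite ?eqxx // in y12.
  by case: (Ny _ yt) => E; subst t; [rewrite (girr sat) in tw'|apply: key; right].
- have [tw' tp] : g t w /\ g t q.
    by case: (Ny _ x1) => E1; case: (Ny _ x2) => E2; subst y1 y2; rewrite ?eqxx // in y12.
  by case: (Nx _ yt) => E; subst t; [rewrite (girr sat) in tw'|apply: key; left].
Qed.

(** Saturation for [r] and [q], where [r] sees only [w] and [r1], gives [q] a second near neighbour
    or a far neighbour that is positive. *)
Lemma deficient_unit r q : deficient r -> lone q -> g w q -> exists e, net_unit q e.
Proof.
move=> nr lq wq; have [r1 [rw rr1 fr1 r1w Nr]] := deficient_nbrs nr.
have fr : far r by case/andP: nr => /and3P[].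
have qw : g q w by rewrite gs.
have [r1r wr] : g r1 r /\ g w r by rewrite !(gs _ r).
have oq := lone_outer lq; have [h vh hq] := near_hub sat (lone_near sat lq).
have qhub x : g v x -> g q x -> x = h.
  by move=> vx qx; apply: (lone_hub sat lq) => //; rewrite gs.
have rq : r != q by apply/eqP => E; subst r; apply: lone_far lq fr.
have nrq : ~~ g r q.
  apply/negP => E; case: (Nr _ E) => D; subst q; first exact: lone_twin lq tw.
  exact: lone_far lq fr1.
have Oq y : g q y -> y != h -> outer y.
  move=> qy n; apply: (outerI sat oq qy); apply/negP => vy.
  by rewrite (qhub _ vy qy) eqxx in n.
have self y : g q y -> near y -> y != w -> exists e, net_unit q e.
  by move=> a b c; exists q; apply: net_unit_lone qw a b c.
have nofh x y : far x -> g x y -> y != h.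
  by move=> fx xy; apply: contraTneq xy => ->; rewrite (hub_far sat vh fx).
(* If [y] has degree two, saturation for [y] and [r] makes [q] adjacent to [r1], which carries a
   unit because of its far neighbour [r]. *)
have on_case y : g q y -> far y -> g y w -> exists e, net_unit q e.
  move=> qy fy yw; case: (ltnP 2 (deg y)) => D; first by exists y; apply: net_unit_attached.
  have Ny := deg2_far fy yw (etrans (gs y q) qy) lq D.
  have yr : y != r by apply/eqP => E; subst y; rewrite gs (negbTE nrq) in qy.
  have nyr : ~~ g y r.
    apply/negP => E; case: (Ny _ E) => E'; subst r; first exact: twin_far tw fr.
    by rewrite eqxx in rq.
  have [qr1|] : g q r1 \/ False.
    case: (nonadj_linked sat yr nyr) => -[t [y1 [y2 [[yt tx y12] [t1 t2 x1 x2]]]]].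
    - have [tw' tp] : g t w /\ g t r1.
        by case: (Nr _ x1) => E1; case: (Nr _ x2) => E2; subst y1 y2; rewrite ?eqxx // in y12.
      by case: (Ny _ yt) => E; subst t; [rewrite (girr sat) in tw'|left].
    - have [tw' tp] : g t w /\ g t q.
        by case: (Ny _ x1) => E1; case: (Ny _ x2) => E2; subst y1 y2; rewrite ?eqxx // in y12.
      by case: (Nr _ yt) => E; subst t; [rewrite (girr sat) in tw'|left; rewrite gs].
    by exists r1; apply: net_unit_attached_far r1r fr.
  by [].
case: (nonadj_linked sat rq nrq) => -[t [y1 [y2 [[yt tx y12] [t1 t2 x1 x2]]]]].
- case: (Nr _ yt) => E; subst t.
    wlog n : y1 y2 y12 t1 t2 x1 x2 / y1 != h.
      move=> W; case: (eqVneq y1 h) => [E|n]; last exact: (W y1 y2).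
      by apply: (W y2 y1); rewrite // -?E eq_sym.
    case: (near_far (Oq _ x1 n)) => c.
      by apply: (self y1) => //; rewrite eq_sym (gneq sat).
    by apply: (on_case y1); rewrite // gs.
  wlog n : y1 y2 y12 t1 t2 x1 x2 / y1 != w.
    move=> W; case: (eqVneq y1 w) => [E|n]; last exact: (W y1 y2).
    by apply: (W y2 y1); rewrite // -?E eq_sym.
  case: (near_far (Oq _ x1 (nofh _ _ fr1 t1))) => c; first exact: (self y1).
  case: (boolP (g y1 w)) => y1w; first exact: (on_case y1).
  exists y1; apply: (net_unit_detached lq x1 c y1w (etrans (gs y1 r1) t1) fr1).
  apply/negP => nr1; have [s [_ _ _ Ns]] := poor_far_nbrs nr1.
  have [] : y1 = r.
    case: (Ns _ t1) => E; first by rewrite E eqxx in n.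
    case: (Ns _ r1r) => E'; first by subst r; case: (twin_far tw fr).
    by rewrite E E'.
  by move=> E; subst y1; rewrite gs (negbTE nrq) in x1.
- have [tw' tp] : g t w /\ g t r1.
    by case: (Nr _ x1) => E1; case: (Nr _ x2) => E2; subst y1 y2; rewrite ?eqxx // in y12.
  have th : t != h by rewrite gs in tp; apply: nofh tp.
  case: (near_far (Oq _ yt th)) => c; last exact: (on_case t).
  by apply: (self t) => //; apply: (gneq sat).
Qed.

Lemma deficient_card : #|deficient| <= 2.
Proof.
apply: (tail_card sat tw _ deficient_nbrs) => r; by case/andP=> /and3P[].
Qed.

Lemma net_pos2 e y : far e -> lone y -> g y e -> 2 < d e near -> (1 < net e)%R.
Proof.
move=> fe ly ye n3; case: (boolP (g e w)) => ew.
  by rewrite net_attached //; alia.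
by rewrite net_detached //; have := poor_far_le e; alia.
Qed.

(** The common carrier is a far vertex that sees lone vertices on both hubs. Its third near
    neighbour is [w], or comes from [mixed_near]. *)
Lemma mixed_net_unit z u h k e : lone z -> lone u -> g v h -> g v k -> h != k -> g h z -> g k u ->
  net_unit z e -> net_unit u e -> (1 < net e)%R.
Proof.
move=> lz lu vh vk hk hz ku [A _] [B _].
have zu : z != u.
  by apply/eqP => E; subst u; case/eqP: hk; apply: (lone_hub sat lz).
have [fe ze ue] := carrier_shared lz lu zu A B.
apply: (net_pos2 fe lz ze).
have [ez eu] : g e z /\ g e u by rewrite !(gs e).
have [nz nu] := (lone_near sat lz, lone_near sat lu).
case: (boolP (g e w)) => ew.
  by apply: (@ndeg_ge3 _ g e near z u w); rewrite ?near_w // lone_neq_w.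
apply: (@mixed_near _ _ sat v ind e z u h k) => //.
- exact: far_outer.
- apply/eqP; rewrite -leqn0 leqNgt; apply/negP => /ndeg_gt0[t [xt tt]].
  by rewrite -(twin_uniq tt) xt in ew.
- by apply/negP => tt; apply: lone_twin lu tt.
Qed.

(** Saturation for [r] and the hub [h], with [w] and [r1] as the only neighbours of [r]. In the
    second outcome [r1] itself can carry a unit for [u], as it sees [w] and the far vertex [r]. *)
Lemma third_unit r h : deficient r -> g v h ->
  (exists u, [/\ lone u, g h u & g w u]) \/
  (exists r1 u, [/\ far r1, g r1 w, g r1 r, lone u & g h u /\ g r1 u]).
Proof.
move=> nr vh; have [r1 [rw rr1 fr1 r1w N]] := deficient_nbrs nr.
have fr : far r by case/andP: nr => /and3P[].
have rh : r != h by apply: contraTneq vh => <-; rewrite (outer_v' (far_outer fr)).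
have nrh : ~~ g r h by rewrite (hub_far sat vh fr).
have onear x y : outer x -> g x y -> g h y -> near y.
  by move=> ox xy hy; apply: (outer_hub_near sat ind ox vh).
case: (nonadj_linked sat rh nrh) => -[t [y1 [y2 [[yt tx y12] [t1 t2 x1 x2]]]]].
- case: (N _ yt) => E; subst t.
    left; exists y1; split=> //; apply: near_lone_w; last by rewrite eq_sym (gneq sat).
    exact: onear (twin_outer tw) _ _.
  right; wlog n : y1 y2 y12 t1 t2 x1 x2 / y1 != w.
    move=> W; case: (eqVneq y1 w) => [E|n]; last exact: (W y1 y2).
    by apply: (W y2 y1); rewrite // -?E eq_sym.
  exists r1, y1; split=> //; first by rewrite gs.
  apply: near_lone_w => //; exact: onear (far_outer fr1) _ _.
- have [tw' tp] : g t w /\ g t r1.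
    by case: (N _ x1) => E1; case: (N _ x2) => E2; subst y1 y2; rewrite ?eqxx // in y12.
  right; exists r1, t; rewrite (gs r1 r) (gs r1 t); split=> //.
  apply: near_lone_w; last exact: (gneq sat).
  by apply: (onear r1 t (far_outer fr1)) => //; rewrite gs.
Qed.

(** The two lone neighbours of [w] on [h] give two units, which outweigh one deficient vertex.
    Against two of them a third unit comes from the other hub; if its carrier is already in use,
    that carrier counts double by [mixed_net_unit]. *)
Lemma deficient_sum r : deficient r -> (0 < \sum_(x | outer x) phi x)%R.
Proof.
move=> nr.
have [h [z [z' [vh nz [lz lz' hz hz' [wz wz' N]]]]]] := w_pair.
have [e E] := deficient_unit nr lz wz; have [e' E'] := deficient_unit nr lz' wz'.
have ee' := net_unit_neq nz lz lz' N vh E E'.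
have [oe oe'] := (net_unit_outer lz E, net_unit_outer lz' E').
have [pe pe'] := (proj2 E, proj2 E').
have := deficient_card; rewrite leq_eqVlt => /orP[/eqP c2|c1]; last first.
  by have := sum_ge2 net_ge0 oe oe' ee'; rewrite net_sum; alia.
suff : (2 < \sum_(x | outer x) net x)%R by rewrite net_sum c2; alia.
have e'e : e' != e by rewrite eq_sym.
have duo x y : outer x -> outer y -> x != y -> (1 < net x)%R -> (0 < net y)%R ->
    (2 < \sum_(x | outer x) net x)%R.
  by move=> ox oy xy px py; have := sum_ge2 net_ge0 ox oy xy; alia.
have tri x : outer x -> (0 < net x)%R -> e != x -> e' != x -> (2 < \sum_(x | outer x) net x)%R.
  by move=> ox px n1 n2; have := sum_ge3 net_ge0 oe oe' ox ee' n1 n2; alia.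
have [k vk hk] := other_hub vh.
case: (third_unit nr vk) => [[u [lu ku wu]]|[r1 [u [fr1 r1w r1r lu [ku r1u]]]]].
  have [f F] := deficient_unit nr lu wu; have of_ := net_unit_outer lu F.
  case: (eqVneq e f) => [D|n1].
    by subst f; apply: (duo e e') => //; apply: (mixed_net_unit lz lu vh vk hk hz ku E F).
  case: (eqVneq e' f) => [D|n2]; last by apply: (tri f) => //; case: F.
  by subst f; apply: (duo e' e) => //; apply: (mixed_net_unit lz' lu vh vk hk hz' ku E' F).
have fr : far r by case/andP: nr => /and3P[].
have ur1 : g u r1 by rewrite gs.
have U : net_unit u r1 by apply: (net_unit_attached_far lu ur1 fr1 r1w r1r fr).
have or1 := far_outer fr1.
case: (eqVneq e r1) => [D|n1].
  by subst r1; apply: (duo e e') => //; apply: (mixed_net_unit lz lu vh vk hk hz ku E U).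
case: (eqVneq e' r1) => [D|n2]; last by apply: (tri r1) => //; case: U.
by subst r1; apply: (duo e' e) => //; apply: (mixed_net_unit lz' lu vh vk hk hz' ku E' U).
Qed.

End Deg2Tau0.

Section Deg2Tau0Main.
Variables (T : finType) (g : rel T).
Hypothesis sat : K23_saturated g.
Hypothesis deg2 : forall x, 2 <= ndeg g x predT.

Lemma dense_deg2_tau0 v : ndeg g v predT = 2 -> tau2 g v = 0 -> dense g.
Proof.
move=> dv t0.
have [a [b [ab va _ vb _]]] : exists a b, [/\ a != b, g v a, predT a, g v b & predT b].
  by apply: ndeg_gt1; rewrite dv.
have N y : g v y -> y = a \/ y = b by move=> vy; apply: (@ndeg_le2 _ g v predT); rewrite ?dv.
have nab : ~~ g a b by move: t0; rewrite (tau2_2 sat dv ab va vb); case: (g a b).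
have ind h h' : g v h -> g v h' -> ~~ g h h'.
  move=> /N vh /N vh'; case: vh vh' => -> [] ->; rewrite ?(girr sat) //.
  by rewrite (gsym sat).
apply: (@dense_phi _ _ sat v); rewrite tau2_sum t0 dv.
suff : (0 < \sum_(x | outer g v x) phi g v x)%R by [].
case: (pickP (twin g v)) => [w tw|W0]; last first.
  by apply: (deg2_no_twin sat deg2 va vb ab ind) => w; rewrite W0.
case: (pickP (deficient g v w)) => [r nr|H]; first exact: (deficient_sum sat deg2 va vb ab N ind tw nr).
apply: (sum_pos_of_net sat deg2 N ind tw) => [r|]; first by rewrite H.
exact: (no_deficient_pos sat va vb ab N ind tw).
Qed.
End Deg2Tau0Main.

(** * Minimum degree three, a root with one edge in its neighbourhood *)

Section Deg3Tau2.
Variables (T : finType) (g : rel T).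
Hypothesis sat : K23_saturated g.
Local Notation d := (ndeg g).
Local Notation deg x := (ndeg g x predT).
Hypothesis deg3 : forall x, 3 <= deg x.
Hypothesis tau_pos : forall x, deg x = 3 -> 2 <= tau2 g x.
Variables v a b c : T.
Hypotheses (va : g v a) (vb : g v b) (vc : g v c).
Hypotheses (gab : g a b) (gac : ~~ g a c) (gbc : ~~ g b c).
Hypothesis Nv : forall y, g v y -> [\/ y = a, y = b | y = c].
Let gs := gsym sat.
Local Notation outer := (outer g v).
Local Notation lone := (lone g v).
Local Notation twin := (twin g v).
Local Notation far := (far g v).
Local Notation near := (near g v).

Lemma hub_edge h k : g v h -> g v k -> g h k -> h = a /\ k = b \/ h = b /\ k = a.
Proof.
move=> vh vk; case: (Nv vh) => ->; case: (Nv vk) => ->; rewrite ?(girr sat) //; auto.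
- by rewrite (negbTE gac).
- by rewrite (negbTE gbc).
- by rewrite gs (negbTE gac).
- by rewrite gs (negbTE gbc).
Qed.

Lemma hub_edge_uniq h k k' : g v h -> g v k -> g v k' -> g h k -> g h k' -> k = k'.
Proof.
move=> vh vk vk' hk hk'; have nab : a != b by apply: (gneq sat).
case: (hub_edge vh vk hk) => -[E1 E2]; case: (hub_edge vh vk' hk') => -[E3 E4]; subst k k' => //;
by move: nab; rewrite -E1 -E3 eqxx.
Qed.

Lemma c_hub h : g v h -> g c h = false.
Proof.
move=> vh; rewrite gs; apply/negP => hc; case: (hub_edge vh vc hc) => -[_ E].
- by move: gac; rewrite E gab.
- by move: gbc; rewrite E gs gab.
Qed.

Let common_hubs_twin := sparse_common_twin sat hub_edge_uniq.
Let link := sparse_link sat hub_edge_uniq.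

Definition far3 : pred T := fun z => far z && (deg z == 3).
(** Half units for each far neighbour of degree three. A lone vertex of degree three owns nothing
    and can only pass on what a twin gives it. *)
Definition rate x : nat := if 3 < deg x then 1 else if 0 < d x twin then 2 else 0.
Definition pay_far3 (x y : T) : nat := g x y *
  (if twin x then 2 * (lone y || far y) else (lone x && far3 y) * rate x).
(* Charges are doubled so that all payments are integral. *)
Definition surplus (x : T) : int := (2 * charge g v x + (\sum_(y | outer y) pay_far3 y x)%N%:Z -
  (\sum_(y | outer y) pay_far3 x y)%N%:Z)%R.

Lemma surplus_sum : (\sum_(x | outer x) surplus x = 2 * \sum_(x | outer x) charge g v x)%R.
Proof. by rewrite /surplus -sum_transfer mulr_sumr. Qed.

Lemma received_far3 x : \sum_(y | outer y) pay_far3 y x =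
  2 * (lone x || far x) * d x twin + far3 x * \sum_(y | g x y && lone y) rate y.
Proof.
rewrite [X in _ + _ * X]big_mkcond [LHS]big_mkcond ndegE !big_distrr -big_split /=; apply: eq_bigr => y _.
rewrite /pay_far3 gs; case oy: (outer y); last by rewrite /lone /twin oy !andbF !muln0.
case ty: (twin y).
  have -> : lone y = false by apply/negP => l; apply: lone_twin l ty.
  by case: (g x y); rewrite ?mul1n ?mul0n /= ?muln0 ?muln1 ?addn0.
by case: (g x y); case: (lone y); case: (far3 x); rewrite /= ?muln0 ?mul1n ?mul0n.
Qed.

Lemma paid_far3 x : \sum_(y | outer y) pay_far3 x y =
  if twin x then 2 * (d x lone + d x far) else lone x * rate x * d x far3.
Proof.
case tx: (twin x); rewrite /pay_far3 tx.
  rewrite -ndegU; last by move=> y _ /lone_farF ->.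
  rewrite ndegE big_distrr big_mkcond /=; apply: eq_bigr => y _.
  case oy: (outer y); last by rewrite /lone /far oy andbF muln0.
  by case: (g x y); rewrite ?mul1n ?mul0n.
rewrite ndegE big_distrr big_mkcond /=; apply: eq_bigr => y _.
case oy: (outer y); last by rewrite /far3 /far oy andbF muln0.
by case: (g x y); case: (lone x); case: (far3 y); rewrite ?mul1n ?mul0n ?muln1 ?muln0.
Qed.

Lemma far3_le x : d x far3 <= d x far.
Proof. by apply: ndeg_le => y _ /andP[]. Qed.

Lemma surplus_twin x : twin x -> (surplus x = (2 * d x twin)%:Z)%R.
Proof.
move=> t; rewrite /surplus received_far3 paid_far3 t /charge.
have -> : lone x = false by apply/negP => l; apply: lone_twin l t.
have -> : far x = false by apply/negP => l; apply: twin_far t l.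
have -> : far3 x = false by rewrite /far3 (twin_farF t).
rewrite (deg_split sat (twin_outer t)); case/andP: t => _ /eqP ->; alia.
Qed.

Lemma surplus_lone x : lone x ->
  (surplus x = 2 * (deg x)%:Z - 6 + (2 * d x twin)%:Z - (rate x * d x far3)%:Z)%R.
Proof.
move=> l; rewrite /surplus received_far3 paid_far3 l (lone_twinF l) /charge.
have -> : far3 x = false by rewrite /far3 (lone_farF l).
case/andP: l => _ /eqP ->; alia.
Qed.

Lemma surplus_far x : far x -> (surplus x = 2 * (deg x)%:Z - 8 + (2 * d x twin)%:Z +
   (far3 x * \sum_(y | g x y && lone y) rate y)%N%:Z)%R.
Proof.
move=> f; rewrite /surplus received_far3 paid_far3 f orbT /charge.
have -> : lone x = false by apply/negP => l; apply: lone_far l f.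
have -> : twin x = false by apply/negP => l; apply: twin_far l f.
case/andP: f => _ /eqP ->; alia.
Qed.

(** One neighbour is a hub and at least one is near, so at most [deg - 2] are far: affordable at one
    each from degree four on. At degree three a single far neighbour remains next to a twin. *)
Lemma surplus_lone_ge0 x : lone x -> (0 <= surplus x)%R.
Proof.
move=> l; rewrite surplus_lone // /rate; have := deg3 x; have := far3_le x.
have := deg_lone sat l; have := sparse_near sat hub_edge_uniq (lone_outer l); have := d_near sat v x.
by case: (ltnP 3 (deg x)) => H; [|case: (posnP (d x twin)) => t0]; alia.
Qed.

Lemma rate_sum_ge2 p q z : g z p -> lone p -> g z q -> lone q -> p != q ->
  rate p + rate q <= \sum_(y | g z y && lone y) rate y.
Proof.
move=> zp lp zq lq n; rewrite (bigD1 p) ?zp //= (bigD1 q) /= ?zq ?lq 1?eq_sym //.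
by rewrite addnA leq_addr.
Qed.

Lemma rate_sum_ge1 p z : g z p -> lone p -> rate p <= \sum_(y | g z y && lone y) rate y.
Proof. by move=> zp lp; rewrite (bigD1 p) ?zp //= leq_addr. Qed.

(** Rate zero means degree three and no twin neighbour. The link of [p] with the root then runs
    through a hub [h'] adjacent to [h], with [h] and [y] as shared vertices. Neither [z] nor [y] is
    on [h], so the edge that [tau_pos] promises around [p] is [z y]. *)
Lemma rate0_nbrs z p h : far3 z -> d z twin = 0 -> lone p -> g z p -> g v h -> g h p -> rate p = 0 ->
  exists h' y, [/\ g v h', g h h', lone y, g h' y & [/\ g p y, g z y, deg p = 3 &
    forall t, g p t -> [\/ t = h, t = z | t = y]]].
Proof.
move=> /andP[fz /eqP dz] t0 lp zp vh hp r0.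
have [dp tp] : deg p = 3 /\ d p twin = 0.
  move: r0; rewrite /rate; have := deg3 p; case: (ltnP 3 (deg p)) => // H1 H2.
  by case: (posnP (d p twin)) => // -> _; split=> //; alia.
have hz : g h z = false by apply: (far_hub sat fz vh).
have nhz : h != z by apply/eqP => E; subst h; rewrite (outer_v' (far_outer fz)) in vh.
have [y [py yh yz N]] := nbr3 dp nhz (etrans (gs p h) hp) (etrans (gs p z) zp).
have notw t : g p t -> twin t -> False by move=> pt tt; have := ndeg0 tp pt; rewrite tt.
case: (link (lone_outer lp)) => [[h' [y1 [y2 [vh' n [n1 h1 h2 x1 x2]]]]]|[t [pt tt]]]; last by case: (notw t).
have y1E : y1 = y.
  case: (N _ x1) => // E; subst y1.
    by have := outer_v' (near_outer n1); rewrite vh.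
  by rewrite (far_nearF fz) in n1.
subst y1.
have y2E : y2 = h.
  case: (N _ x2) => // E; subst y2; first by rewrite (far_hub sat fz vh') in h2.
  by rewrite eqxx in n.
subst y2; have ly : lone y.
  by move: n1; rewrite (near_split sat) => /orP[//|ty]; case: (notw y).
exists h', y; split=> //; first by rewrite gs.
split=> //; have hy : ~~ g h y.
  apply/negP => hy; have E := lone_hub sat ly vh' vh h1 hy; subst h'.
  by rewrite (girr sat) in h2.
have [A B C] : [/\ g p h, g p z & g p y] by split; rewrite // gs.
have := tau2_ge2 sat dp (tau_pos dp) nhz (_ : h != y) (_ : z != y) A B C.
by rewrite hz (negbTE hy) !(eq_sym _ y) /= => ->.
Qed.

(* The only vertices with negative final charge. *)
Definition special_at z h h' p y q := [/\ [/\ g v h, g v h' & g h h'], [/\ lone p, lone y, lone q & g h q],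
  [/\ p != y, p != q & y != q], [/\ g h p, g h' y, deg p = 3 & deg y = 3] &
  [/\ forall t, g p t -> [\/ t = h, t = z | t = y], forall t, g y t -> [\/ t = h', t = z | t = p],
      forall t, g z t -> [\/ t = p, t = y | t = q] & [/\ g z p, g z y, g z q & g p y]]].

Lemma far3_cases z : far3 z -> d z twin = 0 ->
  2 <= \sum_(y | g z y && lone y) rate y \/
  1 <= \sum_(y | g z y && lone y) rate y /\ exists h h' p y q, special_at z h h' p y q.
Proof.
move=> f3 t0; case/andP: (f3) => fz /eqP dz.
have [h [p [q [vh n [lp lq hp hq [zp zq]]]]]] := sparse_far sat hub_edge_uniq fz t0.
have main r s : lone r -> lone s -> g h r -> g h s -> g z r -> g z s -> r != s -> rate r = 0 ->
    2 <= \sum_(y | g z y && lone y) rate y \/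
    1 <= \sum_(y | g z y && lone y) rate y /\ exists h h' p y q, special_at z h h' p y q.
  move=> lr ls hr hs zr zs rs r0.
  have [h' [y [vh' hh' ly h'y [ry zy dr Nr]]]] := rate0_nbrs f3 t0 lr zr vh hr r0.
  have hy : ~~ g h y.
    apply/negP => hy; have E := lone_hub sat ly vh' vh h'y hy; subst h'.
    by rewrite (girr sat) in hh'.
  have ry' : r != y by apply: (gneq sat).
  have [o [zo or os Nz]] := nbr3 dz rs zr zs.
  have E : y = o by case: (Nz _ zy) => E //; subst y; rewrite ?hr ?hs in hy.
  subst o; have sy : s != y by rewrite eq_sym.
  (* If [s] had rate zero as well, it would also be adjacent to [y], and [r], [s] would share [h],
     [z] and [y]. *)
  have s1 : 0 < rate s.
    rewrite lt0n; apply/negP => /eqP s0.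
    have [k [u [vk hk lu ku [su zu ds Ns]]]] := rate0_nbrs f3 t0 ls zs vh hs s0.
    have uy : u = y.
      case: (Nz _ zu) => E //; subst u.
        by have E := lone_hub sat lr vh vk hr ku; subst k; rewrite (girr sat) in hk.
      by rewrite (girr sat) in su.
    subst u; apply: (@K23_free _ _ sat r s h z y) => //; rewrite 1?(gs _ h) 1?(gs _ z) //.
    - by apply/eqP => E; subst h; rewrite (outer_v' (far_outer fz)) in vh.
    - by apply/eqP => E; subst h; rewrite (outer_v' (lone_outer ly)) in vh.
    - exact: (gneq sat).
  have := rate_sum_ge2 zs ls zy ly sy; case: (posnP (rate y)) => [y0 le|]; last by left; alia.
  right; split; first by alia.
  have [k [u [vk hk lu ku [su zu dy Ny]]]] := rate0_nbrs f3 t0 ly zy vh' h'y y0.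
  have kh : k = h by apply: (hub_edge_uniq vh' vk vh); rewrite // gs.
  subst k.
  have ur : u = r.
    by case: (Ny r); rewrite ?(gs y) // => E; subst; rewrite ?(lone_farF lr) // in fz;
       have := outer_v' (lone_outer lr); rewrite vh'.
  have Nz' t : g z t -> [\/ t = r, t = y | t = s].
    by case/Nz=> ->; [constructor 1|constructor 3|constructor 2].
  by subst u; exists h, h', r, y, s; split; split.
case: (posnP (rate p)) => [p0|p1]; first exact: (main p q).
case: (posnP (rate q)) => [q0|q1]; first by apply: (main q p); rewrite // eq_sym.
by left; have := rate_sum_ge2 zp lp zq lq n; alia.
Qed.

(** Saturation for [p] and [h']. With all neighbours of [p], [y] and [z] known, the only possible
    link uses a common neighbour of [h] and [h'] besides the root. *)
Lemma special_twin z h h' p y q : special_at z h h' p y q ->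
  (exists w, [/\ twin w, g h w & g h' w]).
Proof.
case=> -[vh vh' hh'] [lp ly lq hq] [py pq yq] [hp h'y dp dy] [Np Ny Nz [zp zy zq py']].
have nhh' : h != h' by apply: (gneq sat).
have uniqh x : lone x -> g h x -> g h' x -> False.
  by move=> lx hx hx'; case/eqP: nhh'; apply: (lone_hub sat lx).
have ph' : ~~ g p h' by rewrite gs; apply/negP => E; apply: (uniqh p).
have nph' : p != h' by apply/eqP => E; subst p; have := outer_v' (lone_outer lp); rewrite vh'.
have zh' : g z h' = false.
  apply/negP => E; case: (Nz _ E) => E'; subst h'.
  - by rewrite eqxx in nph'.
  - by rewrite (girr sat) in h'y.
  - by have := outer_v' (lone_outer lq); rewrite vh'.
have zh : g z h = false.
  apply/negP => E; case: (Nz _ E) => E'; subst h.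
  - by rewrite (girr sat) in hp.
  - by have := outer_v' (lone_outer ly); rewrite vh.
  - by rewrite (girr sat) in hq.
case: (nonadj_linked sat nph' ph') => -[t [y1 [y2 [[yt tx y12] [t1 t2 x1 x2]]]]].
- case: (Np _ yt) => E; subst t.
  + case: (eqVneq y1 v) => [E|n].
      exists y2; split=> //; apply: (common_hubs_twin nhh' vh vh') => //.
      by rewrite -E eq_sym.
    by exists y1; split=> //; apply: (common_hubs_twin nhh' vh vh').
  + have Z s : g z s -> g h' s -> s = y.
      move=> zs hs; case: (Nz _ zs) => E //; subst s; first by case: (uniqh p).
      by case: (uniqh q).
    by case/eqP: y12; rewrite (Z _ t1 x1) (Z _ t2 x2).
  + have Z s : g y s -> g h' s -> False.
      move=> zs hs; case: (Ny _ zs) => E; subst s; first by rewrite (girr sat) in hs.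
        by rewrite gs zh' in hs.
      by case: (uniqh p).
    by case: (Z _ t1).
- have hy : g h y = false by apply/negP => E; apply: (uniqh y).
  have th : g t h -> t != v -> twin t.
    by move=> th; apply: (common_hubs_twin nhh' vh vh'); rewrite // gs.
  have ty : g t y -> False.
    move=> ty; rewrite gs in ty; case: (Ny _ ty) => E; subst t.
    - by rewrite (girr sat) in yt.
    - by rewrite gs zh' in yt.
    - by rewrite eqxx in tx.
  have [th' tz] : g t h /\ g t z.
    by case: (Np _ x1) => E1; case: (Np _ x2) => E2; subst y1 y2; rewrite ?eqxx // in y12;
      try case: (ty t1); try case: (ty t2).
  case: (eqVneq t v) => [E|n]; last first.
    by exists t; split=> //; [apply: th | rewrite gs].
  subst t; have E : g z v by rewrite gs.
  by case: (Nz _ E) => F; [have := lone_outer lp|have := lone_outer ly|have := lone_outer lq];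
    rewrite -F /outer eqxx.
Qed.

Definition special z := exists h h' p y q, special_at z h h' p y q.

Lemma surplus_ge0 x : outer x -> (0 <= surplus x)%R \/ far3 x /\ (surplus x = -1)%R /\ special x.
Proof.
move=> o; case: (outer_cases sat o) => c0; first by left; apply: surplus_lone_ge0.
  by left; rewrite surplus_twin.
rewrite surplus_far //; case: (ltnP 3 (deg x)) => dx; first by left; alia.
have f3 : far3 x by rewrite /far3 c0 eqn_leq dx deg3.
rewrite f3 mul1n; have := deg3 x => dx'.
case: (posnP (d x twin)) => t0; last by left; alia.
case: (far3_cases f3 t0) => [le|[le [h [h' [p [y [q S]]]]]]]; first by left; alia.
case: (ltnP 1 (\sum_(y0 | g x y0 && lone y0) rate y0)) => le2; first by left; alia.
right; split=> //; split; first by alia.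
by exists h, h', p, y, q.
Qed.

(* Two specials would have nonadjacent, unlinked vertices [p] and [p'] on the same hub. *)
Lemma special_core_uniq z z' h h' p p' y y' q q' :
  far z -> far z' -> g v h -> g v h' -> g h h' -> lone p -> lone y -> lone p' -> lone y' ->
  g h p -> g h p' -> g h' y -> g h' y' ->
  (forall t, g p t -> [\/ t = h, t = z | t = y]) ->
  (forall t, g y t -> [\/ t = h', t = z | t = p]) ->
  (forall t, g z t -> [\/ t = p, t = y | t = q]) ->
  (forall t, g p' t -> [\/ t = h, t = z' | t = y']) ->
  (forall t, g y' t -> [\/ t = h', t = z' | t = p']) ->
  (forall t, g z' t -> [\/ t = p', t = y' | t = q']) ->
  g p z -> g p' z' -> g y z -> g y' z' -> z = z'.
Proof.
move=> fz fz' vh vh' hh' lp ly lp' ly' hp hp' hy hy' Np Ny Nz Np' Ny' Nz' pz pz' yz yz'.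
apply/eqP/negPn/negP => zz'.
have nh : h != h' by apply: (gneq sat).
have LF x t : lone x -> far t -> x <> t by move=> A B E; subst x; apply: lone_far A B.
have LH x t : lone x -> g v t -> x <> t.
  by move=> A B E; subst x; have := outer_v' (lone_outer A); rewrite B.
have FH x t : far x -> g v t -> x <> t.
  by move=> A B E; subst x; have := outer_v' (far_outer A); rewrite B.
have CC x t : lone x -> g h x -> g h' t -> x <> t.
  by move=> A B C E; subst t; case/eqP: nh; apply: (lone_hub sat A).
have pp' : p != p'.
  apply/eqP => E; subst p'; case: (Np _ pz') => E.
  - by case: (FH _ _ fz' vh).
  - by rewrite E eqxx in zz'.
  - by case: (LF y z').
have yy' : y != y'.
  apply/eqP => E; subst y'; case: (Ny _ yz') => E.
  - by case: (FH _ _ fz' vh').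
  - by rewrite E eqxx in zz'.
  - by case: (LF p z').
have half z1 z2 p1 p2 y1 y2 q1 t u u' : far z1 -> far z2 -> lone p1 -> lone y1 -> lone p2 -> lone y2 ->
   g h p1 -> g h p2 -> g h' y1 -> g h' y2 -> z1 != z2 -> y1 != y2 -> p1 != p2 ->
  (forall t, g p1 t -> [\/ t = h, t = z1 | t = y1]) ->
  (forall t, g y1 t -> [\/ t = h', t = z1 | t = p1]) ->
  (forall t, g z1 t -> [\/ t = p1, t = y1 | t = q1]) ->
  (forall t, g p2 t -> [\/ t = h, t = z2 | t = y2]) ->
  g p1 t -> u != u' -> g t u -> g t u' -> g p2 u -> g p2 u' -> False.
  move=> fz1 fz2 lp1 ly1 lp2 ly2 hp1 hp2 hy1 hy2 z12 y12 p12 Np1 Ny1 Nz1 Np2 pt uu tu tu' pu pu'.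
  have Z s : g z1 s -> g p2 s -> s = q1.
    move=> zs ps; case: (Nz1 _ zs) => // E; subst s; case: (Np2 _ ps) => E.
    - by case: (LH p1 h).
    - by case: (LF p1 z2).
    - by case: (CC p1 y2).
    - by case: (LH y1 h).
    - by case: (LF y1 z2).
    - by rewrite E eqxx in y12.
  case: (Np1 _ pt) => E; subst t.
  - case: (Np2 _ pu) => E; subst u; first by rewrite (girr sat) in tu.
      by rewrite (far_hub sat fz2 vh) in tu.
    by case: (CC y2 y2).
  - by rewrite (Z _ tu pu) (Z _ tu' pu') eqxx in uu.
  - case: (Ny1 _ tu) => E; subst u; case: (Np2 _ pu) => E.
    + by rewrite E eqxx in nh.
    + by case: (FH z2 h').
    + by case: (LH y2 h').
    + by case: (FH z1 h).
    + by rewrite E eqxx in z12.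
    + by case: (LF y2 z1).
    + by case: (LH p1 h).
    + by case: (LF p1 z2).
    + by case: (CC p1 y2).
have npp : ~~ g p p'.
  apply/negP => E; case: (Np _ E) => E'.
  - by case: (LH p' h).
  - by case: (LF p' z).
  - by case: (CC p' y).
case: (nonadj_linked sat pp' npp) => -[t [y1 [y2 [[yt tx y12] [t1 t2 x1 x2]]]]].
- exact: (half z z' p p' y y' q t y1 y2).
- by apply: (half z' z p' p y' y q' t y1 y2); rewrite // eq_sym.
Qed.

(** Only one pair of hubs is adjacent, so two special configurations use the same hubs, possibly
    with the roles of [p] and [y] exchanged. *)
Lemma special_uniq z z' : far z -> far z' -> special z -> special z' -> z = z'.
Proof.
move=> fz fz' [h [h' [p [y [q [[vh vh' hh'] [lp ly lq hq] [py pq yq] [hp hy dp dy] [Np Ny Nz [zp zy zq _]]]]]]]].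
move=> [k [k' [p' [y' [q' [[vk vk' kk'] [lp' ly' lq' hq'] [py' pq' yq'] [hp' hy' dp' dy'] [Np' Ny' Nz' [zp' zy' zq' _]]]]]]]].
have [C|C] : h = k /\ h' = k' \/ h = k' /\ h' = k.
  by case: (hub_edge vh vh' hh') => -[-> ->]; case: (hub_edge vk vk' kk') => -[-> ->]; auto.
- case: C => ? ?; subst k k'.
  by apply: (@special_core_uniq z z' h h' p p' y y' q q'); rewrite // gs.
- case: C => ? ?; subst k k'.
  apply: (@special_core_uniq z z' h h' p y' y p' q q'); rewrite // 1?gs // => t /Nz' [] ->;
    by [constructor 1|constructor 2|constructor 3].
Qed.

Lemma surplus_sum_pos x : outer x -> (forall z, far3 z -> special z -> (0 <= surplus z)%R) -> (0 < surplus x)%R ->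
  (0 < \sum_(x | outer x) surplus x)%R.
Proof.
move=> ox H px; apply: Order.POrderTheory.lt_le_trans px _.
apply: (sum_ge1 _ ox) => y oy; case: (surplus_ge0 oy) => // -[f3 [_ sy]]; exact: H.
Qed.

Lemma surplus_ge0_off z x : far z -> special z -> outer x -> x != z -> (0 <= surplus x)%R.
Proof.
move=> fz sz ox xz; case: (surplus_ge0 ox) => // -[/andP[fx _] [_ sx]].
by rewrite (special_uniq fx fz sx sz) eqxx in xz.
Qed.

Lemma surplus_ge x : outer x -> (-1 <= surplus x)%R.
Proof. by move/surplus_ge0 => [|[_ [-> _]]] //; alia. Qed.

(** The unique special vertex lacks one half unit, which is outweighed by a surplus of two elsewhere
    or, in the next lemma, by positive surplus in two places. *)
Lemma surplus_sum_pos1 z x : far z -> special z -> outer x -> x != z -> (1 < surplus x)%R ->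
  (0 < \sum_(x | outer x) surplus x)%R.
Proof.
move=> fz sz ox xz px; rewrite (sum_split _ (far_outer fz)).
have P y : outer y && (y != z) -> (0 <= surplus y)%R by case/andP; apply: surplus_ge0_off.
have := @sum_ge1 _ (fun y => outer y && (y != z)) surplus x P; rewrite ox xz => /(_ isT).
by have := surplus_ge (far_outer fz); alia.
Qed.

Lemma surplus_sum_pos2 z x y : far z -> special z -> outer x -> x != z -> outer y -> y != z -> x != y ->
  (0 < surplus x)%R -> (0 < surplus y)%R -> (0 < \sum_(x | outer x) surplus x)%R.
Proof.
move=> fz sz ox xz oy yz xy px py; rewrite (sum_split _ (far_outer fz)).
have P t : outer t && (t != z) -> (0 <= surplus t)%R by case/andP; apply: surplus_ge0_off.
have := @sum_ge2 _ (fun y => outer y && (y != z)) surplus x y P; rewrite ox xz oy yz => /(_ isT isT xy).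
by have := surplus_ge (far_outer fz); alia.
Qed.


(** The two half units that [y] gets from the twin stay with it unless it has degree three and hands
    them to a far [z] of degree three. They cover the need of [z], so it suffices that [z] has a
    twin or a second paying neighbour. *)
Lemma twin_lone_surplus y w : lone y -> twin w -> g y w ->
  (1 < surplus y)%R \/ exists h z, [/\ g v h, far z, (0 < surplus z)%R &
    [/\ g y z, g y h & forall t, g y t -> [\/ t = h, t = w | t = z]]].
Proof.
move=> ly tw yw; have := surplus_lone ly.
have t1 : 0 < d y twin by apply: ndeg_ge1 yw tw.
have := deg_lone sat ly; have := deg3 y; have := d_near sat v y; have := far3_le y.
rewrite /rate t1; case: (ltnP 3 (deg y)) => dy F A B C E; first by left; alia.
case: (posnP (d y far3)) => [F0|F1]; first by left; alia.
have dy3 : deg y = 3 by alia.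
have [z [yz f3]] := ndeg_gt0 F1; have fz : far z by case/andP: f3.
have [h vh hy] := near_hub sat (lone_near sat ly).
have wz : w != z by apply/eqP => D; subst z; apply: twin_far tw fz.
have yh : g y h by rewrite gs.
have hw : h != w by apply: contraTneq vh => ->; rewrite (outer_v' (twin_outer tw)).
have hz : h != z by apply: contraTneq vh => ->; rewrite (outer_v' (far_outer fz)).
have N t : g y t -> [\/ t = h, t = w | t = z].
  by move=> yt; apply: (@ndeg_le3 _ g y predT h w z); rewrite ?dy3.
right; exists h, z; split=> //; rewrite surplus_far // f3 mul1n.
have zy : g z y by rewrite gs.
have dz : deg z = 3 by case/andP: f3 => _ /eqP.
have ry : rate y = 2 by rewrite /rate dy3 /= t1.
have := rate_sum_ge1 zy ly; rewrite ry dz => S2.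
case: (posnP (d z twin)) => z0; last by alia.
suff : 2 < \sum_(y | g z y && lone y) rate y by alia.
have more x : lone x -> g z x -> x != y -> 0 < rate x -> 2 < \sum_(y | g z y && lone y) rate y.
  by move=> lx zx xy rx; have := rate_sum_ge2 zx lx zy ly xy; rewrite ry; alia.
have [k [p [q [vk pq [lp lq kp kq [zp zq]]]]]] := sparse_far sat hub_edge_uniq fz z0.
have sol p' q' : lone p' -> lone q' -> g k p' -> g k q' -> g z p' -> g z q' -> p' != q' -> q' != y ->
    2 < \sum_(y | g z y && lone y) rate y.
  move: p q p' q' {pq lp lq kp kq zp zq} => _ _ p q lp lq kp kq zp zq pq qy.
  case: (posnP (rate q)) => [q0|]; last exact: more.
  have [k' [o [vk' kk' lo ko [qo zo dq Nq]]]] := rate0_nbrs f3 z0 lq zq vk kq q0.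
  have nkk : k != k' by apply: (gneq sat).
  have op : o != p by apply/eqP => D; subst o; case/eqP: nkk; apply: (lone_hub sat lo).
  have oq : o != q by apply/eqP => D; subst o; case/eqP: nkk; apply: (lone_hub sat lo).
  have [o' [zo' o'p o'q Nz]] := nbr3 dz pq zp zq.
  have oE : o = o' by case: (Nz _ zo) => // D; rewrite D eqxx in op oq.
  subst o'.
  have wnq : ~~ g q w.
    apply/negP => D; case: (Nq _ D) => D'.
    - by move: (outer_v' (twin_outer tw)); rewrite D' vk.
    - by rewrite D' eqxx in wz.
    - by subst o; apply: lone_twin lo tw.
  case: (eqVneq o y) => [D|oy'].
    subst o; case: (N q); first by rewrite gs.
    - by move=> D; move: (outer_v' (lone_outer lq)); rewrite D vh.
    - by move=> D; subst q; case: (lone_twin lq tw).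
    - by move=> D; subst q; case: (lone_far lq fz).
  have yp : p = y by case: (Nz _ zy) => // D; subst; rewrite ?eqxx // in qy oy'.
  subst p; have kh : k = h by apply: (lone_hub sat ly).
  subst k; case: (posnP (rate o)) => [o0|]; last exact: more.
  have [k'' [u [vu ku lu kuu [ou zu do_ No]]]] := rate0_nbrs f3 z0 lo zo vk' ko o0.
  have kE : k'' = h by apply: (hub_edge_uniq vk'); rewrite // gs.
  subst k''; have uq : u = q.
    case: (No q); rewrite 1?gs // => D; subst.
    - by move: (outer_v' (lone_outer lq)); rewrite vk'.
    - by case: (lone_far lq fz).
  subst u.
  have HF t : far t -> g h t = false by move=> ft; apply: (far_hub sat ft vh).
  have LH x : lone x -> x <> h by move=> A' D; subst x; have := outer_v' (lone_outer A'); rewrite vh.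
  have ho : ~~ g h o.
    by apply/negP => D; case/eqP: nkk; apply: (lone_hub sat lo).
  have zw : g z w = false by apply/negP => D; have := ndeg0 z0 D; rewrite tw.
  have ow : g o w = false.
    apply/negP => D; case: (No _ D) => D'; subst.
    - by move: (outer_v' (twin_outer tw)); rewrite vk'.
    - by rewrite eqxx in wz.
    - by case: (lone_twin lq tw).
  have nyq : ~~ g y q.
    apply/negP => D; case: (N _ D) => D'; first by case: (LH q).
      by subst q; case: (lone_twin lq tw).
    by subst q; case: (lone_far lq fz).
  have yq : y != q by [].
  have hz0 : g h z = false by apply: HF.
  have zh : g z h = false by rewrite gs.
  have oh : g o h = false by rewrite gs; apply/negbTE.
  (* With [q] and [o] both of rate zero all neighbourhoods around [z] are known, and the nonadjacent
     vertices [y] and [q] turn out to be unlinked. *)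
  case: (nonadj_linked sat yq nyq) => -[t [y1 [y2 [[yt tx y12] [t1' t2 x1 x2]]]]].
  - case: (N _ yt) => D; subst t; case: (Nq _ x1) => D1; case: (Nq _ x2) => D2; subst y1 y2;
      move: y12 t1' t2; rewrite ?eqxx ?(girr sat) ?hz0 ?(negbTE ho) ?(gs w z) ?zw ?(gs w o) ?ow ?zh //.
  - case: (Nq _ yt) => D; subst t; case: (N _ x1) => D1; case: (N _ x2) => D2; subst y1 y2;
      by move: y12 t1' t2; rewrite ?eqxx ?(girr sat) ?hz0 ?zw ?ow ?zh ?oh.
case: (eqVneq q y) => [D|qy]; last exact: (sol p q).
by apply: (sol q p); rewrite // -?D // eq_sym.
Qed.


(** Adjacent twins keep two half units each. Otherwise a lone neighbour of a twin leads to positive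
    surplus by [twin_lone_surplus]; against a special vertex, more is gained from the twin on the
    two hubs of that vertex. *)
Lemma surplus_twin_sum w : twin w -> (0 < \sum_(x | outer x) surplus x)%R.
Proof.
move=> tw; have ow := twin_outer tw.
have Tne x y : twin x -> far y -> x != y.
  by move=> A B; apply/eqP => E; subst x; apply: twin_far A B.
have Lne x y : lone x -> far y -> x != y.
  by move=> A B; apply/eqP => E; subst x; apply: lone_far A B.
case: (pickP [pred x | twin x && (0 < d x twin)]) => [x /= /andP[tx t1]|TT].
  have px : (1 < surplus x)%R by rewrite surplus_twin //; alia.
  case: (pickP [pred z | far3 z && (surplus z < 0)%R]) => [z /= /andP[f3 nz]|H].
    case: (surplus_ge0 (far_outer (proj1 (andP f3)))) => [|[_ [_ sz]]]; first by alia.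
    have fz : far z by case/andP: f3.
    by apply: (surplus_sum_pos1 fz sz (twin_outer tx)) => //; apply: Tne.
  apply: (surplus_sum_pos (twin_outer tx)); last by alia.
  by move=> z f3 _; have := H z; rewrite /= f3 /= => F; rewrite Order.TotalTheory.leNgt F.
have nott x y : twin x -> twin y -> g x y = false.
  move=> tx ty; apply/negP => xy; have := TT x; rewrite /= tx /=.
  by rewrite (@ndeg_ge1 _ g x twin y).
have nlone x y : twin x -> near y -> g x y -> lone y.
  by move=> tx; rewrite (near_split sat) => /orP[//|ty]; rewrite nott.
have lk x : twin x -> exists h y1 y2,
    [/\ g v h, y1 != y2 & [/\ lone y1, g h y1, g h y2, g x y1 & g x y2]].
  move=> tx; case: (link (twin_outer tx)) => [[h [y1 [y2 [vh n [n1 h1 h2 x1 x2]]]]]|[t [xt tt]]].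
    by exists h, y1, y2; split=> //; split=> //; apply: (nlone x).
  by rewrite (nott _ _ tx tt) in xt.
case: (pickP [pred z | far3 z && (surplus z < 0)%R]) => [z /= /andP[f3 nz]|H]; last first.
  have S z : far3 z -> special z -> (0 <= surplus z)%R.
    by move=> f3 _; have := H z; rewrite /= f3 /= => F; rewrite Order.TotalTheory.leNgt F.
  have [h [y [_ [_ _ [ly _ _ wy _]]]]] := lk w tw.
  case: (twin_lone_surplus ly tw); first by rewrite gs.
    by move=> py; apply: (surplus_sum_pos (lone_outer ly)) => //; alia.
  by case=> _ [z [_ fz pz _]]; apply: (surplus_sum_pos (far_outer fz)).
case: (surplus_ge0 (far_outer (proj1 (andP f3)))) => [|[_ [_ sz]]]; first by alia.
have fz : far z by case/andP: f3.
have [h [h' [p [y [q S]]]]] := sz.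
have [w' [tw' hw hw']] := special_twin S.
case: S => -[vh vh' hh'] [lp ly lq hq] [py pq yq] [hp hy dp dy] [Np Ny Nz [zp zy zq _]].
have {Nz} Nz t : g z t -> lone t by case/Nz=> ->.
have {lk tw ow} [k [y1 [y2 [vk y12 [ly1 ky1 ky2 wy1 wy2]]]]] := lk w' tw'.
move: w w' tw' hw hw' wy1 wy2 => _ w tw hw hw' wy1 wy2.
have one u : lone u -> g w u -> (1 < surplus u)%R -> (0 < \sum_(x | outer x) surplus x)%R.
  by move=> lu wu; apply: (surplus_sum_pos1 fz sz (lone_outer lu)); apply: Lne.
have zpos u : (0 < surplus u)%R -> u != z by move=> pu; apply/eqP => E; subst u; alia.
have LH x t : lone x -> g v t -> x <> t.
  by move=> A B E; subst x; have := outer_v' (lone_outer A); rewrite B.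
have WH t : g v t -> w <> t.
  by move=> B E; subst t; have := outer_v' (twin_outer tw); rewrite B.
have zw : g z w = false by apply/negP => /Nz lw; apply: lone_twin lw tw.
(* A lone neighbour [u] of [w] on one of the two special hubs has a surplus of two, since otherwise
   [u] and the special lone vertex [P] on that hub would be nonadjacent and unlinked. *)
have same P Q k' u : lone P -> lone Q -> g v k -> g v k' -> g k k' -> g k P -> g k' Q ->
    (forall t, g P t -> [\/ t = k, t = z | t = Q]) -> (forall t, g Q t -> [\/ t = k', t = z | t = P]) ->
    lone u -> g k u -> g w u -> (0 < \sum_(x | outer x) surplus x)%R.
  move=> lP lQ _ vk' kk' kP kQ NP NQ lu ku wu.
  have nkk : k != k' by apply: (gneq sat).
  have uw : g u w by rewrite gs.
  case: (twin_lone_surplus lu tw uw) => [|[l [z' [vl fz' pz' [uz' ul Nu]]]]]; first exact: one.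
  have E : l = k by apply: (lone_hub sat lu) => //; rewrite gs.
  subst l; have z'z := zpos _ pz'.
  have PW t : lone t -> w <> t by move=> A B; subst t; apply: lone_twin A tw.
  have Pw : g P w = false.
    apply/negP => D; case: (NP _ D); first exact: WH; first by move=> E; subst z; case: (twin_far tw fz).
    exact: PW.
  have Qw : g Q w = false.
    apply/negP => D; case: (NQ _ D); first exact: WH; first by move=> E; subst z; case: (twin_far tw fz).
    exact: PW.
  have uP : u != P by apply/eqP => E; subst u; rewrite Pw in uw.
  have kQ' : g k Q = false by apply/negP => D; case/eqP: nkk; apply: (lone_hub sat lQ).
  have nPu : ~~ g P u.
    apply/negP => D; case: (NP _ D) => E; first by case: (LH u k).
      by subst u; case: (lone_far lu fz).
    by subst u; rewrite kQ' in ku.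
  have kz0 : g k z = false by apply: (far_hub sat fz vk).
  have kz1 : g k z' = false by apply: (far_hub sat fz' vk).
  have zz' : g z k = false by rewrite gs.
  have z'k : g z' k = false by rewrite gs.
  have Qk : g Q k = false by rewrite gs.
  have Qz' : g Q z' = false.
    apply/negP => D; case: (NQ _ D) => E; first by have := far_hub sat fz' vk; rewrite E kk'.
      by rewrite E eqxx in z'z.
    by subst z'; case: (lone_far lP fz').
  have Pu : P != u by rewrite eq_sym.
  case: (nonadj_linked sat Pu nPu) => -[t [x1 [x2 [[yt tx x12] [t1 t2 u1 u2]]]]].
  - case: (NP _ yt) => D; subst t; case: (Nu _ u1) => D1; case: (Nu _ u2) => D2; subst x1 x2;
      by move: x12 t1 t2; rewrite ?eqxx ?(girr sat) ?kz1 ?zz' ?zw ?Qk ?Qw ?Qz'.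
  - case: (Nu _ yt) => D; subst t; case: (NP _ u1) => D1; case: (NP _ u2) => D2; subst x1 x2;
      by move: x12 t1 t2; rewrite ?eqxx ?(girr sat) ?kz0 ?kQ' ?(gs w z) ?zw ?(gs w Q) ?Qw ?z'k ?(gs z' Q) ?Qz'.
case: (eqVneq k h) => [E|kh].
  by subst k; apply: (same p y h' y1).
case: (eqVneq k h') => [E|kh'].
  by subst k; apply: (same y p h y1); rewrite // gs.
(* What remains is the third hub. The far vertices behind [y1] and [y2] are distinct, because [y1]
   and [y2] already share [c] and [w]. *)
have kc : k = c.
  by case: (hub_edge vh vh' hh') => -[E E']; subst h h'; case: (Nv vk) => // E; subst k; rewrite eqxx in kh kh'.
subst k; have ly2 : lone y2.
  apply: (nlone w) => //; apply: (nearI sat _ vc ky2).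
  by apply: (outerI sat (twin_outer tw) wy2); apply/negP => vy; rewrite (c_hub vy) in ky2.
have wy1' : g y1 w by rewrite gs.
have wy2' : g y2 w by rewrite gs.
case: (twin_lone_surplus ly1 tw wy1') => [|[l1 [z1 [vl1 fz1 pz1 [yz1 yl1 _]]]]]; first exact: one.
case: (twin_lone_surplus ly2 tw wy2') => [|[l2 [z2 [vl2 fz2 pz2 [yz2 yl2 _]]]]]; first exact: one.
have [n1 n2] := (zpos _ pz1, zpos _ pz2).
apply: (surplus_sum_pos2 fz sz (far_outer fz1) n1 (far_outer fz2) n2) => //.
apply/eqP => E; subst z2; apply: (@K23_free _ _ sat y1 y2 c w z1) => //; rewrite 1?(gs _ c) //.
- by apply/eqP => E; apply: (WH c).
- by apply: contraTneq vc => ->; rewrite (outer_v' (far_outer fz1)).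
- exact: Tne.
Qed.


Section NoTwin.
Hypothesis W0 : forall w, ~~ twin w.

Lemma no_special z : ~ special z.
Proof. by case=> h [h' [p [y [q /special_twin[w [tw _ _]]]]]]; have := W0 w; rewrite tw. Qed.

Lemma surplus_sum_pos_no_twin x : outer x -> (0 < surplus x)%R -> (0 < \sum_(x | outer x) surplus x)%R.
Proof. by move=> ox; apply: surplus_sum_pos => // z _ /no_special. Qed.

Lemma hub_uniq_no_twin h h' y : g v h -> g v h' -> g h y -> g h' y -> y != v -> h = h'.
Proof.
move=> vh vh' hy hy' yv; apply/eqP/negPn/negP => n.
by have := common_hubs_twin n vh vh' hy hy' yv; rewrite (negbTE (W0 y)).
Qed.

Lemma surplus_near2 x : lone x -> 1 < d x near -> (3 < deg x) || (d x near != 2) -> (0 < surplus x)%R.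
Proof.
move=> lx n2 C; rewrite surplus_lone // /rate (no_twin W0).
have := deg_lone sat lx; have := far3_le x; move: C.
by case: (ltnP 3 (deg x)) => D /=; alia.
Qed.

(** If nothing is positive, a lone vertex with two near neighbours sees only these and its hub. A
    link between the nonadjacent hubs [a] and [c] would have to run through such a vertex, and the
    links of its neighbours with the root or [tau_pos] rule this out. *)
Lemma surplus_no_twin_sum : (0 < \sum_(x | outer x) surplus x)%R.
Proof.
case: (pickP [pred x | outer x && (0 < surplus x)%R]) => [x /andP[ox px]|NP]; first exact: (surplus_sum_pos_no_twin ox).
have D3 x : lone x -> 1 < d x near -> deg x = 3 /\ d x near = 2.
  move=> lx n2; have := NP x; rewrite /= lone_outer //= => /negP N.
  have : ~~ ((3 < deg x) || (d x near != 2)) by apply/negP => /(surplus_near2 lx n2).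
  by rewrite negb_or negbK -leqNgt => /andP[A /eqP B]; split=> //; have := deg3 x; alia.
have Nx x h s1 s2 : lone x -> g v h -> g h x -> s1 != s2 -> g x s1 -> g x s2 -> near s1 -> near s2 ->
    deg x = 3 /\ forall t, g x t -> [\/ t = h, t = s1 | t = s2].
  move=> lx vh hx s12 xs1 xs2 n1 n2; have [dx _] := D3 _ lx (ndeg_ge2 s12 xs1 n1 xs2 n2).
  have H s : near s -> h != s by move=> ns; apply: contraTneq vh => ->; rewrite (outer_v' (near_outer ns)).
  by split=> // t xt; apply: (@ndeg_le3 _ g x predT h s1 s2); rewrite ?dx ?H // gs.
have cl x h h' : near x -> g v h -> g v h' -> g h x -> h != h' -> g h' x = false.
  move=> nx vh vh' hx n; apply/negP => hx'; case/eqP: n; apply: (hub_uniq_no_twin vh vh' hx hx').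
  by case/andP: (near_outer nx).
have ac : a != c by apply: contraNneq gbc => <-; rewrite gs.
have ca : c != a by rewrite eq_sym.
have twoC t x y1 y2 : lone t -> near y1 -> near y2 -> y1 != y2 -> g t y1 -> g t y2 -> g v x -> g x t ->
   g c y1 -> g c y2 -> x != c -> False.
  move=> lt n1 n2 y12 t1 t2 vx xt c1 c2 xc; have cx : c != x by rewrite eq_sym.
  have [_ Nt] := Nx t x y1 y2 lt vx xt y12 t1 t2 n1 n2.
  have l1 := near_lone sat W0 n1.
  case: (link (lone_outer l1)) => [[h [z1 [z2 [vh z12 [nz1 h1 h2 x1 x2]]]]]|[s [_]]]; last by rewrite (negbTE (W0 s)).
  have nz2 : near z2.
    apply: (nearI sat _ vh h2); apply: (outerI sat (lone_outer l1) x2); apply/negP => vz.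
    have E : z2 = c by apply: (lone_hub sat l1 vc vz c1); rewrite gs.
    by subst z2; rewrite gs c_hub in h2.
  have [d1 N1] := Nx y1 c z1 z2 l1 vc c1 z12 x1 x2 nz1 nz2.
  have sol s s' : near s -> near s' -> g h s -> g h s' -> s != s' -> g y1 s -> g y1 s' -> t = s -> False.
    move=> ns ns' hs hs' ss' ys ys' E; subst s.
    have hx : h = x by apply: (lone_hub sat lt).
    subst h; have cs' : g c s' = false by apply: (cl s' x c).
    have cs : g c t = false by apply: (cl t x c).
    have [A B] : c != t /\ c != s'.
      by split; apply: contraTneq vc => ->; rewrite (outer_v' (near_outer _)).
    have := tau2_ge2 sat d1 (tau_pos d1) A B ss' (etrans (gs _ _) c1) ys ys'.
    rewrite cs cs' /= => ts'; case: (Nt _ ts') => E; subst s'.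
    - by rewrite (girr sat) in hs'.
    - by rewrite (girr sat) in ys'.
    - by rewrite c2 in cs'.
  case: (N1 t); rewrite 1?gs // => E; first by have := outer_v' (lone_outer lt); rewrite E vc.
    by apply: (sol z1 z2).
  by apply: (sol z2 z1); rewrite // eq_sym.
case: (nonadj_linked sat ac gac) => -[t [y1 [y2 [[yt tx y12] [t1 t2 x1 x2]]]]].
- have hub_t k : g v k -> k != c -> t = k -> False.
    move=> vk kc E; subst t; have [e|e] : y1 != v \/ y2 != v.
      by case: (eqVneq y1 v) y12 => [->|]; [rewrite eq_sym; right|left].
    * by case/eqP: kc; apply: (hub_uniq_no_twin vk vc t1 x1 e).
    * by case/eqP: kc; apply: (hub_uniq_no_twin vk vc t2 x2 e).
  case: (hub_nbr va yt) => [E|vt|ot].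
  + by subst t; rewrite c_hub in x1.
  + by case: (hub_t t).
  + have nt := nearI sat ot va yt; have lt := near_lone sat W0 nt.
    have O y : g t y -> g c y -> near y.
      move=> ty cy; apply: (nearI sat _ vc cy); apply: (outerI sat ot ty).
      by apply/negP => vy; rewrite c_hub in cy.
    by case: (twoC t a y1 y2) => //; apply: O.
- have ov y : g a y -> ~~ g c y -> y != v by move=> _; apply: contraNneq => ->; rewrite gs.
  case: (hub_nbr vc yt) => [E|vt|ot].
  + by subst t; case/eqP: y12; apply: (hub_edge_uniq va t1 t2).
  + by rewrite c_hub in yt.
  + have nt := nearI sat ot vc yt; have lt := near_lone sat W0 nt.
    have O y : g t y -> g a y -> near y.
      move=> ty ay; apply: (nearI sat _ va ay); apply: (outerI sat ot ty).
      apply/negP => vy; have E : y = c by apply: (lone_hub sat lt vc vy yt); rewrite gs.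
      by subst y; rewrite (negbTE gac) in ay.
    have [n1 n2] := (O _ t1 x1, O _ t2 x2).
    have [dt Nt] := Nx t c y1 y2 lt vc yt y12 t1 t2 n1 n2.
    have [A B] : c != y1 /\ c != y2.
      by split; apply: contraTneq vc => ->; rewrite (outer_v' (near_outer _)).
    have [cy1 cy2] : g c y1 = false /\ g c y2 = false by split; apply: (cl _ a c).
    have := tau2_ge2 sat dt (tau_pos dt) A B y12 (etrans (gs _ _) yt) t1 t2.
    rewrite cy1 cy2 /= => yy; have l1 := near_lone sat W0 n1.
    have ty2 : t != y2 by apply: (gneq sat).
    have [d1 N1] := Nx y1 a t y2 l1 va x1 ty2 (etrans (gs _ _) t1) yy nt n2.
    have at' : g a t = false by apply: (cl _ c a).
    case: (link (lone_outer l1)) => [[h [z1 [z2 [vh z12 [nz1 h1 h2 u1 u2]]]]]|[s [_]]]; last by rewrite (negbTE (W0 s)).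
    case: (N1 _ u1) => E; subst z1.
    * by have := outer_v' (near_outer nz1); rewrite va.
    * have E : h = c by apply: (lone_hub sat lt).
      subst h; case: (N1 _ u2) => E; subst z2; rewrite ?eqxx // in z12.
        by rewrite gs (negbTE gac) in h2.
      by rewrite cy2 in h2.
    * have E : h = a by apply: (lone_hub sat (near_lone sat W0 n2)).
      subst h; case: (N1 _ u2) => E; subst z2; rewrite ?eqxx ?(girr sat) // in z12 h2.
      by rewrite at' in h2.
Qed.
End NoTwin.

End Deg3Tau2.

Section Deg3Tau2Main.
Variables (T : finType) (g : rel T).
Hypothesis sat : K23_saturated g.
Hypothesis deg3 : forall x, 3 <= ndeg g x predT.
Hypothesis tau_pos : forall x, ndeg g x predT = 3 -> 2 <= tau2 g x.

Lemma dense_tau2 v : ndeg g v predT = 3 -> tau2 g v = 2 -> dense g.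
Proof.
move=> dv tv; have gs := gsym sat.
have [a [b [ab va _ vb _]]] : exists a b, [/\ a != b, g v a, true, g v b & true].
  by apply: (@ndeg_gt1 _ g v predT); rewrite dv.
have [c [vc ca cb N]] := nbr3 dv ab va vb.
have main x y z : g v x -> g v z -> (forall t, g v t -> [\/ t = x, t = y | t = z]) ->
    g x y -> ~~ g x z -> ~~ g y z -> dense g.
  move=> vx vz Nv xy xz yz; apply: (@charge_bound _ _ sat v); rewrite tau2_sum tv dv.
  suff : (0 < \sum_(x | outer g v x) charge g v x)%R by [].
  have : (0 < \sum_(x | outer g v x) surplus g v x)%R.
    case: (pickP (twin g v)) => [w tw|W0].
      exact: (surplus_twin_sum sat deg3 tau_pos vz xy xz yz Nv tw).
    by apply: (surplus_no_twin_sum sat deg3 tau_pos vx vz xy xz yz Nv) => w; rewrite W0.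
  by rewrite surplus_sum; alia.
have := tau2_3 sat dv ab _ _ va vb vc; rewrite !(eq_sym _ c) ca cb tv => /(_ isT isT).
case E1: (g a b); case E2: (g a c); case E3: (g b c) => //= _.
- by apply: (main a b c); rewrite ?E1 ?E2 ?E3.
- apply: (main a c b); rewrite ?E1 ?E2 // 1?gs ?E3 // => t /N[];
    by [constructor 1|constructor 2|constructor 3].
- apply: (main b c a); rewrite ?E3 // 1?gs ?E1 ?E2 // => t /N[];
    by [constructor 1|constructor 2|constructor 3].
Qed.
End Deg3Tau2Main.

(** * Minimum degree two, all neighbourhoods of size two complete *)

Section Deg2Tau2.
Variables (T : finType) (g : rel T).
Hypothesis sat : K23_saturated g.
Local Notation d := (ndeg g).
Local Notation deg x := (ndeg g x predT).
Hypothesis deg2 : forall x, 2 <= deg x.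
Hypothesis tau_pos : forall x, deg x = 2 -> 2 <= tau2 g x.
Variables v a b : T.
Hypotheses (va : g v a) (vb : g v b) (gab : g a b).
Hypothesis Nv : forall y, g v y -> y = a \/ y = b.
Let gs := gsym sat.
Local Notation outer := (outer g v).
Local Notation lone := (lone g v).
Local Notation twin := (twin g v).
Local Notation far := (far g v).
Local Notation near := (near g v).
Local Notation phi := (phi g v).

Lemma deg2_triangle x y z : deg x = 2 -> g x y -> g x z -> y != z -> g y z.
Proof.
move=> dx xy xz yz; have := tau_pos dx; rewrite (tau2_2 sat dx yz xy xz).
by case: (g y z).
Qed.

Lemma two_hubs_adj h k : g v h -> g v k -> h != k -> g h k.
Proof. by move=> /Nv[] -> /Nv[] ->; rewrite ?eqxx // => _; rewrite gs. Qed.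

Lemma other_hub_uniq h k l : g v h -> g v k -> g v l -> h != k -> h != l -> k = l.
Proof. by move=> /Nv[] -> /Nv[] -> /Nv[] ->; rewrite ?eqxx. Qed.

Lemma hub_nbr_uniq h k k' : g v h -> g v k -> g v k' -> g h k -> g h k' -> k = k'.
Proof. by move=> vh vk vk' hk hk'; apply: (other_hub_uniq vh) => //; apply: (gneq sat). Qed.

Let link := sparse_link sat hub_nbr_uniq.
Let near_gt0 := sparse_near sat hub_nbr_uniq.
Let far_link := sparse_far sat hub_nbr_uniq.

(* [own x y]: [y] hangs on the same hub as [x]. *)
Definition own x : pred T := fun y => near y && [exists h, [&& g v h, g h x & g h y]].

Lemma ownI x y h : near y -> g v h -> g h x -> g h y -> own x y.
Proof. by move=> n vh hx hy; rewrite /own n; apply/existsP; exists h; rewrite vh hx hy. Qed.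

Lemma own_hub x y h : lone x -> g v h -> g h x -> own x y -> g h y.
Proof.
move=> lx vh hx /andP[_ /existsP[k /and3P[vk kx ky]]].
by rewrite -(lone_hub sat lx vh vk hx kx).
Qed.

(** The lone vertices with negative [phi], which is [-1]: they wait for two half units. *)
Definition starved : pred T := fun u => [&& lone u, d u twin == 0 & d u near == 1].

(** Having only one near neighbour, [u] needs its own hub as a shared vertex of the link with the
    root, so [x] is on the other hub. Without a far neighbour [u] would have degree two, and its
    neighbours [h] and [x] would be adjacent. *)
Lemma starvedP u : starved u -> exists h k x, [/\ g v h, g v k, k != h & [/\ g h u, lone x, g k x, g u x &
  [/\ forall y, g u y -> near y -> y = x, 0 < d u far & d u twin = 0]]].
Proof.
case/and3P=> lu /eqP t0 /eqP n1; have [h vh hu] := near_hub sat (lone_near sat lu).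
have dle : d u near <= 1 by rewrite n1.
case: (link (lone_outer lu)) => [[k [x [y2 [vk n [nx h1 h2 x1 x2]]]]]|[t [pt tt]]]; last first.
  by have := ndeg0 t0 pt; rewrite tt.
have lx := near_not_twin sat t0 x1 nx.
have U y : g u y -> near y -> y = x by move=> uy ny; apply: (ndeg_le1 dle).
have vy2 : g v y2.
  case: (outer_hub_nbr sat (lone_outer lu) vk h2 x2) => // ny; first by rewrite (U _ x2 ny) eqxx in n.
have E : y2 = h by apply: (lone_hub sat lu vh vy2 hu); rewrite gs.
subst y2; have kh : k != h by apply: (gneq sat).
exists h, k, x; split=> //; split=> //; split=> //.
rewrite lt0n; apply/negP => /eqP f0.
have du : deg u = 2 by rewrite (deg_lone sat lu) n1 f0.
have xh : h != x by rewrite eq_sym.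
have hx := deg2_triangle du x2 x1 xh.
by case/eqP: kh; apply: (lone_hub sat lx).
Qed.

Lemma starved_own u y : starved u -> g u y -> own u y = false.
Proof.
move=> nu uy; have [h [k [x [vh vk kh [hu lx kx ux [U _ _]]]]]] := starvedP nu.
apply/negP => o; have lu : lone u by case/and3P: nu.
have hy := own_hub lu vh hu o; have ny : near y by case/andP: o.
by rewrite (U _ uy ny) in hy; case/eqP: kh; apply: (lone_hub sat lx).
Qed.

(** When [r] can spare a second half unit for [u]: it has degree above three, or a near neighbour
    that takes nothing, or no two neighbours on the hub of [u], in which case two neighbours on the
    other hub forgo the bonus. *)
Definition bonus r u := [|| 3 < deg r, 0 < d r (fun y => near y && ~~ starved y) | d r (own u) <= 1].
(** Neither twins nor neighbours on the hub of [x] are starved, so those counted here increase the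
    charge of [x] without drawing on it. *)
Definition payer x := (0 < d x twin) || (1 < d x (own x)).
Definition pay_starved (x y : T) : nat := (g x y && starved y) *
  (if far x then 1 + bonus x y else if lone x then 2 * payer x else 0).
Definition received x := \sum_(y | outer y) pay_starved y x.
Definition paid x := \sum_(y | outer y) pay_starved x y.
(* As before, in half units. *)
Definition final (x : T) : int := (2 * phi x + (received x)%:Z - (paid x)%:Z)%R.

Lemma final_sum : (\sum_(x | outer x) final x = 2 * \sum_(x | outer x) phi x)%R.
Proof. by rewrite /final -sum_transfer mulr_sumr. Qed.

Lemma starved_lone u : starved u -> lone u. Proof. by case/and3P. Qed.

Lemma received0 x : ~~ starved x -> received x = 0.
Proof. by move/negbTE => E; rewrite /received big1 // => y _; rewrite /pay_starved E andbF. Qed.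

Lemma paid_far r : far r -> paid r = d r starved + d r (fun y => starved y && bonus r y).
Proof.
move=> fr; rewrite !ndegE -big_split /= /paid big_mkcond; apply: eq_bigr => y _.
rewrite /pay_starved fr; case oy: (outer y).
  by case: (g r y); case: (starved y); rewrite ?mul0n ?mul1n //=; case: bonus.
by rewrite /starved /lone oy /= andbF.
Qed.

Lemma paid_lone x : lone x -> paid x = 2 * payer x * d x starved.
Proof.
move=> lx; rewrite ndegE big_distrr /= /paid big_mkcond; apply: eq_bigr => y _.
rewrite /pay_starved lx (lone_farF lx) mulnC; case oy: (outer y) => //.
by rewrite /starved /lone oy /= andbF muln0.
Qed.

Lemma paid_twin x : twin x -> paid x = 0.
Proof.
move=> tx; rewrite /paid big1 // => y _.
by rewrite /pay_starved (twin_farF tx); case: ifP => [l|]; [case: (lone_twin l tx)|rewrite muln0].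
Qed.

Lemma received_ge1 u x : outer x -> pay_starved x u <= received u.
Proof. by move=> o; rewrite /received (bigD1 x) //= leq_addr. Qed.

Lemma received_ge2 u x y : outer x -> outer y -> x != y -> pay_starved x u + pay_starved y u <= received u.
Proof.
move=> ox oy n; rewrite /received (bigD1 x) //= (bigD1 y) /=; last by rewrite oy eq_sym.
by rewrite addnA leq_addr.
Qed.

Lemma pay_far r u : far r -> g r u -> starved u -> pay_starved r u = 1 + bonus r u.
Proof. by move=> fr ru nu; rewrite /pay_starved fr ru nu mul1n. Qed.

Lemma pay_lone x u : lone x -> g x u -> starved u -> pay_starved x u = 2 * payer x.
Proof. by move=> lx xu nu; rewrite /pay_starved (lone_farF lx) lx xu nu mul1n. Qed.

Lemma starved_le x : d x starved <= d x near.
Proof. by apply: ndeg_le => y _ /starved_lone /(lone_near sat). Qed.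

Lemma starved_lt x y : g x y -> near y -> ~~ starved y -> d x starved < d x near.
Proof.
move=> xy ny nd; have : 0 < d x (fun y => near y && ~~ starved y) by apply: (ndeg_ge1 xy); rewrite ny.
have : d x starved + d x (fun y => near y && ~~ starved y) <= d x near; last by alia.
rewrite -ndegU; last by move=> z _ ->; rewrite andbF.
by apply: ndeg_le => z _ /orP[/starved_lone /(lone_near sat)|/andP[]].
Qed.

Lemma twin_not_starved w : twin w -> ~~ starved w.
Proof. by move=> tw; apply/negP => /starved_lone l; apply: lone_twin l tw. Qed.

Lemma starved_nbr_twin u w : starved u -> g u w -> twin w -> False.
Proof. by case/and3P=> _ /eqP t0 _ uw tw; have := ndeg0 t0 uw; rewrite tw. Qed.

(** Two of the [2 * d r near] half units are saved: a near neighbour that is not starved takes none,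
    and failing that the link of [r] with the root gives two neighbours on one hub, neither of which
    gets the bonus. *)
Lemma paid_far_le r : far r -> paid r + 2 <= 2 * d r near \/ 3 < deg r.
Proof.
move=> fr; case: (ltnP 3 (deg r)) => dr; [by right|left].
rewrite paid_far //; have B : d r (fun y => starved y && bonus r y) <= d r starved.
  by apply: ndeg_le => y _ /andP[].
case: (posnP (d r (fun y => near y && ~~ starved y))) => [n0|/ndeg_gt0[y [ry /andP[ny nd]]]]; last first.
  by have := starved_lt ry ny nd; alia.
have t0 : d r twin = 0.
  apply/eqP; rewrite -leqn0 leqNgt; apply/negP => /ndeg_gt0[w [rw tw]].
  by have := ndeg0 n0 rw; rewrite (twin_near sat tw) twin_not_starved.
have [h [p [q [vh pq [lp lq hp hq [rp rq]]]]]] := far_link fr t0.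
have P2 : 1 < d r (pred2 p q) by apply: (@ndeg_ge2 _ g r _ p q); rewrite //= eqxx ?orbT.
have : d r (fun y => starved y && bonus r y) + d r (pred2 p q) <= d r near; last first.
  by have := starved_le r; alia.
rewrite -ndegU; last first.
  move=> y ry /andP[ny]; rewrite /bonus ltnNge dr n0 /= leqNgt; apply: contra => /orP[] /eqP E; subst y.
  - by apply: (@ndeg_ge2 _ g r (own p) p q) => //; apply: (@ownI _ _ h); rewrite ?lone_near.
  - by apply: (@ndeg_ge2 _ g r (own q) p q) => //; apply: (@ownI _ _ h); rewrite ?lone_near.
apply: ndeg_le => y _ /orP[/andP[/starved_lone /(lone_near sat) //]|/orP[] /eqP ->]; exact: lone_near.
Qed.

Definition tail : pred T := fun r => [&& far r, deg r == 2 & d r far == 1].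

Lemma final_far r : far r -> (final r = 4 * (d r near)%:Z + 2 * (d r far)%:Z - 8 - (paid r)%:Z)%R.
Proof.
move=> fr; rewrite /final (phi_far sat fr) received0; last by apply/negP => /starved_lone l; apply: lone_far l fr.
by alia.
Qed.

Lemma final_far_ge r : far r -> (- 2 * (tail r : nat)%:Z <= final r)%R.
Proof.
move=> fr; rewrite final_far // /tail fr /=; have := deg_far sat fr.
have := deg2 r; rewrite leq_eqVlt => /orP[/eqP dr|dr]; last first.
  case: (paid_far_le fr) => H; first by alia.
  have : paid r <= 2 * d r near; last by alia.
  rewrite paid_far //; have := starved_le r.
  have : d r (fun y => starved y && bonus r y) <= d r starved by apply: ndeg_le => y _ /andP[].
  by alia.
rewrite -dr eqxx /= => E; have n1 := near_gt0 (far_outer fr).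
have no0 : d r starved = 0 -> paid r = 0.
  move=> H; rewrite paid_far // H; apply/eqP; rewrite -leqn0 -[X in _ <= X]H.
  by apply: ndeg_le => y _ /andP[].
(* The two neighbours of [r] are adjacent, and a starved vertex is adjacent neither to a twin nor to
   a vertex on its own hub. *)
have N0 : d r starved = 0.
  apply/eqP; rewrite -leqn0 leqNgt; apply/negP => /ndeg_gt0[u [ru nu]].
  case: (link (far_outer fr)) => [[h [p [q [vh n [np h1 h2 x1 x2]]]]]|[t [pt tt]]]; last first.
    have tu : t != u by apply/eqP => D; subst t; move: (twin_not_starved tt); rewrite nu.
    apply: (starved_nbr_twin nu _ tt); rewrite gs; exact: (deg2_triangle (esym dr) pt ru tu).
  have pq' := deg2_triangle (esym dr) x1 x2 n.
  have nq : near q by case: (far_nbr sat fr x2) => // fq; rewrite (far_hub sat fq vh) in h2.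
  have F : forall y, g r y -> y = p \/ y = q.
    by move=> y ry; apply: (@ndeg_le2 _ g r predT p q); rewrite -?dr.
  case: (F _ ru) => D; subst u.
  - by have := starved_own nu pq'; rewrite (ownI nq vh h1 h2).
  - by rewrite gs in pq'; have := starved_own nu pq'; rewrite (ownI np vh h2 h1).
rewrite (no0 N0); case: (eqVneq (d r far) 1) => [->|]; alia.
Qed.

Lemma final_lone x : lone x -> ~~ starved x -> (0 <= final x)%R /\
  (0 < d x twin -> d x starved + 1 < d x near -> (0 < final x)%R).
Proof.
move=> lx nx; rewrite /final received0 // paid_lone // (phi_lone sat lx).
have := near_gt0 (lone_outer lx); have := d_near sat v x.
case: (posnP (d x twin)) => t0; rewrite /payer ?t0 /=.
  rewrite /starved lx t0 eqxx /= in nx.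
  case: ltnP => o2; last by split=> //; alia.
  have : d x starved + d x (own x) <= d x near; last by split=> //; alia.
  rewrite -ndegU.
    by apply: ndeg_le => z _ /orP[/starved_lone /(lone_near sat)|/andP[]].
  move=> y xy ny; have yx : g y x by rewrite gs.
  apply/negP => o; have := starved_own ny yx; have [h vh hx] := near_hub sat (lone_near sat lx).
  by rewrite (ownI (lone_near sat lx) vh (own_hub lx vh hx o) hx).
have [w [xw tw]] := ndeg_gt0 t0.
have := starved_lt xw (twin_near sat tw) (twin_not_starved tw).
by split; alia.
Qed.

Lemma final_starved u : starved u -> (final u = (received u)%:Z - 2)%R /\ 0 < received u.
Proof.
move=> nu; have lu := starved_lone nu; have [h [k [x [vh vk kh [hu lx kx ux [U f1 t0]]]]]] := starvedP nu.
split.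
  rewrite /final paid_lone // (phi_lone sat lu) t0; case/and3P: (nu) => _ _ /eqP ->.
  have -> : payer u = false.
    rewrite /payer t0 /=; apply/negbTE; rewrite -leqNgt.
    have -> : d u (own u) = 0; last by [].
    apply/eqP; rewrite -leqn0 leqNgt; apply/negP => /ndeg_gt0[y [uy]].
    by rewrite starved_own.
  by alia.
have [r [ur fr]] := ndeg_gt0 f1; have ru : g r u by rewrite gs.
by have := received_ge1 u (far_outer fr); rewrite pay_far //; alia.
Qed.


Lemma lone_ne_hub x h : lone x -> g v h -> x <> h.
Proof. by move=> lx vh E; subst x; have := outer_v' (lone_outer lx); rewrite vh. Qed.

Lemma lone_other x h k : lone x -> g v h -> g v k -> k != h -> g h x -> g k x = false.
Proof.
move=> lx vh vk kh hx; apply/negP => kx; case/eqP: kh; exact: (lone_hub sat lx).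
Qed.

Lemma bonus_received r u : far r -> g r u -> starved u -> bonus r u -> 1 < received u.
Proof. by move=> fr ru nu B; have := received_ge1 u (far_outer fr); rewrite pay_far // B. Qed.

Lemma payer_received x u : lone x -> g x u -> starved u -> payer x -> 1 < received u.
Proof. by move=> lx xu nu B; have := received_ge1 u (lone_outer lx); rewrite pay_lone // B. Qed.

Lemma far2_received r r' u : far r -> far r' -> g r u -> g r' u -> r != r' -> starved u -> 1 < received u.
Proof.
move=> fr fr' ru ru' n nu; have := received_ge2 u (far_outer fr) (far_outer fr') n.
by rewrite !pay_far //; alia.
Qed.

Lemma two_hubs_twin h k y : g v h -> g v k -> k != h -> g h y -> g k y -> y != v -> twin y.
Proof.
move=> vh vk kh; apply: (sparse_common_twin sat hub_nbr_uniq) => //; by rewrite eq_sym.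
Qed.

(** Saturation for [u] and the hub [k] that it is not on. As [h] and [k] share only the root, the
    link makes [x] a payer, entitles [u] to a bonus from a far neighbour, or shows two far
    neighbours. *)
Lemma starved_fed u : (forall w, ~~ twin w) -> starved u -> 1 < received u.
Proof.
move=> W0 nu; have lu := starved_lone nu; have [h [k [x [vh vk kh [hu lx kx ux [U f1 t0]]]]]] := starvedP nu.
have xu : g x u by rewrite gs.
have ku : g k u = false by apply: (lone_other lu vh vk kh hu).
have hx : g h x = false by apply: (lone_other lx vk vh _ kx); rewrite eq_sym.
have uk : u != k by apply/eqP; apply: lone_ne_hub.
have nuk : ~~ g u k by rewrite gs ku.
have notw y : g h y -> g k y -> y != v -> False.
  by move=> hy ky yv; have := W0 y; rewrite (two_hubs_twin vh vk kh).
have uhub y : g v y -> g u y -> y = h by move=> vy uy; apply: (lone_hub sat lu); rewrite // gs.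
case: (nonadj_linked sat uk nuk) => -[t [y1 [y2 [[yt tx y12] [t1 t2 x1 x2]]]]].
- case: (outer_nbr sat (lone_outer lu) yt) => [vt|/near_far[nt|ft]].
  + have E := uhub _ vt yt; subst t.
    have [e|e] : y1 != v \/ y2 != v.
      by case: (eqVneq y1 v) y12 => [->|]; [rewrite eq_sym; right|left].
    * by case: (notw y1).
    * by case: (notw y2).
  + have E := U _ yt nt; subst t; apply: (payer_received lx xu nu); rewrite /payer.
    have O y : g x y -> g k y -> own x y.
      move=> xy ky; apply: (ownI _ vk kx ky); case: (outer_hub_nbr sat (lone_outer lx) vk ky xy) => // vy.
      have E : y = k by apply: (lone_hub sat lx); rewrite // gs.
      by subst y; rewrite (girr sat) in ky.
    by apply/orP; right; apply: (@ndeg_ge2 _ g x _ y1 y2) => //; apply: O.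
  + apply: (bonus_received ft _ nu); first by rewrite gs.
    rewrite /bonus; case: (leqP (d t (own u)) 1) => O; first by rewrite !orbT.
    suff : d t (own u) + d t (g k) <= deg t.
      have : 1 < d t (g k) by apply: (@ndeg_ge2 _ g t _ y1 y2).
      by move=> K L; apply/orP; left; alia.
    rewrite -ndegU; first exact: ndeg_le.
    move=> y ty o; apply/negP => ky; apply: (notw y) => //; first exact: (own_hub lu).
    by case/andP: o => /near_outer /andP[].
- case: (hub_nbr vk yt) => [E|vt|ot].
  + by subst t; case/eqP: y12; rewrite (uhub _ t1 x1) (uhub _ t2 x2).
  + have E : t = h by apply: (hub_nbr_uniq vk) => //; apply: two_hubs_adj; rewrite // eq_sym.
    subst t; case: (outer_hub_nbr sat (lone_outer lu) vh t1 x1) => [vy|ny].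
      by have E := uhub _ vy x1; subst y1; rewrite (girr sat) in t1.
    by have E := U _ x1 ny; subst y1; rewrite hx in t1.
  + have nt := nearI sat ot vk yt.
    have lt : lone t by move: nt; rewrite (near_split sat) (negbTE (W0 t)) orbF.
    have nh y : g t y -> g u y -> far y \/ y = x.
      move=> ty uy; case: (outer_nbr sat (lone_outer lu) uy) => [vy|/near_far[ny|fy]]; [|right|by left]; last exact: U.
      have E := uhub _ vy uy; subst y; case/eqP: kh; apply: (lone_hub sat lt); rewrite // gs //.
    have mixed y : g t x -> far y -> g t y -> g u y -> 1 < received u.
      move=> tx' fy ty uy; apply: (bonus_received fy _ nu); first by rewrite gs.
      rewrite /bonus; suff -> : 0 < d y (fun y => near y && ~~ starved y) by rewrite orbT.
      apply: (@ndeg_ge1 _ g y _ t); [by rewrite gs | rewrite nt /=].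
      apply/negP => nnt; have := starved_own nnt tx'.
      by rewrite (ownI (lone_near sat lx) vk yt kx).
    case: (nh _ t1 x1) => [f1'|E1]; case: (nh _ t2 x2) => [f2|E2].
    * by apply: (far2_received f1' f2); rewrite // gs.
    * by subst y2; apply: (mixed y1).
    * by subst y1; apply: (mixed y2).
    * by rewrite E1 E2 eqxx in y12.
Qed.

(** A starved vertex always receives something, so these lack exactly one half unit. *)
Definition poor : pred T := fun u => starved u && (received u <= 1).
(** Tails and poor vertices are credited with their largest possible deficits, two half units and
    one. *)
Definition slack x : int := (final x + 2 * (tail x : nat)%:Z + (poor x : nat)%:Z)%R.

Lemma slack_sum : (\sum_(x | outer x) slack x = 2 * (\sum_(x | outer x) phi x) + 2 * #|tail|%:Z + #|poor|%:Z)%R.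
Proof.
rewrite big_split big_split /= final_sum.
rewrite -mulr_sumr !sum_indicator // => x; first by case/andP=> /starved_lone /lone_outer.
by case/andP=> /far_outer.
Qed.

Lemma slack_ge x : outer x -> (0 <= slack x)%R.
Proof.
move=> ox; rewrite /slack; case: (boolP (starved x)) => nx.
  have [-> i0] := final_starved nx; rewrite /poor nx; case: (leqP (received x) 1) => /=; alia.
case: (outer_cases sat ox) => c.
- by have [H _] := final_lone c nx; alia.
- by rewrite /final received0 // paid_twin // (phi_twin c); alia.
- by have := final_far_ge c; alia.
Qed.

Lemma no_twin_sum_ge0 : (forall w, ~~ twin w) -> (0 <= \sum_(x | outer x) phi x)%R.
Proof.
move=> W0; have P0 : #|poor| = 0.
  apply: eq_card0 => u; rewrite unfold_in; apply/negP => /andP[nu].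
  by rewrite leqNgt starved_fed.
have T0 : #|tail| = 0.
  apply: eq_card0 => r; rewrite unfold_in; apply/negP => /and3P[fr /eqP dr /eqP fr1].
  have [h [p [q [_ pq [lp lq _ _ [rp rq]]]]]] := far_link fr (no_twin W0 r).
  have := ndeg_ge2 pq rp (lone_near sat lp) rq (lone_near sat lq).
  by have := deg_far sat fr; alia.
have : (0 <= \sum_(x | outer x) slack x)%R by apply: sumr_ge0 slack_ge.
by rewrite slack_sum P0 T0; alia.
Qed.


(** * Complete neighbourhood of size two, with a twin *)

Section WithTwin.
Variable w : T.
Hypothesis tw : twin w.

Let twin_uniq := twin_uniq sat Nv tw.
Let near_lone_w := near_lone_w sat Nv tw.
Let lone_neq_w := lone_neq_w tw.
Let far_neq_w := far_neq_w tw.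

Lemma off_twin x : ~~ g x w -> d x twin = 0.
Proof.
move=> xw; apply/eqP; rewrite -leqn0 leqNgt; apply/negP => /ndeg_gt0[t [xt tt]].
by rewrite -(twin_uniq tt) xt in xw.
Qed.

Lemma tail_far r : tail r -> far r. Proof. by case/and3P. Qed.

Lemma tail_nbrs r : tail r -> exists r1, [/\ g r w, g r r1, far r1, g r1 w &
  forall y, g r y -> y = w \/ y = r1].
Proof.
case/and3P=> fr /eqP dr /eqP f1; have n1 : d r near = 1 by have := deg_far sat fr; alia.
have [r1 [rr1 fr1]] : exists y, g r y /\ far y by apply: ndeg_gt0; rewrite f1.
have rw : g r w.
  apply/negPn/negP => nrw.
  have [h [p [q [_ pq [lp lq _ _ [rp rq]]]]]] := far_link fr (off_twin nrw).
  by have := ndeg_ge2 pq rp (lone_near sat lp) rq (lone_near sat lq); rewrite n1.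
have wr1 : r1 != w by apply: far_neq_w.
exists r1; split=> //; first by apply: (deg2_triangle dr).
by move=> y ry; apply: (@ndeg_le2 _ g r predT w r1); rewrite ?dr // eq_sym.
Qed.

(** A single half unit received rules out a second far neighbour, a paying [x], and each clause of
    [bonus] for the far neighbour [r]. *)
Lemma poorP p : poor p -> exists h k x r, [/\ g v h, g v k, k != h & [/\ g h p, lone x, g k x, g p x &
  [/\ far r, g p r, forall t, g p t -> [\/ t = h, t = x | t = r], ~~ payer x &
    [/\ forall y, g r y -> near y -> starved y, deg r <= 3, ~~ g r w & ~~ g x w]]]].
Proof.
case/andP=> np ip; have lp := starved_lone np.
have [h [k [x [vh vk kh [hp lx kx px [U f1 t0]]]]]] := starvedP np.
have [r [pr fr]] := ndeg_gt0 f1; have rp : g r p by rewrite gs.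
have nb : ~~ bonus r p by apply/negP => /(bonus_received fr rp np); alia.
have xp : g x p by rewrite gs.
have npay : ~~ payer x by apply/negP => /(payer_received lx xp np); alia.
move: nb; rewrite /bonus !negb_or => /and3P[b1 b2 _].
have NN y : g r y -> near y -> starved y.
  by move=> ry ny; apply/negPn/negP => nn; case/negP: b2; apply: (ndeg_ge1 ry); rewrite ny.
exists h, k, x, r; split=> //; split=> //; split=> // [t pt|].
  case: (outer_nbr sat (lone_outer lp) pt) => [vt|/near_far[nt|ft]].
  - by constructor 1; apply: (lone_hub sat lp); rewrite // gs.
  - by constructor 2; apply: U.
  - constructor 3; apply/eqP/negPn/negP => tr; have tp : g t p by rewrite gs.
    by have := far2_received ft fr tp rp tr np; alia.
split=> //; first by rewrite leqNgt.
- by apply/negP => rw; have := NN _ rw (twin_near sat tw); apply/negP; apply: twin_not_starved.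
- by apply/negP => xw; case/negP: npay; rewrite /payer (ndeg_ge1 xw tw).
Qed.

(** Starved vertices on one hub are nonadjacent. By [poorP] each has just three neighbours, and a
    link between them would create a starved vertex with a neighbour on its own hub, or leave [r]
    without a link to the root. *)
Lemma poor_uniq p p' h : poor p -> poor p' -> g v h -> g h p -> g h p' -> p = p'.
Proof.
move=> Pp Pp' vh hp hp'; apply/eqP/negPn/negP => pp'.
have [lp lp'] : lone p /\ lone p' by split; apply: starved_lone; [case/andP: Pp|case/andP: Pp'].
have aux q q' : poor q -> poor q' -> q != q' -> g h q -> g h q' -> lone q -> lone q' ->
    exists k x r x' r', [/\ [/\ g v k, k != h, far r & lone x], [/\ far r', lone x', g k x & g k x'],
     [/\ g q x, g q r, g q' x' & g q' r'],
     [/\ forall t, g q t -> [\/ t = h, t = x | t = r], forall t, g q' t -> [\/ t = h, t = x' | t = r'],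
      starved q & starved q'] &
     [/\ forall y, g r y -> near y -> starved y, deg r <= 3, ~~ g r w &
       forall y, g r' y -> near y -> starved y]].
  move=> Pq Pq' qq hq hq' lq lq'.
  have [h1 [k [x [r [vh1 vk kh1 [hq1 lx kx qx [fr qr Nq _ [Nr dr rw _]]]]]]]] := poorP Pq.
  have [h2 [k' [x' [r' [vh2 vk' kh2 [hq2 lx' kx' qx' [fr' qr' Nq' _ [Nr' _ _ _]]]]]]]] := poorP Pq'.
  have E1 : h1 = h by apply: (lone_hub sat lq).
  have E2 : h2 = h by apply: (lone_hub sat lq').
  subst h1 h2; have E : k' = k by apply: (other_hub_uniq vh) => //; rewrite eq_sym.
  subst k'; exists k, x, r, x', r'; split=> //; split=> //; by [case/andP: Pq|case/andP: Pq'].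
have half q q' t y1 y2 : poor q -> poor q' -> q != q' -> g h q -> g h q' -> lone q -> lone q' ->
    g q t -> y1 != y2 -> g t y1 -> g t y2 -> g q' y1 -> g q' y2 -> False.
  move=> Pq Pq' qq hq hq' lq lq' qt y12 t1 t2 q1 q2.
  have [k [x [r [x' [r' [[vk kh fr lx] [fr' lx' kx kx'] [qx qr qx' qr'] [Nq Nq' nq nq'] [Nr dr rw Nr']]]]]]] :=
    aux _ _ Pq Pq' qq hq hq' lq lq'.
  have hk : h != k by rewrite eq_sym.
  have hx : g h x = false by apply: (lone_other lx vk vh hk kx).
  have hx' : g h x' = false by apply: (lone_other lx' vk vh hk kx').
  have hr : g h r = false by apply: (far_hub sat fr vh).
  have hr' : g h r' = false by apply: (far_hub sat fr' vh).
  case: (Nq _ qt) => E; subst t.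
  - by case: (Nq' _ q1) => E; subst y1; rewrite ?(girr sat) ?hx' ?hr' in t1.
  - have [xx xr] : g x x' /\ g x r'.
      by case: (Nq' _ q1) => E1; case: (Nq' _ q2) => E2; subst y1 y2; split; move: y12 t1 t2;
        rewrite ?eqxx ?(gs x h) ?hx.
    have nx : starved x by apply: Nr'; [rewrite gs|apply: lone_near].
    by have := starved_own nx xx; rewrite (ownI (lone_near sat lx') vk kx kx').
  - have [rx rr] : g r x' /\ g r r'.
      by case: (Nq' _ q1) => E1; case: (Nq' _ q2) => E2; subst y1 y2; split; move: y12 t1 t2;
        rewrite ?eqxx ?(gs r h) ?hr.
    have rq : g r q by rewrite gs.
    have [l [s1 [s2 [vl ss [ls1 ls2 l1 l2 [r1 r2]]]]]] := far_link fr (off_twin rw).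
    have n2 : d r near <= 2 by have := deg_far sat fr; have := ndeg_ge1 rr fr'; alia.
    have qx1 : q != x' by apply/eqP => E; subst x'; rewrite hq in hx'.
    have S s : g r s -> near s -> s = q \/ s = x'.
      by apply: (ndeg_le2 n2 qx1 rq (lone_near sat lq) rx (lone_near sat lx')).
    have bad : g l q -> g l x' -> False.
      move=> lq1 lx1; have E : l = h by apply: (lone_hub sat lq).
      by subst l; rewrite hx' in lx1.
    by case: (S _ r1 (lone_near sat ls1)) => E1; case: (S _ r2 (lone_near sat ls2)) => E2; subst s1 s2;
      rewrite ?eqxx // in ss; apply: bad.
have npp : ~~ g p p'.
  apply/negP => D; have np : starved p by case/andP: Pp.
  by have := starved_own np D; rewrite (ownI (lone_near sat lp') vh hp hp').
case: (nonadj_linked sat pp' npp) => -[t [y1 [y2 [[yt tx y12] [t1 t2 x1 x2]]]]].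
- exact: (half p p' t y1 y2).
- by apply: (half p' p t y1 y2); rewrite // eq_sym.
Qed.

Lemma poor_card : #|poor| <= 2.
Proof.
rewrite leqNgt; apply/negP => /card_gt2P[x [y [z [[nx ny nz] [xy yz zx]]]]].
move: nx ny nz; rewrite !unfold_in => nx ny nz.
have cls p : poor p -> g a p \/ g b p.
  move=> Pp; have [h [_ [_ [_ [vh _ _ [hp _ _ _ _]]]]]] := poorP Pp.
  by case: (Nv vh) hp => ->; [left|right].
have dif h p q : poor p -> poor q -> p != q -> g v h -> g h p -> g h q -> False.
  by move=> Pp Pq pq vh hp hq; case/eqP: pq; apply: (poor_uniq Pp Pq vh).
by case: (cls _ nx) (cls _ ny) (cls _ nz) => [] ? [] ? [] ?;
  first [exact: (dif a x y)|exact: (dif b x y)|exact: (dif a y z)|exact: (dif b y z)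
        |exact: (dif a z x)|exact: (dif b z x)].
Qed.

Lemma tail_card_le2 : #|tail| <= 2.
Proof. exact: (tail_card sat tw tail_far tail_nbrs). Qed.

(** Saturation for a tail and [p] makes the partner of the tail adjacent to [x] and [s], the
    neighbours of [p] besides its hub. The partners of two tails would then share [w], [x] and
    [s]. *)
Lemma two_tails r r' p : tail r -> tail r' -> r != r' -> poor p -> False.
Proof.
move=> tr tr' rr' Pp.
have [h [k [x [s [vh vk kh [hp lx kx px [fs ps Np _ [_ _ sw xw]]]]]]]] := poorP Pp.
have lp : lone p by apply: starved_lone; case/andP: Pp.
have att q q1 : tail q -> g q q1 -> far q1 -> g q1 x /\ g q1 s.
  move=> tq qq1 fq1; have [q1' [qw qq1' _ _ Nq]] := tail_nbrs tq.
  have E : q1' = q1 by case: (Nq _ qq1) => // E; subst q1; case: (twin_far tw fq1).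
  subst q1'; have fq := tail_far tq.
  have qp : q != p by apply/eqP => E; subst q; apply: lone_far lp fq.
  have xw' : g w x = false by rewrite gs; apply/negbTE.
  have sw' : g w s = false by rewrite gs; apply/negbTE.
  have nqp : ~~ g q p.
    apply/negP => D; case: (Nq _ D) => E; first by have := lone_neq_w lp; rewrite E eqxx.
    by subst q1; apply: lone_far lp fq1.
  have hq1 : g q1 h = false by rewrite gs; apply: (far_hub sat fq1 vh).
  case: (nonadj_linked sat qp nqp) => -[t [y1 [y2 [[yt tx y12] [t1 t2 x1 x2]]]]].
  - case: (Nq _ yt) => E; subst t;
    by case: (Np _ x1) => E1; case: (Np _ x2) => E2; subst y1 y2; split; move: y12 t1 t2;
        rewrite ?eqxx ?xw' ?sw' ?hq1.
  - have [tw' tq1] : g t w /\ g t q1.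
      by case: (Nq _ x1) => E1; case: (Nq _ x2) => E2; subst y1 y2; rewrite ?eqxx // in y12.
    case: (Np _ yt) => E; subst t; first by rewrite gs hq1 in tq1.
      by rewrite tw' in xw.
    by rewrite tw' in sw.
have [r1 [rw rr1 fr1 r1w N]] := tail_nbrs tr.
have [r1' [rw' rr1' fr1' r1w' N']] := tail_nbrs tr'.
have [r1x r1s] := att _ _ tr rr1 fr1; have [r1x' r1s'] := att _ _ tr' rr1' fr1'.
have no q q1 : tail q -> far q1 -> (forall y, g q y -> y = w \/ y = q1) -> g q x -> False.
  move=> tq fq1 Nq qx; case: (Nq _ qx) => E; first by have := lone_neq_w lx; rewrite E eqxx.
  by subst x; apply: lone_far lx fq1.
case: (boolP (g r r')) => D.
  case: (N _ D) => E; first by have := far_neq_w (tail_far tr'); rewrite E eqxx.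
  by subst r'; apply: (no r1 r1').
have e := tail_pair sat tw tail_nbrs tr tr' rr' D rr1 fr1 rr1' fr1'.
have xs : x != s by apply/eqP => E; subst x; apply: lone_far lx fs.
apply: (@K23_free _ _ sat r1 r1' w x s) => //; first exact: (gneq sat).
- by rewrite eq_sym lone_neq_w.
- by rewrite eq_sym far_neq_w.
Qed.

Lemma paid_far_le2 y : far y -> paid y <= 2 * d y starved.
Proof.
move=> fy; rewrite paid_far //.
have : d y (fun z => starved z && bonus y z) <= d y starved by apply: ndeg_le => z _ /andP[].
by alia.
Qed.

Lemma starved_lt2 x s1 s2 : s1 != s2 -> near s1 -> near s2 -> ~~ starved s1 -> ~~ starved s2 ->
  g x s1 -> g x s2 -> d x starved + 2 <= d x near.
Proof.
move=> n n1 n2 m1 m2 x1 x2.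
have H : d x starved + d x (pred2 s1 s2) <= d x near.
  rewrite -ndegU; last first.
    by move=> z _ nz; apply/negP => /orP[] /eqP E; subst z; rewrite nz in m1 m2.
  by apply: ndeg_le => z _ /orP[/starved_lone /(lone_near sat)|/orP[] /eqP ->].
have : 1 < d x (pred2 s1 s2) by apply: (@ndeg_ge2 _ g x _ s1 s2); rewrite //= eqxx ?orbT.
by alia.
Qed.

Lemma final_far_pos y s1 s2 : far y -> s1 != s2 -> near s1 -> near s2 -> ~~ starved s1 -> ~~ starved s2 ->
  g y s1 -> g y s2 -> 2 < deg y -> (0 < final y)%R.
Proof.
move=> fy n n1 n2 m1 m2 x1 x2; rewrite final_far // (deg_far sat fy).
by have := starved_lt2 n n1 n2 m1 m2 x1 x2; have := paid_far_le2 fy; alia.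
Qed.

Local Notation some_final_pos := (exists e, outer e /\ (0 < final e)%R).

(** The positive vertex is found near a lone neighbour [p] of [w], by saturation for [p] and the
    tail and, if necessary, for [p] and a starved vertex on the same hub. *)
Lemma tail_surplus r : tail r -> some_final_pos.
Proof.
move=> tr; have [r1 [rw rr1 fr1 r1w Nr]] := tail_nbrs tr; have fr := tail_far tr.
have [h [p [vh hp np wp]]] : exists h p, [/\ g v h, g h p, near p & g w p].
  case: (link (twin_outer tw)) => [[h [p [_ [vh _ [np hp _ wp _]]]]]|[t [wt tt]]].
    by exists h, p.
  by rewrite (twin_uniq tt) (girr sat) in wt.
have pw : g p w by rewrite gs.
have lp : lone p by apply: near_lone_w => //; apply: (gneq sat).
have nw := twin_near sat tw; have mw := twin_not_starved tw.
have mp : ~~ starved p by apply/negP => N; apply: (starved_nbr_twin N pw tw).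
have pnw := lone_neq_w lp.
(* A starved lone neighbour of [p] is overfed, by the payer [p] and by a far neighbour. If the lone
   neighbour is not starved, neither it nor [w] takes anything from [p], which remains positive. *)
case: (pickP [pred z | g p z && lone z]) => [z /= /andP[pz lz]|NL].
  case: (boolP (starved z)) => mz.
    have [E _] := final_starved mz; have [_ [_ [_ [_ _ _ [_ _ _ _ [_ f1 _]]]]]] := starvedP mz.
    have [s [zs fs]] := ndeg_gt0 f1; have ps : p != s by apply/eqP => D; subst s; apply: lone_far lp fs.
    have sz : g s z by rewrite gs.
    exists z; split; first exact: lone_outer.
    have := received_ge2 z (lone_outer lp) (far_outer fs) ps.
    by rewrite pay_lone // pay_far // E /payer (ndeg_ge1 pw tw); alia.
  have wz : w != z by rewrite eq_sym; apply: lone_neq_w.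
  exists p; split; first exact: lone_outer.
  have [_ H] := final_lone lp mp; apply: H; first exact: ndeg_ge1 pw tw.
  by have := starved_lt2 wz nw (lone_near sat lz) mw mz pw pz; alia.
have Np t : g p t -> [\/ t = h, t = w | far t].
  move=> pt; case: (outer_nbr sat (lone_outer lp) pt) => [vt|/near_far[nt|ft]]; last by constructor 3.
    by constructor 1; apply: (lone_hub sat lp); rewrite // gs.
  case: (eqVneq t w) => [->|tw']; first by constructor 2.
  by have := NL t; rewrite /= pt near_lone_w.
have far2 y : far y -> g p y -> g y w -> 2 < deg y -> some_final_pos.
  move=> fy py yw dy; exists y; split; first exact: far_outer.
  by apply: (@final_far_pos y p w) => //; rewrite gs.
have r1p : g r1 p -> some_final_pos.
  move=> D; apply: (far2 r1) => //; first by rewrite gs.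
  have pr : p != r by apply/eqP => E; subst r; apply: lone_far lp fr.
  have wr : w != r by rewrite eq_sym far_neq_w.
  have r1r : g r1 r by rewrite gs.
  by apply: (@ndeg_ge3 _ g r1 predT p w r).
have pr1 : p <> r1 by move=> E; subst r1; apply: lone_far lp fr1.
(* Far common neighbours of [p] and [w] are positive from degree three on. For degree two,
   saturation with [r] makes [p] adjacent to [r1], which is then such a vertex of degree at least
   three. *)
have c1 y : far y -> g p y -> g y w -> some_final_pos.
  move=> fy py yw; case: (ltnP 2 (deg y)) => dy; first exact: (far2 y).
  have yp : g y p by rewrite gs.
  have Ny t : g y t -> t = p \/ t = w by move=> yt; apply: (ndeg_le2 dy pnw).
  have yr : y != r.
    by apply/eqP => E; subst y; case: (Nr _ yp) => // E; rewrite E eqxx in pnw.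
  have nyr : ~~ g y r.
    apply/negP => D; case: (Ny _ D) => E; first by subst r; apply: lone_far lp fr.
    by have := far_neq_w fr; rewrite E eqxx.
  case: (nonadj_linked sat yr nyr) => -[t [y1 [y2 [[yt tx y12] [t1 t2 x1 x2]]]]].
  - have [tw' tr1] : g t w /\ g t r1.
      by case: (Nr _ x1) => E1; case: (Nr _ x2) => E2; subst y1 y2; rewrite ?eqxx // in y12.
    case: (Ny _ yt) => E; subst t; first by apply: r1p; rewrite gs.
    by rewrite (girr sat) in tw'.
  - have [tw' tp] : g t w /\ g t p.
      by case: (Ny _ x1) => E1; case: (Ny _ x2) => E2; subst y1 y2; rewrite ?eqxx // in y12.
    case: (Nr _ yt) => E; subst t; last exact: r1p.
    by rewrite (girr sat) in tw'.
have hf y : far y -> g h y = false by move=> fy; apply: (far_hub sat fy vh).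
have rp : r != p by apply/eqP => E; subst r; apply: lone_far lp fr.
have nrp : ~~ g r p.
  by apply/negP => D; case: (Nr _ D) => E; [rewrite E eqxx in pnw|apply: pr1].
have [//|[y [fy py r1y]]] : some_final_pos \/ exists y, [/\ far y, g p y & g r1 y].
  case: (nonadj_linked sat rp nrp) => -[t [y1 [y2 [[yt tx y12] [t1 t2 x1 x2]]]]].
  - case: (Nr _ yt) => E; subst t.
    + case: (Np _ x1) => E1; last by left; apply: (c1 y1); rewrite // gs.
        case: (Np _ x2) => E2; last by left; apply: (c1 y2); rewrite // gs.
          by rewrite E1 E2 eqxx in y12.
        by subst y2; rewrite (girr sat) in t2.
      by subst y1; rewrite (girr sat) in t1.
    + case: (Np _ x1) => E1; last by right; exists y1.
        by subst y1; rewrite gs hf in t1.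
      case: (Np _ x2) => E2; last by right; exists y2.
        by subst y2; rewrite gs hf in t2.
      by rewrite E1 E2 eqxx in y12.
  - have [tw' tr1] : g t w /\ g t r1.
      by case: (Nr _ x1) => E1; case: (Nr _ x2) => E2; subst y1 y2; rewrite ?eqxx // in y12.
    left; case: (Np _ yt) => E; last exact: (c1 t).
      by subst t; rewrite hf in tr1.
    by subst t; rewrite (girr sat) in tw'.
case: (boolP (g y w)) => yw; first exact: (c1 y).
have yp : g y p by rewrite gs.
have [l [s1 [s2 [vl ss [ls1 ls2 l1 l2 [y1 y2]]]]]] := far_link fy (off_twin yw).
have k2 := ndeg_ge2 ss y1 (lone_near sat ls1) y2 (lone_near sat ls2).
have yr1 : g y r1 by rewrite gs.
have f1 := ndeg_ge1 yr1 fr1; have := final_far fy; have := starved_lt yp np mp; have := paid_far_le2 fy.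
(* If [y] is not positive, the estimates are tight: its neighbours are [p], a starved [q] and the
   far [r1], and its link with the root puts [q] on the hub of [p]. *)
case: (boolP (0 < final y)%R) => [Py|NP O L F]; first by exists y; split=> //; apply: far_outer.
have [n2 fy1 o1] : [/\ d y near <= 2, d y far <= 1 & 0 < d y starved].
  by move: NP; rewrite -Order.TotalTheory.leNgt => NP; split; alia.
have [q [yq mq]] := ndeg_gt0 o1; have lq := starved_lone mq; have nq := lone_near sat lq.
have pq : p != q by apply/eqP => E; subst q; rewrite mq in mp.
have hq : g h q.
  have S s : g y s -> near s -> s = p \/ s = q by apply: (ndeg_le2 n2 pq).
  have lpq : g l p /\ g l q.
    by case: (S _ y1 (lone_near sat ls1)) => E1; case: (S _ y2 (lone_near sat ls2)) => E2; subst s1 s2;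
      rewrite ?eqxx // in ss.
  have E : l = h by apply: (lone_hub sat lp) => //; case: lpq.
  by subst l; case: lpq.
have [h' [k [x [vh' vk kh [hq' lx kx qx [U _ _]]]]]] := starvedP mq.
have E : h' = h by apply: (lone_hub sat lq).
subst h'; have By : bonus y q.
  by rewrite /bonus (ndeg_ge1 yp) ?orbT // np.
have hx : g h x = false by apply: (lone_other lx vk vh _ kx); rewrite eq_sym.
have xq : g x q by rewrite gs.
have fq u : outer u -> u != y -> 0 < pay_starved u q -> some_final_pos.
  move=> ou uy pu; exists q; split; first exact: lone_outer.
  have [-> _] := final_starved mq; have := received_ge2 q ou (far_outer fy) uy.
  by rewrite (pay_far fy) // By; alia.
have xy : x != y by apply/eqP => E; subst x; apply: lone_far lx fy.
case: (boolP (payer x)) => Px.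
  by apply: (fq x) => //; [apply: lone_outer | rewrite pay_lone // Px].
have xw : g x w = false.
  by apply/negP => D; case/negP: Px; rewrite /payer (ndeg_ge1 D tw).
case: (pickP [pred u | [&& g q u, far u & u != y]]) => [u /= /and3P[qu fu uy]|NF].
  by apply: (fq u) => //; [apply: far_outer | rewrite pay_far // gs].
have Nq t : g q t -> [\/ t = h, t = x | t = y].
  move=> qt; case: (outer_nbr sat (lone_outer lq) qt) => [vt|/near_far[nt|ft]].
  - by constructor 1; apply: (lone_hub sat lq); rewrite // gs.
  - by constructor 2; apply: U.
  - by constructor 3; apply/eqP/negPn/negP => ty; have := NF t; rewrite /= qt ft ty.
have nqp : ~~ g q p.
  by apply/negP => D; have E := U _ D np; subst x; rewrite hp in hx.
have qp : q != p by rewrite eq_sym.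
have yfar z : far z -> g y z -> z = r1 by move=> fz yz; apply: (ndeg_le1 fy1).
(* A link between [q] and [p] leads back to an edge [p r1], or gives two far common neighbours of
   [p] and [x]. In the latter case a starved [x] gets a bonus from both; otherwise [p] and [x] take
   nothing from them. *)
case: (nonadj_linked sat qp nqp) => -[t [z1 [z2 [[qt tx z12] [t1 t2 x1 x2]]]]]; last first.
  case: (Np _ qt) => E.
  - by subst t; case: (Nq _ x1) => E1; case: (Nq _ x2) => E2; subst z1 z2; move: z12 t1 t2;
      rewrite ?eqxx ?(girr sat) ?hx ?hf.
  - by subst t; case: (Nq _ x1) => E1; case: (Nq _ x2) => E2; subst z1 z2; move: z12 t1 t2;
      rewrite ?eqxx ?(gs w x) ?xw ?(gs w y) ?(negbTE yw).
  - have th : g t h = false by rewrite gs hf.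
    have ty : g y t.
      by rewrite gs; case: (Nq _ x1) => E1; case: (Nq _ x2) => E2; subst z1 z2; move: z12 t1 t2;
        rewrite ?eqxx ?th.
    by have E1 := yfar _ E ty; subst t; apply: r1p; rewrite gs.
case: (Nq _ qt) => E; subst t.
- case: (Np _ x1) => E1; first by subst z1; rewrite (girr sat) in t1.
    case: (Np _ x2) => E2; first by subst z2; rewrite (girr sat) in t2.
      by rewrite E1 E2 eqxx in z12.
    by rewrite hf in t2.
  by rewrite hf in t1.
- have fz z : g x z -> g p z -> far z.
    move=> xz /Np[] // E; subst z; last by rewrite xw in xz.
    by rewrite gs hx in xz.
  have [F1 F2] := (fz _ t1 x1, fz _ t2 x2).
  case: (boolP (starved x)) => mx.
    exists x; split; first exact: lone_outer.
    have B z : g p z -> bonus z x by move=> pz; rewrite /bonus (@ndeg_ge1 _ g z _ p) ?orbT // ?np // gs.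
    have zx z : g x z -> g z x by rewrite gs.
    have [-> _] := final_starved mx; have := received_ge2 x (far_outer F1) (far_outer F2) z12.
    by rewrite !pay_far ?B ?zx //; alia.
  have px : p != x by apply/eqP => E; subst x; rewrite hp in hx.
  have [zp zx] : g z1 p /\ g z1 x by rewrite !(gs z1).
  exists z1; split; first exact: far_outer.
  apply: (@final_far_pos z1 p x) => //; first exact: lone_near.
  rewrite ltn_neqAle deg2 andbT; apply/eqP => dz.
  by have := deg2_triangle (esym dz) zp zx px => D; have := NL x; rewrite /= D lx.
- case: (Np _ x1) => E1; first by subst z1; rewrite gs hf in t1.
    by subst z1; rewrite (negbTE yw) in t1.
  case: (Np _ x2) => E2; first by subst z2; rewrite gs hf in t2.
    by subst z2; rewrite (negbTE yw) in t2.
  by case/eqP: z12; rewrite (yfar _ E1 t1) (yfar _ E2 t2).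
Qed.

(** In half units less than four may be missing. Poor vertices lack two at most; one tail adds two,
    but then some vertex is positive; two tails account for four, but exclude poor vertices and
    again leave something positive. *)
Lemma phi_sum_twin : (-2 < \sum_(x | outer x) phi x)%R.
Proof.
have S := slack_sum; have P2 := poor_card; have T2 := tail_card_le2.
have S0 : (0 <= \sum_(x | outer x) slack x)%R by apply: sumr_ge0 slack_ge.
case: (posnP #|tail|) => T0; first by rewrite T0 in S; alia.
have [r tr] : exists r, tail r by case/card_gt0P: T0 => r; exists r.
have [e [oe pe]] := tail_surplus tr.
have S1 : (0 < \sum_(x | outer x) slack x)%R.
  apply: Order.POrderTheory.lt_le_trans (sum_ge1 slack_ge oe).
  by rewrite /slack; alia.
case: (ltnP 1 #|tail|) => T1; last by alia.
have [r' [s [ss tr' ts]]] : exists r' s, [/\ r' != s, tail r' & tail s].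
  by case/card_gt1P: T1 => r' [s [? ? ?]]; exists r', s.
suff P0 : #|poor| = 0 by alia.
apply: eq_card0 => u; rewrite unfold_in; apply/negP => Pu.
exact: (two_tails tr' ts ss Pu).
Qed.
End WithTwin.

End Deg2Tau2.

Section Deg2Tau2Main.
Variables (T : finType) (g : rel T).
Hypothesis sat : K23_saturated g.
Hypothesis deg2 : forall x, 2 <= ndeg g x predT.
Hypothesis tau_pos : forall x, ndeg g x predT = 2 -> 2 <= tau2 g x.

Lemma dense_deg2_tau2 v : ndeg g v predT = 2 -> dense g.
Proof.
move=> dv; have tv := tau_pos dv.
have [a [b [ab va _ vb _]]] : exists a b, [/\ a != b, g v a, true, g v b & true].
  by apply: (@ndeg_gt1 _ g v predT); rewrite dv.
have N y : g v y -> y = a \/ y = b by move=> vy; apply: (@ndeg_le2 _ g v predT); rewrite ?dv.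
have gab : g a b by move: tv; rewrite (tau2_2 sat dv ab va vb); case: (g a b).
apply: (@dense_phi _ _ sat v); rewrite tau2_sum dv (tau2_2 sat dv ab va vb) gab.
suff : (-2 < \sum_(x | outer g v x) phi g v x)%R by [].
case: (pickP (twin g v)) => [w tw|W0].
  exact: (phi_sum_twin sat deg2 tau_pos va vb N tw).
apply: (@Order.POrderTheory.lt_le_trans _ _ 0%R) => //.
by apply: (no_twin_sum_ge0 sat deg2 tau_pos gab N) => w; rewrite W0.
Qed.
End Deg2Tau2Main.

(** * Cones over graphs of maximum degree two *)

Definition cone (T : finType) (o : T) (H : rel T) : rel T :=
  fun x y => (x != y) && [|| x == o, y == o | H x y].

Section Cone.
Variables (T : finType) (o : T) (H : rel T).
Hypotheses (Hs : symmetric H) (Hi : irreflexive H) (Ho : forall x, H o x = false).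
Hypothesis H_deg2 : forall x, ndeg H x predT <= 2.
Hypothesis H_common : forall x y z z', x != y -> H x z -> H y z -> H x z' -> H y z' -> z = z'.
Hypothesis H_nonadj : forall x y, x != o -> y != o -> x != y -> ~~ H x y ->
  1 < ndeg H x predT \/ 1 < ndeg H y predT.
Local Notation g := (cone o H).

Lemma cone_sym x y : g x y = g y x.
Proof. by rewrite /cone eq_sym Hs; case: (x == o); case: (y == o); rewrite ?orbT. Qed.

Lemma cone_off x y : x != o -> y != o -> g x y -> H x y.
Proof. by rewrite /cone => /negbTE -> /negbTE -> /andP[]. Qed.

Lemma H_neq x y : H x y -> x != y.
Proof. by apply: contraTneq => ->; rewrite Hi. Qed.

Lemma H_off x y : H x y -> y != o.
Proof. by apply: contraTneq => ->; rewrite Hs Ho. Qed.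

Lemma cone_H x y : H x y -> g x y.
Proof. by move=> h; rewrite /cone H_neq // h !orbT. Qed.

(** With the apex in the part of size two, the other vertex of that part has degree three in [H].
    Otherwise two vertices of the larger part avoid the apex and are common neighbours in [H],
    against [H_common]. *)
Lemma cone_K23_free : ~ has_K23 g.
Proof.
case=> a1 [a2 [b1 [b2 [b3 [un]]]]] /and5P[g11 g12 g13 g21 /andP[g22 g23]].
move: un; rewrite /= !inE !negb_or.
move=> /and5P[/and4P[a12 a1b1 a1b2 a1b3] /and3P[a2b1 a2b2 a2b3] /andP[b12 b13] b23 _].
have off x : x != o -> o != x by rewrite eq_sym.
have two p q x y : p != q -> x != y -> p != o -> q != o -> x != o -> y != o ->
    g p x -> g q x -> g p y -> g q y -> False.
  move=> pq xy po qo xo yo px qx py qy; case/eqP: xy.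
  by apply: (H_common pq); apply: cone_off.
have three p : p != o -> b1 != o -> b2 != o -> b3 != o -> g p b1 -> g p b2 -> g p b3 -> False.
  move=> po o1 o2 o3 p1 p2 p3; have := H_deg2 p; rewrite leqNgt => /negP; apply.
  by apply: (@ndeg_ge3 _ H p predT b1 b2 b3) => //; apply: cone_off.
have [E|a1o] := eqVneq a1 o.
  by subst a1; apply: (three a2) => //; rewrite eq_sym.
have [E|a2o] := eqVneq a2 o.
  by subst a2; apply: (three a1) => //; rewrite eq_sym.
have [E|b1o] := eqVneq b1 o.
  by subst b1; apply: (two a1 a2 b2 b3) => //; rewrite eq_sym.
have [E|b2o] := eqVneq b2 o.
  by subst b2; apply: (two a1 a2 b1 b3) => //; rewrite eq_sym.
exact: (two a1 a2 b1 b2).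
Qed.

(** If [p] has two neighbours in [H], it shares them with the apex, and a new edge [p q] adds [q] as
    a third common neighbour. *)
Lemma cone_saturated : K23_saturated g.
Proof.
split; first by split=> [x|x y]; [rewrite /cone eqxx|rewrite cone_sym].
split=> [|x y xy nxy]; first exact: cone_K23_free.
have [xo yo nH] : [/\ x != o, y != o & ~~ H x y].
  by move: nxy; rewrite /cone xy /= !negb_or => /and3P[].
have A p q : g p q -> add_edge g x y p q by rewrite /add_edge => ->.
have [xy' yx'] : add_edge g x y x y /\ add_edge g x y y x.
  by rewrite /add_edge !eqxx !orbT.
have og p : p != o -> g o p by rewrite /cone eq_sym eqxx => ->.
have main p q : p != o -> q != o -> p != q -> ~~ H p q -> add_edge g x y p q -> 1 < ndeg H p predT ->
    has_K23 (add_edge g x y).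
  move=> po qo pq npq e /ndeg_gt1[y1 [y2 [y12 p1 _ p2 _]]].
  have N z : H p z -> q != z by move=> pz; apply: contraNneq npq => ->.
  exists o, p, q, y1, y2; split; last first.
    by rewrite e !A ?og ?cone_H ?(H_off p1) ?(H_off p2).
  by rewrite /= !inE !negb_or !(eq_sym o) po qo (H_off p1) (H_off p2) pq (H_neq p1) (H_neq p2)
    (N _ p1) (N _ p2) y12.
case: (H_nonadj xo yo xy nH); first by apply: (main x y).
by apply: (main y x) => //; rewrite ?(Hs y) // eq_sym.
Qed.

(** The apex has degree at most [#|T| - 1], and every other vertex gains at most the edge to the
    apex, which makes another [#|T| - 1] in total. *)
Lemma cone_deg : \sum_x ndeg g x predT <= 2 * (#|T| - 1) + \sum_x ndeg H x predT.
Proof.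
have -> : 2 * (#|T| - 1) = \sum_x (if x == o then #|T| - 1 else 1).
  rewrite (bigD1 o) //= eqxx (eq_bigr (fun=> 1)) => [|x /negbTE -> //].
  by rewrite sum1_card cardC1 subn1 mul2n -addnn.
rewrite -big_split /=; apply: leq_sum => x _; case: eqP => [->|/eqP xo].
  have -> : #|T| - 1 = #|predC1 o| by rewrite cardC1 subn1.
  apply: leq_trans (leq_addr _ _); apply: subset_leq_card; apply/subsetP => y.
  by rewrite !inE /cone eq_sym => /andP[/andP[]].
have : ndeg g x predT <= ndeg g x (pred1 o) + ndeg g x (predC1 o).
  by rewrite (ndegC g x (pred1 o)).
have : ndeg g x (predC1 o) <= ndeg H x predT.
  apply: subset_leq_card; apply/subsetP => y; rewrite !inE andbT => /andP[xy yo].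
  exact: cone_off.
have : ndeg g x (pred1 o) <= 1.
  rewrite -(card1 o); apply: subset_leq_card; apply/subsetP => y.
  by rewrite !inE => /andP[].
lia.
Qed.
End Cone.

(** * The two bounds *)

Section LowerBound.
Variables (T : finType) (g : rel T).
Hypothesis sat : K23_saturated g.
Local Notation deg x := (ndeg g x predT).

Lemma saturated_dense : 1 < #|T| -> dense g.
Proof.
move=> c; have d1 := deg_gt0 sat ^~ c.
case: (pickP [pred x | deg x == 1]) => [x /eqP|N1]; first exact: dense_deg1.
have deg2 x : 1 < deg x by have := d1 x; have /= := N1 x; case: (deg x) => [|[]].
case: (pickP [pred x | deg x == 2]) => [x /= /eqP dx|N2].
  case: (pickP [pred x | (deg x == 2) && (tau2 g x == 0)]) => [y /andP[/eqP dy /eqP ty]|N].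
    exact: (dense_deg2_tau0 sat deg2 dy ty).
  apply: (@dense_deg2_tau2 _ g sat deg2 _ x dx) => y dy.
  have [p [q [pq yp _ yq _]]] : exists a b, [/\ a != b, g y a, true, g y b & true].
    by apply: (@ndeg_gt1 _ g y predT); rewrite dy.
  by have := N y; rewrite /= dy /= (tau2_2 sat dy pq yp yq); case: (g p q).
have deg3 x : 2 < deg x by have := deg2 x; have /= := N2 x; case: (deg x) => [|[|[]]].
case: (pickP [pred x | deg x == 3]) => [x /= /eqP dx|N3]; last first.
  by apply: dense_deg4 => x; have := deg3 x; have /= := N3 x; case: (deg x) => [|[|[|[]]]].
have T3 y : deg y = 3 -> exists p q r, [/\ [/\ g y p, g y q & g y r],
    forall z, g y z -> [\/ z = p, z = q | z = r] & tau2 g y = 2 * (g p q + g p r + g q r)].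
  move=> dy; have [p [q [pq yp _ yq _]]] : exists a b, [/\ a != b, g y a, true, g y b & true].
    by apply: (@ndeg_gt1 _ g y predT); rewrite dy.
  have [r [yr rp rq N]] := nbr3 dy pq yp yq; exists p, q, r; split=> //.
  by apply: tau2_3; rewrite // eq_sym.
case: (pickP [pred x | (deg x == 3) && (tau2 g x == 0)]) => [y /andP[/eqP dy /eqP ty]|N].
  have [p [q [r [[yp yq yr] Ny E]]]] := T3 _ dy.
  have [e1 e2 e3] : [/\ g p q = false, g p r = false & g q r = false].
    by move: E; rewrite ty; case: (g p q); case: (g p r); case: (g q r).
  apply: (@dense_tau0 _ g sat deg3 y) => // h h' /Ny[] -> /Ny[] ->;
    by rewrite ?(girr sat) ?e1 ?e2 ?e3 // (gsym sat) ?e1 ?e2 ?e3.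
have tau_pos y : deg y = 3 -> 1 < tau2 g y.
  move=> dy; have [p [q [r [_ _ E]]]] := T3 _ dy.
  by have := N y; rewrite /= dy E /=; case: (g p q); case: (g p r); case: (g q r).
case: (pickP [pred x | (deg x == 3) && (tau2 g x == 2)]) => [y /andP[/eqP dy /eqP ty]|N'].
  exact: (dense_tau2 sat deg3 tau_pos dy ty).
apply: (@dense_tau4 _ g sat deg3 _ x dx) => y dy.
have [p [q [r [_ _ E]]]] := T3 _ dy.
by have := N y; have := N' y; rewrite /= dy E /=; case: (g p q); case: (g p r); case: (g q r).
Qed.
End LowerBound.

Lemma num_edges_ge n (g : rel 'I_n) : 1 < n -> K23_saturated g -> 2 * n - 3 <= num_edges g.
Proof.
move=> n1 sat; have := saturated_dense sat; rewrite /dense card_ord => /(_ n1).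
rewrite handshake; [by lia|exact: gsym|exact: girr].
Qed.

(** An upper estimate of the degrees is enough, as every saturated graph already obeys the lower
    bound. *)
Lemma cone_num_edges n (o : 'I_n) (H : rel 'I_n) : 1 < n -> K23_saturated (cone o H) ->
  \sum_x ndeg H x predT <= 2 * (n - 2) -> num_edges (cone o H) = 2 * n - 3.
Proof.
move=> n1 sat S; apply/eqP; rewrite eqn_leq num_edges_ge // andbT.
have := cone_deg o H; rewrite card_ord handshake; [by lia|exact: gsym|exact: girr].
Qed.

(* A cycle on [2, ..., n - 1]; the vertices [0] and [1] are isolated. *)
Definition cyc n : rel 'I_n := fun i j =>
  [&& 1 < i, 1 < j & [|| j == i.+1 :> nat, i == j.+1 :> nat,
    (i == 2 :> nat) && (j == n.-1 :> nat) | (j == 2 :> nat) && (i == n.-1 :> nat)]].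

(* A triangle and an edge, used when the cycle would have length four. *)
Definition tri_edge n : rel 'I_n := fun i j =>
  (i != j :> nat) && (((0 < i < 4) && (0 < j < 4)) || ((3 < i) && (3 < j))).

(** * The extremal graphs *)

Section Cycle.
Variable n : nat.
Hypotheses (n5 : 5 <= n) (n6 : n != 6).

(** Two vertices of a cycle share two neighbours only if they are opposite in a cycle of length
    four, that is, for [n = 6]. *)
Lemma cyc_common (x y z z' : 'I_n) : x != y -> cyc x z -> cyc y z -> cyc x z' -> cyc y z' -> z = z'.
Proof.
move=> xy; have {xy} : x != y :> nat by [].
rewrite /cyc => xy A B C D; apply: val_inj => /=.
have [? [? [? ?]]] := (ltn_ord x, (ltn_ord y, (ltn_ord z, ltn_ord z'))).
lia.
Qed.

Lemma cyc_deg (x : 'I_n) : ndeg (@cyc n) x predT = if x <= 1 then 0 else 2.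
Proof.
case: leqP => x1.
  by apply: eq_card0 => y; rewrite !inE /cyc ltnNge x1.
apply/eqP; rewrite eqn_leq; apply/andP; split.
  rewrite leqNgt; apply/negP => /card_gt2P[a [b [c [[]]]]].
  rewrite !inE !andbT /cyc => A B C [ab bc ca].
  have {ab bc ca} [ab bc ca] : [/\ a != b :> nat, b != c :> nat & c != a :> nat] by [].
  have [? [? [? ?]]] := (ltn_ord x, (ltn_ord a, (ltn_ord b, ltn_ord c))).
  lia.
(* Successor and predecessor of [x] on the cycle, which closes between [n - 1] and [2]. *)
have sn : (if x == n.-1 :> nat then 2 else x.+1) < n by have := ltn_ord x; case: ifP; lia.
have pn : (if x == 2 :> nat then n.-1 else x.-1) < n by have := ltn_ord x; case: ifP; lia.
apply: (@ndeg_ge2 _ _ x predT (Ordinal sn) (Ordinal pn)) => //.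
- by rewrite -val_eqE /=; have := ltn_ord x; case: ifP; case: ifP; lia.
- by rewrite /cyc /=; have := ltn_ord x; case: ifP; lia.
- by rewrite /cyc /=; have := ltn_ord x; case: ifP; lia.
Qed.

Lemma cyc_cone (o : 'I_n) : o = 0 :> nat ->
  K23_saturated (cone o (@cyc n)) /\ num_edges (cone o (@cyc n)) = 2 * n - 3.
Proof.
move=> o0; have sat : K23_saturated (cone o (@cyc n)).
  apply: cone_saturated.
  - by move=> x y; rewrite /cyc; case: (1 < x); case: (1 < y) => //=; lia.
  - by move=> x; rewrite /cyc; have := ltn_ord x; lia.
  - by move=> x; rewrite /cyc o0.
  - by move=> x; rewrite cyc_deg; case: ifP.
  - exact: cyc_common.
  - move=> x y xo yo xy _; rewrite !cyc_deg.
    have : x != y :> nat by []. have : x != o :> nat by []. have : y != o :> nat by [].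
    rewrite o0; case: (leqP x 1); case: (leqP y 1) => //; auto; lia.
split=> //; apply: cone_num_edges => //; first by lia.
under eq_bigr do rewrite cyc_deg.
case: (n) n5 => [|[|m]] // _; rewrite !big_ord_recl /=.
by rewrite sum_nat_const card_ord; lia.
Qed.
End Cycle.

Lemma tri_edge_cone (o : 'I_6) : o = 0 :> nat ->
  K23_saturated (cone o (@tri_edge 6)) /\ num_edges (cone o (@tri_edge 6)) = 2 * 6 - 3.
Proof.
move=> o0.
have nb (x : 'I_6) (a b c : 'I_6) : a != b -> b != c -> c != a -> tri_edge x a -> tri_edge x b ->
    tri_edge x c -> False.
  move=> ab bc ca; have {ab bc ca} : [/\ a != b :> nat, b != c :> nat & c != a :> nat] by [].
  case=> ab bc ca; rewrite /tri_edge => A B C.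
  by have [? [? [? ?]]] := (ltn_ord x, (ltn_ord a, (ltn_ord b, ltn_ord c))); lia.
have sat : K23_saturated (cone o (@tri_edge 6)).
  apply: cone_saturated.
  - by move=> x y; rewrite /tri_edge; lia.
  - by move=> x; rewrite /tri_edge eqxx.
  - by move=> x; rewrite /tri_edge o0; lia.
  - move=> x; rewrite leqNgt; apply/negP => /card_gt2P[a [b [c [[]]]]].
    rewrite !inE !andbT => A B C [ab bc ca]; exact: (nb x a b c).
  - move=> x y z z' xy A B C D; apply: val_inj => /=; have {xy} xy : x != y :> nat by [].
    move: A B C D; rewrite /tri_edge.
    by have [? [? [? ?]]] := (ltn_ord x, (ltn_ord y, (ltn_ord z, ltn_ord z'))); lia.
  - have deg3 (x : 'I_6) : 0 < x < 4 -> 1 < ndeg (@tri_edge 6) x predT.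
      move=> x03; pose s := if x == 1 :> nat then 2 else 1.
      pose t := if x == 3 :> nat then 2 else 3.
      have [s6 t6] : s < 6 /\ t < 6 by rewrite /s /t; split; case: ifP.
      apply: (@ndeg_ge2 _ _ x predT (Ordinal s6) (Ordinal t6)) => //.
      + by rewrite -val_eqE /= /s /t; case: ifP; case: ifP; lia.
      + by rewrite /tri_edge /= /s; case: ifP; lia.
      + by rewrite /tri_edge /= /t; case: ifP; lia.
    move=> x y xo yo xy.
    have : x != y :> nat by []. have : x != o :> nat by []. have : y != o :> nat by [].
    rewrite o0 /tri_edge => y0 x0 xy' N; have [? ?] := (ltn_ord x, ltn_ord y).
    (* The vertices [4] and [5] are adjacent, so one of two nonadjacent vertices lies in the
       triangle. *)
    have [A|A] : 0 < x < 4 \/ 0 < y < 4 by lia.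
      by left; apply: deg3.
    by right; apply: deg3.
split=> //; apply: cone_num_edges => //.
under eq_bigr do rewrite ndegE !big_ord_recl big_ord0.
by rewrite !big_ord_recl big_ord0.
Qed.

Theorem theorem1 (n : nat) (hn : (5 <= n)%N) :
  (forall g : rel 'I_n, K23_saturated g -> (2 * n - 3 <= num_edges g)%N) /\
  (exists g : rel 'I_n, K23_saturated g /\ num_edges g = (2 * n - 3)%N).
Proof.
split; first by move=> g; apply: num_edges_ge; apply: leq_trans hn.
case: (eqVneq n 6) => [->|n6].
  by exists (cone ord0 (@tri_edge 6)); apply: tri_edge_cone.
have n0 : 0 < n by apply: leq_trans hn.
by exists (cone (Ordinal n0) (@cyc n)); apply: cyc_cone.
Qed.
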